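(* Let $n\ge 1$, $m\ge 0$, and let $\Omega\subseteq\mathbb C^{n+m}$ be a domain (not necessarily bounded) which is $n$-star-shaped Hartogs in the first $n$ variables $z=(z_1,\dots,z_n)$; write points of $\mathbb C^{n+m}$ as $(z,z')$ with $z'\in\mathbb C^m$. Let $\alpha=(\alpha_1,\dots,\alpha_n)$ with all $\alpha_j>0$, and put $$U^{\alpha}=\big\{(z,z',w)\in\mathbb C^{n+m}\times\mathbb C:\ (f_\alpha(z,w),z')\in\Omega,\ |w|<1\big\},\qquad f_\alpha(z,w)=\Big(\frac{z_1}{(1-|w|^2)^{\alpha_1/2}},\dots,\frac{z_n}{(1-|w|^2)^{\alpha_n/2}}\Big).$$ For $|\eta|<1$ let $U^\alpha_\eta=\{(z,z')\in\mathbb C^{n+m}:(z,z',\eta)\in U^\alpha\}$, with Bergman kernel $K_{U^\alpha_\eta}$. Define $$h(z,w,\eta)=\Big(z_1\Big(\frac{1-|\eta|^2}{1-w\bar\eta}\Big)^{\alpha_1},\dots,z_n\Big(\frac{1-|\eta|^2}{1-w\bar\eta}\Big)^{\alpha_n}\Big)$$ and the operator (acting on functions of $(z,z',w)$) $$D_{U^\alpha}=\frac{(1-|\eta|^2)^{\alpha\cdot\mathbf 1}}{\pi(1-w\bar\eta)^{2+\alpha\cdot\mathbf 1}}\Big(I+\sum_{j=1}^n\alpha_j\Big(I+z_j\frac{\partial}{\partial z_j}\Big)\Big),$$ where $I$ is the identity and $\alpha\cdot\mathbf 1=\sum_j\alpha_j$. Then for all $(z,z',w;\zeta,\zeta',\eta)\in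 U^\alpha\times U^\alpha$, the Bergman kernel of $U^\alpha$ is $$K_{U^\alpha}(z,z',w;\bar\zeta,\bar\zeta',\bar\eta)=D_{U^\alpha}\Big[K_{U^\alpha_\eta}\big(h(z,w,\eta),z';\bar\zeta,\bar\zeta'\big)\Big].$$
   Context: A domain $\Omega\subseteq\mathbb C^{n+m}$ is called $n$-star-shaped Hartogs in $(z_1,\dots,z_n)$ if $(z_1,\dots,z_n,\zeta)\in\Omega$ implies $(\lambda_1z_1,\dots,\lambda_nz_n,\zeta)\in\Omega$ for all $\lambda_j\in\mathbb C$ with $|\lambda_j|\le1$. The Bergman kernel $K_D(z;\bar\zeta)$ of a domain $D$ is the reproducing kernel of the space $A^2(D)$ of square-integrable holomorphic functions on $D$. Powers of $1-w\bar\eta$ (which has positive real part) are taken with the principal branch. In the formula, the differential operator acts on the function $(z,z',w)\mapsto K_{U^\alpha_\eta}(h(z,w,\eta),z';\bar\zeta,\bar\zeta')$, with $\partial/\partial z_j$ differentiating in the variable $z_j$. *)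

(* Defs.v *)
(* Complex numbers are R[i] (mathcomp-real-closed)
   for an abstract R : realType, viewed as a numClosedFieldType so that
   MathComp-Analysis supplies its topology / normed structure.  Points of
   C^N are row vectors 'rV[C]_N. *)
From mathcomp Require Import all_boot all_algebra.
From mathcomp Require Import all_classical all_reals all_analysis.
From mathcomp Require Import complex.
Import GRing.Theory Num.Theory.
Import numFieldNormedType.Exports.

Set Implicit Arguments.
Unset Strict Implicit.
Unset Printing Implicit Defensive.

Local Open Scope classical_set_scope.
Local Open Scope ring_scope.

Definition Cx (R : realType) : numClosedFieldType := R[i].

Section Bergman.
Variable R : realType.
Local Notation C := (Cx R).

Definition cre (u : C) : R := complex.Re (u : R[i]).
Definition cim (u : C) : R := complex.Im (u : R[i]).
Definition cabs (u : C) : R := Num.sqrt (cre u ^+ 2 + cim u ^+ 2).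
Definition cconj (u : C) : C := (cre u -i* cim u)%C.
Definition creal (x : R) : C := (x +i* 0)%C.

Variable N : nat.

Definition is_domain (D : set 'rV[C]_N) : Prop :=
  D !=set0 /\ open D /\ connected D.

Definition evec (j : 'I_N) : 'rV[C]_N := delta_mx 0 j.

Definition holomorphic_on (D : set 'rV[C]_N) (f : 'rV[C]_N -> C) : Prop :=
  open D /\
  forall z, D z ->
    {for z, continuous f} /\ forall j : 'I_N, derivable f z (evec j).

Definition upd (v : 'rV[C]_N) (i : 'I_N) (c : C) : 'rV[C]_N :=
  \row_k (if k == i then c else v 0 k).

(* iterated Lebesgue integral over the real and imaginary parts of the
   coordinates listed in l (Tonelli: for nonnegative Borel g this is the
   integral w.r.t. the 2N-dimensional Lebesgue measure). *)
Fixpoint iter_int (l : seq 'I_N) (g : 'rV[C]_N -> \bar R) (v : 'rV[C]_N)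
  : \bar R :=
  match l with
  | [::] => g v
  | i :: l' =>
      (\int[@lebesgue_measure R]_x
         \int[@lebesgue_measure R]_y iter_int l' g (upd v i (x +i* y)%C))%E
  end.

Definition vol_int (g : 'rV[C]_N -> \bar R) : \bar R :=
  iter_int (enum 'I_N) g 0.

Definition real_int (u : 'rV[C]_N -> R) : R :=
  fine (vol_int (fun v => (Num.max (u v) 0)%:E)) -
  fine (vol_int (fun v => (Num.max (- u v) 0)%:E)).

Definition cint (D : set 'rV[C]_N) (h : 'rV[C]_N -> C) : C :=
  (real_int (fun v => \1_D v * cre (h v)) +i*
   real_int (fun v => \1_D v * cim (h v)))%C.

Definition square_integrable (D : set 'rV[C]_N) (f : 'rV[C]_N -> C) : Prop :=
  (vol_int (fun v => (\1_D v * cabs (f v) ^+ 2)%:E) < +oo)%E.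

Definition A2 (D : set 'rV[C]_N) (f : 'rV[C]_N -> C) : Prop :=
  holomorphic_on D f /\ square_integrable D f.

(* K is the Bergman kernel of D: K z zeta stands for K_D(z; conj zeta).
   K(., zeta) lies in A^2(D) and reproduces every f in A^2(D):
   f(zeta) = int_D f(z) conj(K(z, zeta)) dV(z). *)
Definition is_bergman_kernel (D : set 'rV[C]_N)
    (K : 'rV[C]_N -> 'rV[C]_N -> C) : Prop :=
  (forall zeta, D zeta -> A2 D (fun z => K z zeta)) /\
  (forall f, A2 D f -> forall zeta, D zeta ->
     f zeta = cint D (fun z => f z * cconj (K z zeta))).

End Bergman.

Section Powers.
Variable R : realType.
Local Notation C := (Cx R).

(* principal argument in (-pi, pi) on C \ (-oo, 0] *)
Definition carg (u : C) : R :=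
  2 * atan (cim u / (cabs u + cre u)).

(* principal power u^a = exp(a Log u), for u off the closed negative real
   axis (in particular whenever Re u > 0) *)
Definition cpow (u : C) (a : R) : C :=
  creal (cabs u `^ a) * (cos (a * carg u) +i* sin (a * carg u))%C.
End Powers.

Section Hartogs.
Variable R : realType.
Local Notation C := (Cx R).
Variables n m : nat.

Definition nstar_hartogs (Omega : set 'rV[C]_(n + m)) : Prop :=
  forall (z : 'rV[C]_n) (z' : 'rV[C]_m) (lam : 'rV[C]_n),
    Omega (row_mx z z') ->
    (forall j, cabs (lam 0 j) <= 1) ->
    Omega (row_mx (\row_j (lam 0 j * z 0 j)) z').

Variable alpha : 'I_n -> R.

Definition f_alpha (z : 'rV[C]_n) (w : C) : 'rV[C]_n :=
  \row_j (z 0 j / creal ((1 - cabs w ^+ 2) `^ (alpha j / 2))).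

Definition zof (p : 'rV[C]_(n + m + 1)) : 'rV[C]_n := lsubmx (lsubmx p).
Definition z'of (p : 'rV[C]_(n + m + 1)) : 'rV[C]_m := rsubmx (lsubmx p).
Definition wof (p : 'rV[C]_(n + m + 1)) : C := rsubmx p 0 0.
Definition pt (z : 'rV[C]_n) (z' : 'rV[C]_m) (w : C) : 'rV[C]_(n + m + 1) :=
  row_mx (row_mx z z') (const_mx w).

Definition U_alpha (Omega : set 'rV[C]_(n + m)) : set 'rV[C]_(n + m + 1) :=
  fun p => Omega (row_mx (f_alpha (zof p) (wof p)) (z'of p)) /\
           cabs (wof p) < 1.

Definition U_alpha_eta (Omega : set 'rV[C]_(n + m)) (eta : C)
  : set 'rV[C]_(n + m) :=
  fun q => U_alpha Omega (row_mx q (const_mx eta)).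

Definition h_map (z : 'rV[C]_n) (w eta : C) : 'rV[C]_n :=
  \row_j (z 0 j *
          cpow (creal (1 - cabs eta ^+ 2) / (1 - w * cconj eta)) (alpha j)).

Definition alpha_sum : R := \sum_(j < n) alpha j.

Definition zdir (j : 'I_n) : 'rV[C]_(n + m + 1) :=
  @evec R _ (lshift 1 (lshift m j)).

Definition D_op (eta : C) (F : 'rV[C]_(n + m + 1) -> C)
    (p : 'rV[C]_(n + m + 1)) : C :=
  creal ((1 - cabs eta ^+ 2) `^ alpha_sum) /
    (creal pi * cpow (1 - wof p * cconj eta) (2 + alpha_sum)) *
  (F p + \sum_(j < n)
           creal (alpha j) * (F p + zof p 0 j * 'D_(zdir j) F p)).

End Hartogs.

(* Main.v *)
Require Import Defs.
From mathcomp Require Import all_boot all_order all_algebra.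
From mathcomp Require Import all_classical all_reals all_analysis.
From mathcomp Require Import measurable_realfun complex ring lra.
Import Order.TTheory GRing.Theory Num.Theory.
Import numFieldNormedType.Exports.
Set Implicit Arguments.
Unset Strict Implicit.
Unset Printing Implicit Defensive.
Local Open Scope classical_set_scope.
Local Open Scope ring_scope.

(* Write (zeta, eta) for the second point, F for the kernel of U at (., p), G for the kernel of the
   slice U_eta at (., zeta), T_x for the scaling z_j |-> x^alpha_j z_j, and
   lambda(w) = (1 - |w|^2) / (1 - conj w eta). The slice over w is the image of U_eta under a diagonal
   map, and the kernel of a Hartogs star-shaped set satisfies K(M z, q) = K(z, M^* q) for diagonal
   contractions M, so the reproducing property on the slices, integrated over w, gives for
   0 < s <= 1 and Phi_s(z, w) = c(w) G(T_s h(z, w, eta)), c being the coefficient of D_U,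
     conj Phi_s(p) = 1/pi int_{|w|<1} (1 - conj w eta)^-2 lambda^|alpha| F(T_{s lambda} zeta, w) dA(w).
   The right-hand side of the formula is the derivative of s^(1+|alpha|) Phi_s(p) at s = 1. Under the
   integral this derivative is (d/d conj w) v / (eta - w) with
   v(w) = lambda^(1+|alpha|) F(T_lambda zeta, w), which vanishes on |w| = 1, so the Cauchy-Pompeiu
   formula evaluates the integral to v(eta) = F(zeta, eta), the conjugate of the left-hand side. *)

(** * Complex numbers and pointwise continuity *)

(** The operator in [D_op] is [(1 + |alpha|) I + sum alpha_j z_j d_j], the generator of
    [s |-> s^(1 + |alpha|) G o T_s]; hence the weight. The differentiation is what creates a point
    evaluation: before it, the integrand has nothing singular at [eta]. Since [F] is holomorphic,
    [conj w] enters [v] only through [lambda], whose derivative [(eta - w) / (1 - conj w eta)^2]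
    cancels the Cauchy kernel, so every integrand stays continuous. [T_s] contracts the slices only
    for [s <= 1], so the integral formula gives a one-sided derivative; this is enough because
    [s^(1 + |alpha|) Phi_s(p)] is known to be complex differentiable at [s = 1]. The circle
    [|w| = 1] is delicate: [lambda] vanishes there, its powers are only known to be continuous, and
    [F] has to be replaced by a continuation. Volume is an iterated integral with no measure on row
    vectors behind it, so measurability must be carried through each partial integration, and square
    integrability on [U] passes to almost every slice only. *)

Section ComplexBasics.
Variable R : realType.
Local Notation C := (Cx R).
Implicit Types (z w : C) (x y : R).

Lemma complex_eqP z w : cre z = cre w -> cim z = cim w -> z = w.
Proof. by case: z w => [a b] [c d]; rewrite /cre /cim /= => -> ->. Qed.

Lemma creD z w : cre (z + w) = cre z + cre w. Proof. by case: z w => [? ?] [? ?]. Qed.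
Lemma cimD z w : cim (z + w) = cim z + cim w. Proof. by case: z w => [? ?] [? ?]. Qed.
Lemma creN z : cre (- z) = - cre z. Proof. by case: z. Qed.
Lemma cimN z : cim (- z) = - cim z. Proof. by case: z. Qed.
Lemma creB z w : cre (z - w) = cre z - cre w. Proof. by rewrite creD creN. Qed.
Lemma cimB z w : cim (z - w) = cim z - cim w. Proof. by rewrite cimD cimN. Qed.
Lemma creM z w : cre (z * w) = cre z * cre w - cim z * cim w.
Proof. by case: z w => [? ?] [? ?]. Qed.
Lemma cimM z w : cim (z * w) = cre z * cim w + cim z * cre w.
Proof. by case: z w => [? ?] [? ?]. Qed.
Lemma cre0 : cre (0 : C) = 0. Proof. by []. Qed.
Lemma cim0 : cim (0 : C) = 0. Proof. by []. Qed.
Lemma cre1 : cre (1 : C) = 1. Proof. by []. Qed.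
Lemma cim1 : cim (1 : C) = 0. Proof. by []. Qed.
Lemma cre_creal x : cre (creal x) = x. Proof. by []. Qed.
Lemma cim_creal x : cim (creal x) = 0. Proof. by []. Qed.
Lemma cre_mk x y : cre ((x +i* y)%C : C) = x. Proof. by []. Qed.
Lemma cim_mk x y : cim ((x +i* y)%C : C) = y. Proof. by []. Qed.
Lemma cre_conj z : cre (cconj z) = cre z. Proof. by []. Qed.
Lemma cim_conj z : cim (cconj z) = - cim z. Proof. by []. Qed.
Definition cE := (creD, cimD, creN, cimN, creM, cimM, cre_creal, cim_creal, cre_mk, cim_mk, cre_conj, cim_conj, cre0, cim0, cre1, cim1).

Lemma cconjD z w : cconj (z + w) = cconj z + cconj w.
Proof. by apply: complex_eqP; rewrite !cE; ring. Qed.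
Lemma cconjN z : cconj (- z) = - cconj z.
Proof. by apply: complex_eqP; rewrite !cE; ring. Qed.
Lemma cconjB z w : cconj (z - w) = cconj z - cconj w.
Proof. by rewrite cconjD cconjN. Qed.
Lemma cconjM z w : cconj (z * w) = cconj z * cconj w.
Proof. by apply: complex_eqP; rewrite !cE; ring. Qed.
Lemma cconjK z : cconj (cconj z) = z.
Proof. by apply: complex_eqP; rewrite !cE; ring. Qed.
Lemma cconj_creal x : cconj (creal x) = creal x.
Proof. by apply: complex_eqP; rewrite !cE ?oppr0. Qed.
Lemma cconj1 : cconj (1 : C) = 1.
Proof. by apply: complex_eqP; rewrite !cE ?oppr0. Qed.
Lemma cconj0 : cconj (0 : C) = 0.
Proof. by apply: complex_eqP; rewrite !cE ?oppr0. Qed.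

Lemma crealD x y : creal (x + y) = creal x + creal y.
Proof. by apply: complex_eqP; rewrite !cE; ring. Qed.
Lemma crealN x : creal (- x) = - creal x.
Proof. by apply: complex_eqP; rewrite !cE; ring. Qed.
Lemma crealB x y : creal (x - y) = creal x - creal y.
Proof. by rewrite crealD crealN. Qed.
Lemma crealM x y : creal (x * y) = creal x * creal y.
Proof. by apply: complex_eqP; rewrite !cE; ring. Qed.
Lemma creal1 : creal 1 = 1 :> C. Proof. by []. Qed.
Lemma creal0 : creal 0 = 0 :> C. Proof. by []. Qed.
Lemma crealX x n : creal (x ^+ n) = creal x ^+ n.
Proof. by elim: n => [//|n IH]; rewrite !exprS crealM IH. Qed.
Lemma creal_eq0 x : (creal x == 0 :> C) = (x == 0).
Proof. by apply/eqP/eqP => [[->]|->]. Qed.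
Lemma crealV x : creal x^-1 = (creal x)^-1.
Proof.
have [->|x0] := eqVneq x 0; first by rewrite invr0 !creal0 invr0.
apply: (@mulIf _ (creal x)); first by rewrite creal_eq0.
by rewrite mulVf ?creal_eq0// -crealM mulVf.
Qed.

Lemma normCE z : `|z| = creal (cabs z).
Proof. by rewrite (normc_def z). Qed.
Lemma ltcrealE x y : (creal x < creal y) = (x < y).
Proof. exact: ltcR. Qed.
Lemma lecrealE x y : (creal x <= creal y) = (x <= y).
Proof. exact: lecR. Qed.
(** The norm of [C] takes values in [C], so radii of balls are complex numbers; a positive one is
    real, which lets neighbourhoods be described below with radii in [R]. *)
Lemma ltC0_creal (e : C) : 0 < e -> exists2 x : R, 0 < x & e = creal x.
Proof.
move=> e0; have E : e = creal (cre e).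
  move: e0; rewrite ltcE => /andP[/eqP h _]; apply: complex_eqP; rewrite !cE //.
by exists (cre e) => //; rewrite -ltcrealE -E creal0.
Qed.

Lemma cabsM z w : cabs (z * w) = cabs z * cabs w.
Proof. by have := normrM z w; rewrite !normCE -crealM => -[]. Qed.
Lemma cabs_ge0 z : 0 <= cabs z. Proof. exact: sqrtr_ge0. Qed.
Lemma cabs0 : cabs (0 : C) = 0.
Proof. by rewrite /cabs !cE expr0n addr0 sqrtr0. Qed.
Lemma cabs1 : cabs (1 : C) = 1.
Proof. by rewrite /cabs !cE expr0n addr0 expr1n sqrtr1. Qed.
Lemma cabsD z w : cabs (z + w) <= cabs z + cabs w.
Proof. by have := ler_normD z w; rewrite !normCE -crealD lecrealE. Qed.
Lemma cabsN z : cabs (- z) = cabs z.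
Proof. by rewrite /cabs !cE !sqrrN. Qed.
Lemma cabs_distC z w : cabs (z - w) = cabs (w - z).
Proof. by rewrite -cabsN opprB. Qed.
Lemma cabsB z w : cabs (z - w) <= cabs z + cabs w.
Proof. by rewrite (le_trans (cabsD _ _))// cabsN. Qed.
Lemma cabs_conj z : cabs (cconj z) = cabs z.
Proof. by rewrite /cabs !cE !sqrrN. Qed.
Lemma cabs_eq0 z : (cabs z == 0) = (z == 0).
Proof. by rewrite -(normr_eq0 z) normCE creal_eq0. Qed.
Lemma cabs_gt0 z : (0 < cabs z) = (z != 0).
Proof. by rewrite lt_def cabs_eq0 cabs_ge0 andbT. Qed.
Lemma cabs_creal x : cabs (creal x) = `|x|.
Proof. by rewrite /cabs !cE expr0n addr0 sqrtr_sqr. Qed.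
Lemma cabsV z : cabs z^-1 = (cabs z)^-1.
Proof. by have := normfV z; rewrite !normCE -crealV => -[]. Qed.
Lemma sqr_cabs z : cabs z ^+ 2 = cre z ^+ 2 + cim z ^+ 2.
Proof. by rewrite sqr_sqrtr// addr_ge0// sqr_ge0. Qed.
Lemma mulCconj z : z * cconj z = creal (cabs z ^+ 2).
Proof. by apply: complex_eqP; rewrite sqr_cabs !cE; ring. Qed.
Lemma cre_le z : `|cre z| <= cabs z.
Proof. by rewrite -sqrtr_sqr ler_wsqrtr// lerDl sqr_ge0. Qed.
Lemma cim_le z : `|cim z| <= cabs z.
Proof. by rewrite -sqrtr_sqr ler_wsqrtr// lerDr sqr_ge0. Qed.
Lemma cabs_le z : cabs z <= `|cre z| + `|cim z|.
Proof.
rewrite -[leRHS]ger0_norm ?addr_ge0// -sqrtr_sqr ler_wsqrtr// -(real_normK (num_real (cre z))) -(real_normK (num_real (cim z))).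
have := mulr_ge0 (normr_ge0 (cre z)) (normr_ge0 (cim z)); nra.
Qed.
Lemma cconjV z : cconj z^-1 = (cconj z)^-1.
Proof.
have [->|z0] := eqVneq z 0; first by rewrite invr0 cconj0 invr0.
have z0' : cconj z != 0 by rewrite -cabs_eq0 cabs_conj cabs_eq0.
by apply: (mulIf z0'); rewrite mulVf// -cconjM mulVf// cconj1.
Qed.

Lemma nbhsCP z (P : set C) :
  nbhs z P <-> exists2 e : R, 0 < e & forall w, cabs (w - z) < e -> P w.
Proof.
split.
  move=> /nbhs_ballP[e /= /ltC0_creal[x x0 ->]] h; exists x => // w wz; apply: h.
  by rewrite -ball_normE /= normCE ltcrealE cabs_distC.
move=> [e e0 h]; apply/nbhs_ballP; exists (creal e); first by rewrite /= ltcrealE.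
by move=> w; rewrite -ball_normE /= normCE ltcrealE cabs_distC; exact: h.
Qed.

Lemma nbhs_rVP N (v : 'rV[C]_N) (P : set 'rV[C]_N) :
  nbhs v P <-> exists2 e : R, 0 < e &
    forall w : 'rV[C]_N, (forall k, cabs (w 0 k - v 0 k) < e) -> P w.
Proof.
split.
  move=> /nbhs_ballP[e /= /ltC0_creal[x x0 ->]] h; exists x => // w wz; apply: h.
  split => [|i j]; first by rewrite ltcrealE.
  by rewrite (ord1 i) -ball_normE /= normCE ltcrealE cabs_distC.
move=> [e e0 h]; apply/nbhs_ballP; exists (creal e); first by rewrite /= ltcrealE.
move=> w [_ vw]; apply: h => k; have := vw 0 k.
by rewrite -ball_normE /= normCE ltcrealE cabs_distC.
Qed.

Lemma cvgCP (T : Type) (F : set_system T) {FF : Filter F} (f : T -> C) (l : C) :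
  f @ F --> l <-> forall e : R, 0 < e -> \forall t \near F, cabs (f t - l) < e.
Proof.
split=> [fl e e0|h].
  have /fl : nbhs l [set w | cabs (w - l) < e] by apply/nbhsCP; exists e.
  by [].
by move=> P /nbhsCP[e e0 eP]; apply: filterS (h e e0) => t; exact: eP.
Qed.

Lemma cvgC_epsP (f : C -> C) z l :
  f @ z --> l <-> forall e : R, 0 < e -> exists2 r : R, 0 < r & forall w, cabs (w - z) < r -> cabs (f w - l) < e.
Proof.
split=> [/cvgCP h e /h/nbhsCP//|h].
by apply: (proj2 (@cvgCP C (nbhs z) _ f l)) => e /h; move=> [r r0 hr]; apply/nbhsCP; exists r.
Qed.

Lemma cvg_rVP N (T : Type) (F : set_system T) {FF : Filter F} (f : T -> 'rV[C]_N) (l : 'rV[C]_N) :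
  f @ F --> l <-> forall k, (fun t => f t 0 k) @ F --> l 0 k.
Proof.
split=> [fl k|h].
  exact: (cvg_comp _ _ fl (@coord_continuous _ 1 N 0 k l)).
move=> P /nbhs_rVP[e e0 eP].
have : \forall t \near F, forall k, cabs (f t 0 k - l 0 k) < e.
  have := @filter_forall T 'I_N (fun k t => cabs (f t 0 k - l 0 k) < e) F FF.
  by apply => k; have /cvgCP := h k; apply.
by apply: filterS => t; exact: eP.
Qed.

Lemma cvg_creimP (T : Type) (F : set_system T) {FF : Filter F} (f : T -> C) (l : C) :
  f @ F --> l <-> ((fun t => cre (f t)) @ F --> cre l) /\ ((fun t => cim (f t)) @ F --> cim l).
Proof.
split=> [/cvgCP h|[/cvgrPdist_lt h1 /cvgrPdist_lt h2]].
  split; apply/cvgrPdist_lt => e e0; near=> t.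
    rewrite distrC -creB (le_lt_trans (cre_le _))//; near: t; exact: h.
  rewrite distrC -cimB (le_lt_trans (cim_le _))//; near: t; exact: h.
apply/cvgCP => e e0; near=> t.
rewrite (le_lt_trans (cabs_le _))// creB cimB [e]splitr ltrD//.
  by rewrite distrC; near: t; apply: h1; rewrite divr_gt0.
by rewrite distrC; near: t; apply: h2; rewrite divr_gt0.
Unshelve. all: by end_near. Qed.

Lemma cre_continuous : continuous (@cre R : C -> R).
Proof. by move=> z; have /cvg_creimP[] := @cvg_id _ (nbhs z). Qed.
Lemma cim_continuous : continuous (@cim R : C -> R).
Proof. by move=> z; have /cvg_creimP[] := @cvg_id _ (nbhs z). Qed.
Lemma cabs_cvg (T : Type) (F : set_system T) {FF : Filter F} (f : T -> C) (l : C) :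
  f @ F --> l -> (fun t => cabs (f t)) @ F --> cabs l.
Proof.
move=> /cvgCP h; apply/cvgrPdist_lt => e e0; near=> t.
have h1 : cabs (f t - l) < e by near: t; exact: h.
rewrite (le_lt_trans _ h1)// ler_norml; apply/andP; split.
  by rewrite lerNl opprB lerBlDl -[in leLHS](subrK l (f t)) addrC cabsD.
by rewrite lerBlDl -[in leLHS](subrK (f t) l) addrC (le_trans (cabsD _ _))// lerD2l cabs_distC.
Unshelve. all: by end_near. Qed.
Lemma mk_cvg (T : Type) (F : set_system T) {FF : Filter F} (f g : T -> R) a b :
  f @ F --> a -> g @ F --> b -> (fun t => (f t +i* g t)%C : C) @ F --> ((a +i* b)%C : C).
Proof. by move=> fa gb; apply/cvg_creimP. Qed.

(* Pointwise continuity, kept opaque to unification: without it the neighbourhood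
   filter of [Cx R] gets unfolded before [Filter] instances are looked for. *)
Definition ccont (T : topologicalType) (f : T -> C) (t : T) : Prop := f @ t --> f t.
Definition rcont (T : topologicalType) (u : T -> R) (t : T) : Prop := u @ t --> u t.

Section Continuity.
Variable T : topologicalType.
Implicit Types (f g : T -> C) (u v : T -> R) (t s : T).

Lemma ccont_cst (a : C) t : ccont (fun=> a) t. Proof. exact: cvg_cst. Qed.
Lemma ccontD f g t : ccont f t -> ccont g t -> ccont (fun s => f s + g s) t.
Proof. exact: cvgD. Qed.
Lemma ccontB f g t : ccont f t -> ccont g t -> ccont (fun s => f s - g s) t.
Proof. exact: cvgB. Qed.
Lemma ccontN f t : ccont f t -> ccont (fun s => - f s) t.
Proof. exact: cvgN. Qed.
Lemma ccontM f g t : ccont f t -> ccont g t -> ccont (fun s => f s * g s) t.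
Proof. exact: cvgM. Qed.
Lemma ccontV f t : f t != 0 -> ccont f t -> ccont (fun s => (f s)^-1) t.
Proof. by move=> f0 cf; apply: cvgV. Qed.
Lemma ccont_creimP f t : ccont f t <-> rcont (fun s => cre (f s)) t /\ rcont (fun s => cim (f s)) t.
Proof. exact: cvg_creimP. Qed.
Lemma rcont_re f t : ccont f t -> rcont (fun s => cre (f s)) t.
Proof. by move=> /ccont_creimP[]. Qed.
Lemma rcont_im f t : ccont f t -> rcont (fun s => cim (f s)) t.
Proof. by move=> /ccont_creimP[]. Qed.
Lemma ccont_mk u v t : rcont u t -> rcont v t -> ccont (fun s => (u s +i* v s)%C : C) t.
Proof. by move=> cu cv; apply/ccont_creimP. Qed.
Lemma ccont_creal u t : rcont u t -> ccont (fun s => creal (u s)) t.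
Proof. by move=> cu; apply: ccont_mk => //; exact: cvg_cst. Qed.
Lemma rcont_cabs f t : ccont f t -> rcont (fun s => cabs (f s)) t.
Proof. exact: cabs_cvg. Qed.
Lemma rcont_cst (a : R) t : rcont (fun=> a) t. Proof. exact: cvg_cst. Qed.
Lemma rcontD u v t : rcont u t -> rcont v t -> rcont (fun s => u s + v s) t.
Proof. exact: cvgD. Qed.
Lemma rcontN u t : rcont u t -> rcont (fun s => - u s) t.
Proof. exact: cvgN. Qed.
Lemma rcontB u v t : rcont u t -> rcont v t -> rcont (fun s => u s - v s) t.
Proof. exact: cvgB. Qed.
Lemma rcontM u v t : rcont u t -> rcont v t -> rcont (fun s => u s * v s) t.
Proof. exact: cvgM. Qed.
Lemma rcontV u t : u t != 0 -> rcont u t -> rcont (fun s => (u s)^-1) t.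
Proof. by move=> u0 cu; apply: cvgV. Qed.
Lemma rcontX u n t : rcont u t -> rcont (fun s => u s ^+ n) t.
Proof.
move=> cu; elim: n => [|n IH]; first exact: rcont_cst.
by have := rcontM cu IH; rewrite /rcont exprS; under eq_fun do rewrite -exprS.
Qed.
Lemma ccont_conj f t : ccont f t -> ccont (fun s => cconj (f s)) t.
Proof.
move=> /ccont_creimP[h1 h2]; apply: ccont_mk; first exact: h1.
exact: (rcontN h2).
Qed.
Lemma ccont_sum (I : Type) (r : seq I) (P : pred I) (f : I -> T -> C) t :
  (forall i, P i -> ccont (f i) t) -> ccont (fun s => \sum_(i <- r | P i) f i s) t.
Proof.
move=> h; rewrite /ccont; elim: r => [|i r IH].
  by rewrite big_nil; under eq_fun do rewrite big_nil; exact: ccont_cst.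
rewrite big_cons; under eq_fun do rewrite big_cons.
case: ifP => Pi; last exact: IH.
by apply: cvgD; [exact: h|exact: IH].
Qed.
Lemma eq_ccont f g t : (forall s, f s = g s) -> ccont g t -> ccont f t.
Proof. by move=> /funext ->. Qed.
Lemma ccont_near f g t : (\forall s \near t, f s = g s) -> ccont f t -> ccont g t.
Proof.
move=> fg; rewrite /ccont (nbhs_singleton fg) => cf.
by apply: cvg_trans cf; exact: near_eq_cvg.
Qed.
End Continuity.

Lemma ccont_id (z : C) : ccont (fun w => w) z. Proof. exact: cvg_id. Qed.
Lemma rcont_id (x : R) : rcont (fun y => y) x. Proof. exact: cvg_id. Qed.
Lemma ccont_comp (T U : topologicalType) (h : T -> U) (f : U -> C) t :
  h @ t --> h t -> ccont f (h t) -> ccont (fun s => f (h s)) t.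
Proof. by move=> ch cf; exact: (cvg_comp _ _ ch cf). Qed.
Lemma rcont_comp (T U : topologicalType) (h : T -> U) (f : U -> R) t :
  h @ t --> h t -> rcont f (h t) -> rcont (fun s => f (h s)) t.
Proof. by move=> ch cf; exact: (cvg_comp _ _ ch cf). Qed.
Lemma ccont_compC (T : topologicalType) (h : T -> C) (f : C -> C) t :
  ccont h t -> ccont f (h t) -> ccont (fun s => f (h s)) t.
Proof. exact: ccont_comp. Qed.
Lemma ccont_compR (T : topologicalType) (u : T -> R) (f : R -> C) t :
  rcont u t -> ccont f (u t) -> ccont (fun s => f (u s)) t.
Proof. exact: ccont_comp. Qed.
Lemma rcont_compR (T : topologicalType) (u : T -> R) (f : R -> R) t :
  rcont u t -> rcont f (u t) -> rcont (fun s => f (u s)) t.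
Proof. exact: rcont_comp. Qed.
Lemma ccont_epsP (f : C -> C) z : ccont f z <->
  forall e : R, 0 < e -> exists2 r : R, 0 < r & forall w, cabs (w - z) < r -> cabs (f w - f z) < e.
Proof. exact: cvgC_epsP. Qed.
Lemma ccont_coord N (v : 'rV[C]_N) j : ccont (fun w : 'rV[C]_N => w 0 j) v.
Proof. exact: coord_continuous. Qed.

End ComplexBasics.

(** * Iterated integrals of lower semicontinuous functions *)

Section RealIntegration.
Variable R : realType.
Local Notation mu := (@lebesgue_measure R).
Local Open Scope ereal_scope.

(** Lebesgue measure is characterised by its values on half-open intervals, and the pushforward
    along [phi], weighted by [|a|], has the same values there. *)
Lemma ge0_integral_affine (a b : R) (f : R -> \bar R) : a != 0%R ->
  measurable_fun [set: R] f -> (forall x, 0 <= f x) ->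
  `|a|%:E * \int[mu]_x f (a * x + b)%R = \int[mu]_x f x.
Proof.
move=> a0 mf f0.
pose phi : measurableTypeR R -> measurableTypeR R := fun x => (a * x + b)%R.
have mphi : measurable_fun setT phi.
  by apply: continuous_measurable_fun => x; apply: cvgD; [apply: cvgM; [exact: cvg_cst|exact: cvg_id]|exact: cvg_cst].
pose k : {nonneg R} := NngNum (normr_ge0 a).
pose nu1 : {measure set (measurableTypeR R) -> \bar R} := measure_function_pushforward__canonical__measure_function_Measure mu mphi.
pose nu : {measure set (measurableTypeR R) -> \bar R} := mscale k nu1.
have nuE A : nu A = `|a|%:E * mu (phi @^-1` A) by [].
have H : forall A, measurable A -> mu A = nu A.
  apply: lebesgue_measure_unique => _ [[u v]] _ <-; rewrite nuE /=.
  have [a_gt0|a_le0] := ltP 0%R a.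
    have -> : phi @^-1` `]u, v] = `]((u - b) / a)%R, ((v - b) / a)%R]%classic.
      apply/seteqP; split => x /=; rewrite !in_itv /= /phi ltr_pdivrMr// ler_pdivlMr// ltrBlDr lerBrDr mulrC //.
    rewrite !lebesgue_measure_itv /= !lte_fin ltr_pM2r ?invr_gt0// ltrD2r.
    case: ifP => _; last by rewrite mule0.
    rewrite -!EFinB -EFinM gtr0_norm//; congr EFin; field; exact: a0.
  (* A negative slope reverses the interval, so the preimage of []u, v]] is closed at its left
     end. *)
  have a_lt0 : (a < 0)%R by rewrite lt_neqAle a0.
  have -> : phi @^-1` `]u, v] = `[((v - b) / a)%R, ((u - b) / a)%R[%classic.
    by apply/seteqP; split => x /=; rewrite !in_itv /= /phi ler_ndivrMr// ltr_ndivlMr// lerBrDr ltrBlDr mulrC andbC.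
  rewrite !lebesgue_measure_itv /= !lte_fin ltr_nM2r ?invr_lt0// ltrD2r.
  case: ifP => _; last by rewrite mule0.
  by rewrite -!EFinB -EFinM ltr0_norm//; congr EFin; field; exact: a0.
rewrite [RHS](_ : _ = \int[nu]_x f x); last first.
  by apply: eq_measure_integral => A mA _; exact: H.
rewrite [RHS](@ge0_integral_mscale _ _ R nu1 setT measurableT k f mf (fun x _ => f0 x)) /=.
rewrite (ge0_integral_pushforward mphi mu measurableT mf) ?preimage_setT//.
Qed.

(** The product sigma-algebra contains boxes, and an open set is the union of the countably many
    rational boxes that it contains. *)
Lemma open_measurable_prod (U : set (R * R)) : open U ->
  measurable (U : set (measurableTypeR R * measurableTypeR R)).
Proof.
move=> oU.
pose box (p : rat * rat * rat * rat) : set (measurableTypeR R * measurableTypeR R) :=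
  let: (a, b, c, d) := p in `]ratr a, ratr b[%classic `*` `]ratr c, ratr d[%classic.
have -> : U = \bigcup_p (if `[< box p `<=` U >] then box p else set0).
  apply/seteqP; split => [[x y] Uxy|[x y] [p _]]; last by case: asboolP => // + h; apply.
  have := oU; rewrite openE => /(_ _ Uxy) [[A B] /= [nA nB] AB].
  have [e1 /= e10 h1] := (proj1 (nbhs_ballP _ _) nA).
  have [e2 /= e20 h2] := (proj1 (nbhs_ballP _ _) nB).
  have rr (z e : R) : (0 < e)%R -> exists a b : rat, [/\ (ratr a < z)%R, (z < ratr b)%R,
     (z - e < ratr a)%R & (ratr b < z + e)%R].
    move=> e0; have [a] := @rat_in_itvoo R (z - e)%R z ltac:(lra).
    rewrite in_itv /= => /andP[ha1 ha2].
    have [b] := @rat_in_itvoo R z (z + e)%R ltac:(lra).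
    rewrite in_itv /= => /andP[hb1 hb2].
    by exists a, b.
  have [a [b [xa xb xa' xb']]] := rr x e1 e10.
  have [c [d [yc yd yc' yd']]] := rr y e2 e20.
  exists (a, b, c, d) => //; case: asboolP => [_|]; first by split => /=; rewrite in_itv /= ?xa ?xb ?yc ?yd.
  case=> -[s t] [/=]; rewrite !in_itv /= => /andP[s1 s2] /andP[t1 t2].
  apply: (AB (s,t)); split => /=.
    by apply: h1; rewrite -ball_normE /= ltr_distlC; apply/andP; split; lra.
  by apply: h2; rewrite -ball_normE /= ltr_distlC; apply/andP; split; lra.
apply: countable_bigcupT_measurable; first exact: countableP.
move=> -[[[a b] c] d]; case: ifP => _ //.
by apply: measurableX; exact: measurable_itv.
Qed.

Lemma lsc_measurable_prod (f : R * R -> \bar R) : lower_semicontinuous f ->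
  measurable_fun (setT : set (measurableTypeR R * measurableTypeR R)) f.
Proof.
move=> scif; apply: (measurability _ (ErealGenOInfty.measurableE R)).
move=> /= _ [_ [a ->]] <-; apply: measurableI => //; apply: open_measurable_prod.
by rewrite preimage_itvoy; move/lower_semicontinuousP : scif; exact.
Qed.

Lemma continuous_measurable_prod (f : R * R -> R) : continuous f ->
  measurable_fun (setT : set (measurableTypeR R * measurableTypeR R)) f.
Proof.
move=> cf; apply: (measurability _ (RGenOInfty.measurableE R)).
move=> /= _ [_ [a ->]] <-; apply: measurableI => //; apply: open_measurable_prod.
by move/continuousP : cf; apply; exact: interval_open.
Qed.

End RealIntegration.

Section LscIntegral.
Variables (R : realType) (N : nat).
Local Notation C := (Cx R).
Local Notation mu := (@lebesgue_measure R).
Local Open Scope ereal_scope.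

Lemma lee_lt_real (x y : \bar R) : (forall b : R, b%:E < x -> b%:E <= y) -> x <= y.
Proof.
move=> h; rewrite leNgt; apply/negP => yx.
case: x y h yx => [x| |] [y| |] //= h yx.
- have := h ((x + y) / 2)%R; rewrite lee_fin lte_fin; move: yx; rewrite lte_fin; lra.
- by have := h (x - 1)%R; rewrite lte_fin leeNy_eq => /(_ ltac:(lra)).
- by have := h (y + 1)%R (ltry _); rewrite lee_fin; lra.
- by have := h 0%R (ltry _); rewrite leeNy_eq.
Qed.

Lemma lsc_comp (X Y : topologicalType) (g : Y -> \bar R) (h : X -> Y) :
  lower_semicontinuous g -> continuous h -> lower_semicontinuous (g \o h).
Proof.
move=> lg ch x a agx; have [V nV Va] := lg _ _ agx.
exists (h @^-1` V); first exact: ch.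
by move=> y; exact: Va.
Qed.

(* Fatou's lemma, applied along a sequence realising the failure of semicontinuity. *)
Lemma lsc_integral (g : 'rV[C]_N -> R -> \bar R) :
  (forall v t, 0 <= g v t) ->
  (forall t, lower_semicontinuous (g ^~ t)) ->
  (forall v, measurable_fun setT (g v)) ->
  lower_semicontinuous (fun v => \int[mu]_t g v t).
Proof.
move=> g0 lg mg v a av; apply: contrapT => H.
have Hk : forall k : nat, exists w : 'rV[C]_N,
    (forall j, (cabs (w 0 j - v 0 j) < k.+1%:R^-1)%R) /\ \int[mu]_t g w t <= a%:E.
  move=> k; apply: contrapT => Hn; apply: H.
  exists [set w : 'rV[C]_N | forall j, (cabs (w 0 j - v 0 j) < k.+1%:R^-1)%R].
    by apply/nbhs_rVP; exists (k.+1%:R^-1)%R.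
  move=> w hw; rewrite ltNge; apply/negP => h; apply: Hn; exists w; split => //.
have [w Hw] := choice Hk.
have wv : w @ \oo --> v.
  apply/cvg_rVP => j; apply/cvgCP => e e0; near=> k.
  apply: (lt_trans ((Hw k).1 j)); near: k; exact: near_infty_natSinv_lt (PosNum e0).
have : \int[mu]_t g v t <= limn_einf (fun k => \int[mu]_t g (w k) t).
  apply: le_trans (@fatou _ _ R mu setT measurableT (fun k => g (w k)) (fun k => mg (w k)) (fun k t _ => g0 (w k) t)).
  apply: ge0_le_integral => //.
  - exact: mg.
  - under eq_fun do rewrite limn_einf_lim.
    apply: (emeasurable_fun_cvg (fun n t => einfs (fun k => g (w k) t) n)).
      by apply: measurable_fun_einfs => k; exact: mg.
    by move=> t _; exact: is_cvg_einfs.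
  move=> t _; rewrite limn_einf_lim.
  apply: lee_lt_real => b bg.
  have [V nV Vb] := lg t v _ bg.
  have : \forall k \near \oo, forall j, (k <= j)%N -> V (w j).
    have := wv _ nV; rewrite /= => -[k _ hk]; exists k => // i /= ki j ij.
    by apply: hk => /=; exact: leq_trans ij.
  move=> Hk2; apply: lime_ge; first exact: is_cvg_einfs.
  near=> k; apply: le_ereal_inf_tmp => _ [j /= kj <-]; apply/ltW/Vb.
  by move: j kj; near: k; exact: Hk2.
move=> H1.
have /(lt_le_trans av) : \int[mu]_t g v t <= a%:E.
  apply: (le_trans H1); rewrite limn_einf_lim; apply: lime_le; first exact: is_cvg_einfs.
  near=> k; apply: le_trans (Hw k).2; apply: ereal_inf_lbound; by exists k => /=.
by rewrite ltxx.
Unshelve. all: by end_near. Qed.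
End LscIntegral.

(** * Exchange of the order of integration and scaling of one complex coordinate *)

Section CoordinateIntegrals.
Variables (R : realType) (N : nat).
Local Notation C := (Cx R).
Local Notation mu := (@lebesgue_measure R).
Implicit Types (v : 'rV[C]_N) (i : 'I_N) (k : 'rV[C]_N -> \bar R) (a b : 'I_N * bool).

(* A pair [(i, true)] names the real part of the coordinate [i], [(i, false)] its imaginary part. *)
Definition setc a v (t : R) : 'rV[C]_N :=
  upd v a.1 (if a.2 then (t +i* cim (v 0%R a.1))%C else (cre (v 0%R a.1) +i* t)%C).

Definition pint a k v : \bar R := (\int[mu]_t k (setc a v t))%E.

Definition cxint i k : 'rV[C]_N -> \bar R := pint (i, true) (pint (i, false) k).

(* A class of integrands stable under partial integration, hence measurable at every stage of an
   iterated integral. *)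
Definition lscge0 k := (forall v, 0 <= k v)%E /\ lower_semicontinuous k.

Lemma updE v i c j : upd v i c 0 j = if j == i then c else v 0 j.
Proof. by rewrite mxE. Qed.

Lemma upd_upd v i c c' : upd (upd v i c) i c' = upd v i c'.
Proof. by apply/rowP => j; rewrite !updE; case: eqP. Qed.

Lemma updC v i j c d : i != j -> upd (upd v i c) j d = upd (upd v j d) i c.
Proof.
move=> ij; apply/rowP => l; rewrite !updE.
by case: eqVneq => // ->; rewrite eq_sym (negbTE ij).
Qed.

Lemma cxintE i k v : cxint i k v = (\int[mu]_x \int[mu]_y k (upd v i (x +i* y)%C))%E.
Proof.
apply: eq_integral => x _; apply: eq_integral => y _.
by rewrite /setc /= upd_upd updE eqxx cre_mk.
Qed.

Lemma iter_int_cons i l k : iter_int (i :: l) k = cxint i (iter_int l k).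
Proof. by apply: funext => v; rewrite cxintE. Qed.

Lemma iter_int_cat l1 l2 k : iter_int (l1 ++ l2) k = iter_int l1 (iter_int l2 k).
Proof.
elim: l1 => [|i l1 IH]; first reflexivity.
rewrite cat_cons !iter_int_cons IH; reflexivity.
Qed.

Lemma setcC a b v s t : a != b -> setc a (setc b v s) t = setc b (setc a v t) s.
Proof.
case: a b => [i [] ] [j [] ] ab; rewrite /setc /=;
  (have [ij|ij] := eqVneq i j; last by rewrite !updE ?(eq_sym j i) ?(negbTE ij) updC// eq_sym);
  subst j; move: ab; rewrite ?eqxx // => _; by rewrite !upd_upd !updE eqxx.
Qed.

Lemma setc_continuous_v a t : continuous (fun v => setc a v t).
Proof.
move=> v; apply: (proj2 (@cvg_rVP R N 'rV[C]_N (nbhs v) _ (fun v => setc a v t) (setc a v t))) => j.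
rewrite /setc updE; under eq_fun do rewrite updE.
case: eqP => _; last exact: coord_continuous.
have hre : (fun v => cre (v 0 a.1)) @ v --> cre (v 0 a.1).
  by apply: (@continuous_comp _ _ _ (fun v : 'rV[C]_N => v 0 a.1) (@cre R)); [exact: coord_continuous|exact: cre_continuous].
have him : (fun v => cim (v 0 a.1)) @ v --> cim (v 0 a.1).
  by apply: (@continuous_comp _ _ _ (fun v : 'rV[C]_N => v 0 a.1) (@cim R)); [exact: coord_continuous|exact: cim_continuous].
by case: a.2; apply: mk_cvg => //; exact: cvg_cst.
Qed.

Lemma setc2_continuous a b v : continuous (fun p : R * R => setc a (setc b v p.1) p.2).
Proof.
move=> p; apply: (proj2 (@cvg_rVP R N (R * R)%type (nbhs p) _ (fun p => setc a (setc b v p.1) p.2) _)) => j.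
have hb i : (fun p : R * R => setc b v p.1 0 i) @ p --> setc b v p.1 0 i.
  rewrite /setc updE; under eq_fun do rewrite updE.
  case: eqP => _; last exact: cvg_cst.
  by case: b.2; apply: mk_cvg; try exact: cvg_cst; exact: cvg_fst.
rewrite {1}/setc updE; under eq_fun do rewrite {1}/setc updE.
case: eqP => _; last exact: hb.
have [h1 h2] := proj1 (@cvg_creimP R (R * R)%type (nbhs p) _ _ _) (hb a.1).
by case: a.2; apply: mk_cvg => //; exact: cvg_snd.
Qed.

Lemma setc_continuous_t a v : continuous (setc a v).
Proof.
move=> t; apply: (proj2 (@cvg_rVP R N R (nbhs t) _ (setc a v) _)) => j.
rewrite /setc updE; under eq_fun do rewrite updE.
case: eqP => _; last exact: cvg_cst.
by case: a.2; apply: mk_cvg; try exact: cvg_cst; exact: cvg_id.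
Qed.

Lemma lscge0_measurable a k v : lscge0 k -> measurable_fun [set: R] (fun t => k (setc a v t)).
Proof.
by move=> [_ lk]; apply: lower_semicontinuous_measurable; apply: lsc_comp lk _; exact: setc_continuous_t.
Qed.

Lemma lscge0_pint a k : lscge0 k -> lscge0 (pint a k).
Proof.
move=> gk; have [k0 lk] := gk; split; first by move=> v; apply: integral_ge0.
apply: (@lsc_integral R N (fun v t => k (setc a v t))) => [v t|t|v]; first exact: k0.
  by apply: lsc_comp lk _; exact: setc_continuous_v.
exact: lscge0_measurable.
Qed.

Lemma lscge0_cxint i k : lscge0 k -> lscge0 (cxint i k).
Proof. by move=> gk; do 2 apply: lscge0_pint. Qed.

Lemma lscge0_iter_int l k : lscge0 k -> lscge0 (iter_int l k).
Proof. by move=> gk; elim: l => // i l IH; rewrite iter_int_cons; exact: lscge0_cxint. Qed.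

Lemma pintC a b k : lscge0 k -> a != b -> pint a (pint b k) = pint b (pint a k).
Proof.
move=> [k0 lk] ab; apply: funext => v; rewrite /pint.
have := @fubini_tonelli _ _ _ _ R mu mu (fun p => k (setc b (setc a v p.1) p.2)).
move=> /= ->; last 2 first.
- by apply: lsc_measurable_prod; apply: lsc_comp lk _; exact: setc2_continuous.
- by move=> *; exact: k0.
by apply: eq_integral => s _; apply: eq_integral => t _; rewrite setcC// eq_sym.
Qed.

Lemma cxintC i j k : lscge0 k -> cxint i (cxint j k) = cxint j (cxint i k).
Proof.
move=> gk; have [->//|ij] := eqVneq i j.
have ne s t : (i, s) != (j, t) by apply: contra ij => /eqP[->].
rewrite /cxint (@pintC (i, false) (j, true)); [|exact: lscge0_pint|exact: ne].
rewrite (@pintC (i, false) (j, false)); [|by []|exact: ne].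
rewrite (@pintC (i, true) (j, true)); [|by do 2 apply: lscge0_pint|exact: ne].
by rewrite (@pintC (i, true) (j, false)); [|exact: lscge0_pint|exact: ne].
Qed.

(** Any coordinate may thus be integrated first or last, as required by the change of variable in
    one coordinate and by the slicing along [w]. *)
Lemma iter_int_perm l1 l2 k : lscge0 k -> perm_eq l1 l2 -> iter_int l1 k = iter_int l2 k.
Proof.
move=> gk; elim: l1 l2 => [|i l1 IH] l2.
  by rewrite perm_sym => /perm_nilP ->.
move=> h; have il2 : i \in l2 by rewrite -(perm_mem h) mem_head.
case/splitPr: il2 h => la lb h.
have /IH : perm_eq l1 (la ++ lb).
  by rewrite -(perm_cons i) (perm_trans h)// perm_catC/= perm_cons perm_catC.
rewrite iter_int_cons iter_int_cat => ->; rewrite iter_int_cat iter_int_cons.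
have : lscge0 (iter_int lb k) by exact: lscge0_iter_int.
elim: la {h IH} (iter_int lb k) => [|j la IH] k' gk'; first reflexivity.
rewrite !iter_int_cons cxintC; last exact: lscge0_iter_int.
by rewrite (IH _ gk').
Qed.

Lemma le_pint a k k' : lscge0 k -> lscge0 k' -> (forall v, k v <= k' v)%E ->
  (forall v, pint a k v <= pint a k' v)%E.
Proof.
move=> gk gk' kk' v; apply: ge0_le_integral => //.
- by move=> *; exact: gk.1.
- exact: lscge0_measurable.
- exact: lscge0_measurable.
Qed.

Lemma le_iter_int l k k' : lscge0 k -> lscge0 k' -> (forall v, k v <= k' v)%E ->
  (forall v, iter_int l k v <= iter_int l k' v)%E.
Proof.
move=> gk gk' kk'; elim: l => [|i l IH]; first exact: kk'.
rewrite !iter_int_cons => v.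
have g1 := lscge0_iter_int l gk; have g2 := lscge0_iter_int l gk'.
apply: (@le_pint (i, true) (pint (i, false) _) (pint (i, false) _)); [exact: lscge0_pint g1|exact: lscge0_pint g2|].
exact: (@le_pint (i, false)).
Qed.

Lemma iter_intD l k k' : lscge0 k -> lscge0 k' ->
  iter_int l (fun v => k v + k' v)%E = (fun v => iter_int l k v + iter_int l k' v)%E.
Proof.
move=> gk gk'; have pD a h h' : lscge0 h -> lscge0 h' ->
    pint a (fun v => h v + h' v)%E = (fun v => pint a h v + pint a h' v)%E.
  move=> gh gh'; apply: funext => v; apply: ge0_integralD => //;
   try by move=> *; [exact: gh.1 || exact: gh'.1].
  exact: lscge0_measurable.
  exact: lscge0_measurable.
elim: l => // i l IH; rewrite !iter_int_cons IH /cxint.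
have g1 := lscge0_iter_int l gk; have g2 := lscge0_iter_int l gk'.
by rewrite pD// pD//; [exact: lscge0_pint g1|exact: lscge0_pint g2].
Qed.

Lemma iter_intZ l k (c : R) : lscge0 k -> 0 <= c ->
  iter_int l (fun v => c%:E * k v)%E = (fun v => c%:E * iter_int l k v)%E.
Proof.
move=> gk c0; have pZ a h : lscge0 h -> pint a (fun v => c%:E * h v)%E = (fun v => c%:E * pint a h v)%E.
  move=> gh; apply: funext => v; apply: ge0_integralZl_EFin => //.
    by move=> *; exact: gh.1.
  exact: lscge0_measurable.
elim: l => // i l IH; rewrite !iter_int_cons IH /cxint.
have g1 := lscge0_iter_int l gk.
by rewrite pZ// pZ//; exact: lscge0_pint g1.
Qed.

Definition sc1 i (c : C) v : 'rV[C]_N := upd v i (c * v 0 i).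

Lemma sc1_continuous i c : continuous (sc1 i c).
Proof.
move=> v; apply: (proj2 (@cvg_rVP R N 'rV[C]_N (nbhs v) _ (sc1 i c) _)) => j.
rewrite /sc1 updE; under eq_fun do rewrite updE.
by case: eqP => _; [apply: cvgM; [exact: cvg_cst|]|]; exact: coord_continuous.
Qed.

Lemma lscge0Z (r : R) k : 0 <= r -> lscge0 k -> lscge0 (fun v => r%:E * k v)%E.
Proof.
move=> r0 [k0 lk]; split=> [v|]; first by apply: mule_ge0 => //; rewrite lee_fin.
have [->|rn0] := eqVneq r 0.
  by move=> v a; rewrite mul0e => a0; exists setT; [exact: filterT|move=> w _; rewrite mul0e].
have rp : 0 < r by rewrite lt_def rn0.
move=> v a; rewrite -lte_pdivrMl// -EFinM => /lk[V nV Va]; exists V => // w /Va.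
by rewrite EFinM lte_pdivrMl.
Qed.

Lemma lscge0_comp k (h : 'rV[C]_N -> 'rV[C]_N) : continuous h -> lscge0 k -> lscge0 (k \o h).
Proof. by move=> ch [k0 lk]; split=> [v|]; [exact: k0|exact: lsc_comp]. Qed.

Lemma lscge0_scale i (c : C) k : lscge0 k -> lscge0 (fun v => (cabs c ^+ 2)%:E * k (sc1 i c v))%E.
Proof.
move=> gk; apply: lscge0Z; first exact: sqr_ge0.
by apply: lscge0_comp gk; exact: sc1_continuous.
Qed.

Lemma upd_continuous (T : topologicalType) v i (f g : T -> R) :
  continuous f -> continuous g -> continuous (fun p => upd v i (f p +i* g p)%C).
Proof.
move=> cf cg p; apply: (proj2 (@cvg_rVP R N T (nbhs p) _ _ _)) => j.
rewrite updE; under eq_fun do rewrite updE.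
by case: eqP => _; [apply: mk_cvg; [exact: cf|exact: cg]|exact: cvg_cst].
Qed.

(* A complex multiplication is a composition of two real affine substitutions, one in each
   real variable, separated by an exchange of the order of integration. *)
Lemma cxint_scale_re i (c : C) k : cre c != 0 -> lscge0 k ->
  cxint i (fun v => (cabs c ^+ 2)%:E * k (sc1 i c v))%E = cxint i k.
Proof.
set a := cre c; set b := cim c; set n := cabs c ^+ 2 => a0 gk.
have [k0 lk] := gk.
have nE : n = a ^+ 2 + b ^+ 2 by rewrite /n sqr_cabs.
have n0 : 0 < n.
  have := sqr_ge0 b; have : 0 < a ^+ 2 by rewrite exprn_even_gt0.
  rewrite nE; lra.
have na : 0 < n / `|a| by rewrite divr_gt0// normr_gt0.
apply: funext => v; rewrite !cxintE.
have aff1 (p q r x : R) : measurable_fun [set: R] (fun y => k (upd v i ((p * x + q * y + r) +i* y)%C)).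
  apply: lower_semicontinuous_measurable.
  apply: (@lsc_comp R R 'rV[C]_N k (fun y => upd v i ((p * x + q * y + r) +i* y)%C)) => //.
  apply: upd_continuous => y; last exact: cvg_id.
  apply: cvgD; last exact: cvg_cst.
  by apply: cvgD; [exact: cvg_cst|apply: cvgM; [exact: cvg_cst|exact: cvg_id]].
(* If [y' = a y + b x] denotes the imaginary part of [c (x + i y)], its real part is
   [(n / a) x - (b / a) y']. The two substitutions contribute the factors [|a|] and [n / |a|], whose
   product is [n = |c|^2]. *)
transitivity (\int[mu]_x ((n / `|a|)%:E * \int[mu]_y k (upd v i ((n / a * x + (- b / a) * y)%R +i* y)%C)))%E.
  apply: eq_integral => x _.
  rewrite -(@ge0_integral_affine R a (b * x)%R (fun y => k (upd v i ((n / a * x + (- b / a) * y)%R +i* y)%C))); [|exact: a0| |by move=> y; exact: k0]; last first.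
    have := aff1 (n / a) (- b / a) 0 x.
    by under eq_fun do rewrite addr0.
  rewrite muleA -EFinM divfK ?normr_eq0//.
  rewrite -ge0_integralZl_EFin ?ltW//; last first.
  - apply: lower_semicontinuous_measurable.
    apply: (@lsc_comp R R 'rV[C]_N k (fun y => upd v i ((n / a * x + (- b / a) * (a * y + b * x)) +i* (a * y + b * x))%C)) => //.
    have cy : continuous (fun y : R => a * y + b * x).
      by move=> y; apply: cvgD; [apply: cvgM; [exact: cvg_cst|exact: cvg_id]|exact: cvg_cst].
    apply: upd_continuous => // y.
    by apply: cvgD; [exact: cvg_cst|apply: cvgM; [exact: cvg_cst|exact: cy]].
  apply: eq_integral => y _; congr (_ * k _)%E.
  rewrite /sc1 upd_upd updE eqxx; congr upd; apply: complex_eqP; rewrite !cE -/a -/b; last by ring.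
  by rewrite nE; field; exact: a0.
have cL : continuous (fun p : R * R => upd v i ((n / a * p.1 + (- b / a) * p.2) +i* p.2)%C).
  apply: upd_continuous => p; last exact: cvg_snd.
  by apply: cvgD; (apply: cvgM; [exact: cvg_cst|]); [exact: cvg_fst|exact: cvg_snd].
have mL : measurable_fun (setT : set (measurableTypeR R * measurableTypeR R))
    (fun p => k (upd v i ((n / a * p.1 + (- b / a) * p.2) +i* p.2)%C)).
  by apply: lsc_measurable_prod; apply: lsc_comp lk _.
rewrite ge0_integralZl_EFin ?ltW//; first last.
- exact: (@measurable_fun_fubini_tonelli_F _ _ _ _ R mu _ mL (fun p => k0 _)).
- by move=> x _; apply: integral_ge0.
have := @fubini_tonelli _ _ _ _ R mu mu _ mL (fun p => k0 _); rewrite /= => ->.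
rewrite -ge0_integralZl_EFin ?ltW//; first last.
- exact: (@measurable_fun_fubini_tonelli_G _ _ _ _ R mu _ mL (fun p => k0 _)).
- by move=> x _; apply: integral_ge0.
have mK : measurable_fun (setT : set (measurableTypeR R * measurableTypeR R))
    (fun p => k (upd v i (p.1 +i* p.2)%C)).
  apply: lsc_measurable_prod; apply: lsc_comp lk _.
  by apply: upd_continuous => p; [exact: cvg_fst|exact: cvg_snd].
have := @fubini_tonelli _ _ _ _ R mu mu _ mK (fun p => k0 _); rewrite /= => ->.
apply: eq_integral => y _.
have -> : n / `|a| = `|n / a| by rewrite normrM normfV (gtr0_norm n0).
rewrite -[RHS](@ge0_integral_affine R (n / a) (- b / a * y)%R (fun x => k (upd v i (x +i* y)%C))) //.
- by rewrite mulf_neq0 ?invr_eq0// gt_eqF.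
- apply: lower_semicontinuous_measurable.
  apply: (@lsc_comp R R 'rV[C]_N k (fun x => upd v i (x +i* y)%C)) => //.
  by apply: upd_continuous => x; [exact: cvg_id|exact: cvg_cst].
Qed.

Lemma sc1M i (c d : C) v : sc1 i c (sc1 i d v) = sc1 i (c * d) v.
Proof. by rewrite /sc1 upd_upd updE eqxx mulrA. Qed.

Lemma cxint_scale i (c : C) k : c != 0 -> lscge0 k ->
  cxint i (fun v => (cabs c ^+ 2)%:E * k (sc1 i c v))%E = cxint i k.
Proof.
move=> c0 gk; have [r0|] := eqVneq (cre c) 0; last by move/cxint_scale_re; apply.
(* Since [(1 + i)^2 = 2 i], a purely imaginary [c = i t] is the product of [1 + i] and
   [(t / 2) (1 + i)], both with nonzero real part. *)
pose d : C := (1 +i* 1)%C; pose e : C := ((cim c / 2) +i* (cim c / 2))%C.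
have ced : c = e * d by apply: complex_eqP; rewrite !cE; lra.
have c1 : cim c != 0 by apply: contra c0 => /eqP c1; apply/eqP/complex_eqP.
have e0 : cre e != 0 by rewrite cre_mk mulf_neq0// invr_eq0 pnatr_eq0.
have d0 : cre d != 0 by rewrite cre_mk oner_neq0.
rewrite -(cxint_scale_re i e0 gk) -(cxint_scale_re i d0 (lscge0_scale i e gk)).
congr cxint; apply: funext => v.
by rewrite sc1M -ced ced cabsM exprMn [RHS]muleA -EFinM mulrC.
Qed.

End CoordinateIntegrals.

Section Volume.
Variables (R : realType) (N : nat).
Local Notation C := (Cx R).
Local Notation mu := (@lebesgue_measure R).
Implicit Types (v : 'rV[C]_N) (k : 'rV[C]_N -> \bar R) (D : set 'rV[C]_N).

Definition scl (c : 'I_N -> C) v : 'rV[C]_N := \row_j (c j * v 0 j).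

Lemma sclE c v j : scl c v 0 j = c j * v 0 j. Proof. by rewrite mxE. Qed.

Lemma scl_scl (c d : 'I_N -> C) v : scl c (scl d v) = scl (fun j => c j * d j) v.
Proof. by apply/rowP => j; rewrite !sclE mulrA. Qed.

Lemma eq_scl (c d : 'I_N -> C) v : c =1 d -> scl c v = scl d v.
Proof. by move=> cd; apply/rowP => j; rewrite !sclE cd. Qed.

Lemma scl1 v : scl (fun=> 1) v = v.
Proof. by apply/rowP => j; rewrite sclE mul1r. Qed.

Lemma scl_continuous c : continuous (scl c).
Proof.
move=> v; apply: (proj2 (@cvg_rVP R N 'rV[C]_N (nbhs v) _ (scl c) _)) => j.
apply: (@eq_ccont _ _ _ (fun w : 'rV[C]_N => c j * w 0 j)); first by move=> w; exact: sclE.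
apply: ccontM; [exact: ccont_cst|exact: ccont_coord].
Qed.

Lemma vol_int_sc1 i (c : C) k : c != 0 -> lscge0 k ->
  vol_int (fun v => (cabs c ^+ 2)%:E * k (sc1 i c v))%E = vol_int k.
Proof.
move=> c0 gk; rewrite /vol_int.
have P : perm_eq (enum 'I_N) (rem i (enum 'I_N) ++ [:: i]).
  by rewrite perm_sym perm_catC perm_sym; apply: perm_to_rem; rewrite mem_enum.
rewrite (iter_int_perm (lscge0_scale i c gk) P) (iter_int_perm gk P) !iter_int_cat.
by rewrite !iter_int_cons /= cxint_scale.
Qed.

Lemma vol_int_scl (c : 'I_N -> C) k : (forall j, c j != 0) -> lscge0 k ->
  vol_int (fun v => (\prod_j cabs (c j) ^+ 2)%:E * k (scl c v))%E = vol_int k.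
Proof.
move=> c0 gk.
(* The induction runs over the set [s] of coordinates already scaled. *)
pose cs (s : seq 'I_N) j : C := if j \in s then c j else 1.
have H s : uniq s -> vol_int (fun v => (\prod_(j <- s) cabs (c j) ^+ 2)%:E * k (scl (cs s) v))%E = vol_int k.
  elim: s => [_|i s IH /= /andP[is_ us]].
    congr vol_int; apply: funext => v; rewrite big_nil mul1e (@eq_scl _ (fun=> 1)) ?scl1//.
  have gs : lscge0 (fun v => (\prod_(j <- s) cabs (c j) ^+ 2)%:E * k (scl (cs s) v))%E.
    apply: lscge0Z; first by apply: prodr_ge0 => j _; exact: sqr_ge0.
    by apply: lscge0_comp gk; exact: scl_continuous.
  rewrite -(IH us) -(vol_int_sc1 i (c0 i) gs); congr vol_int; apply: funext => v.
  rewrite muleA -EFinM big_cons; congr (_ * k _)%E.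
  apply/rowP => j; rewrite !sclE /sc1 updE /cs inE.
  by have [->|ji] := eqVneq j i; rewrite ?(negbTE is_) ?mul1r.
have := H (enum 'I_N) (enum_uniq _) => <-.
congr vol_int; apply: funext => v; rewrite big_enum /=; congr (_ * k _)%E.
by apply: eq_scl => j; rewrite /cs mem_enum.
Qed.

Lemma le_vol_int k k' : lscge0 k -> lscge0 k' -> (forall v, k v <= k' v)%E -> (vol_int k <= vol_int k')%E.
Proof. by move=> gk gk' kk'; exact: le_iter_int. Qed.

Lemma vol_intD k k' : lscge0 k -> lscge0 k' -> vol_int (fun v => k v + k' v)%E = (vol_int k + vol_int k')%E.
Proof. by move=> gk gk'; rewrite /vol_int iter_intD. Qed.

Lemma vol_intZ k (c : R) : lscge0 k -> 0 <= c -> vol_int (fun v => c%:E * k v)%E = (c%:E * vol_int k)%E.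
Proof. by move=> gk c0; rewrite /vol_int iter_intZ. Qed.

Lemma vol_int_ge0 k : lscge0 k -> (0 <= vol_int k)%E.
Proof. by move=> gk; exact: (lscge0_iter_int _ gk).1. Qed.

Lemma lscge0D k k' : lscge0 k -> lscge0 k' -> lscge0 (fun v => k v + k' v)%E.
Proof.
move=> [k0 lk] [k0' lk']; split=> [v|v a]; first exact: adde_ge0.
case kv : (k v) => [x| |]; last by have := k0 v; rewrite kv.
- case kv' : (k' v) => [y| |]; last by have := k0' v; rewrite kv'.
  + rewrite -EFinD lte_fin => axy; pose e := (x + y - a) / 2.
    have [V nV Vh] := lk v (x - e)%R ltac:(by rewrite kv lte_fin /e; lra).
    have [W nW Wh] := lk' v (y - e)%R ltac:(by rewrite kv' lte_fin /e; lra).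
    exists (V `&` W); first exact: filterI.
    move=> w [/Vh h1 /Wh h2]; apply: le_lt_trans (lteD h1 h2).
    by rewrite -EFinD lee_fin /e; lra.
  + move=> _; have [W nW Wh] := lk' v a ltac:(by rewrite kv' ltry).
    exists W => // w /Wh h; apply: lt_le_trans h _; exact: leeDr.
- move=> _; have [W nW Wh] := lk v a ltac:(by rewrite kv ltry).
  exists W => // w /Wh h; apply: lt_le_trans h _; exact: leeDl.
Qed.

(** Zero is the least value, so extending a nonnegative function by zero off an open set can only
    create downward jumps on leaving the set. Continuity is lost but lower semicontinuity is kept,
    which is why the class [lscge0] is the working one. *)
Lemma lscge0_pos D (u : 'rV[C]_N -> R) : open D -> (forall v, D v -> rcont u v) ->
  lscge0 (fun v => (Num.max (\1_D v * u v) 0)%:E).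
Proof.
move=> oD cu; split=> [v|v a]; first by rewrite lee_fin le_max lexx orbT.
rewrite lte_fin; have [a0|a0] := ltP a 0.
  move=> _; exists setT; first exact: filterT.
  by move=> w _; rewrite lte_fin lt_max a0 orbT.
rewrite lt_max (ltNge a 0) a0 orbF indicE; case: (boolP (v \in D)) => [|_]; last by rewrite mul0r ltNge a0.
rewrite inE mul1r => Dv auv.
exists (D `&` [set w | a < u w]).
  apply: filterI; first exact: open_nbhs_nbhs.
  by have /(_ [set x | a < x]) := cu v Dv; apply; apply: open_nbhs_nbhs; split; [exact: open_gt|].
by move=> w [Dw aw]; rewrite lte_fin lt_max indicE mem_set// mul1r aw.
Qed.

Lemma lscge0_indic D (u : 'rV[C]_N -> R) : open D -> (forall v, D v -> rcont u v) -> (forall v, 0 <= u v) ->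
  lscge0 (fun v => (\1_D v * u v)%:E).
Proof.
move=> oD cu u0; have := lscge0_pos oD cu; congr lscge0; apply: funext => v.
by rewrite max_l// mulr_ge0.
Qed.

End Volume.

(** * Volume as an integral over the plane of the volumes of slices *)

Section Slices.
Variables (R : realType) (N : nat).
Local Notation C := (Cx R).
Local Notation mu := (@lebesgue_measure R).

Definition app_last (v : 'rV[C]_N) (w : C) : 'rV[C]_(N + 1) := row_mx v (const_mx w).

Lemma app_lastE v w (j : 'I_N) : app_last v w 0 (lshift 1 j) = v 0 j.
Proof. by rewrite /app_last row_mxEl. Qed.

Lemma app_last_last v w (j : 'I_1) : app_last v w 0 (rshift N j) = w.
Proof. by rewrite /app_last row_mxEr mxE. Qed.

Lemma iter_int_lshift l (k : 'rV[C]_(N + 1) -> \bar R) v w :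
  iter_int (map (lshift 1) l) k (app_last v w) = iter_int l (fun u => k (app_last u w)) v.
Proof.
elim: l v => [|i l IH] v; first reflexivity.
rewrite /=; apply: eq_integral => x _; apply: eq_integral => y _.
rewrite -IH; congr (iter_int _ _ _); apply/rowP => j; rewrite mxE.
case: (split_ordP j) => j' ->; first by rewrite !app_lastE mxE (inj_eq (@lshift_inj _ _)).
by rewrite !app_last_last eq_rlshift.
Qed.

Definition slice_int (k : 'rV[C]_(N + 1) -> \bar R) (w : C) : \bar R :=
  vol_int (fun v => k (app_last v w)).

Lemma slice_int_ge0 k w : lscge0 k -> (0 <= slice_int k w)%E.
Proof.
move=> gk; rewrite /slice_int /vol_int -iter_int_lshift.
exact: (lscge0_iter_int _ gk).1.
Qed.

Lemma lsc_slice k : lscge0 k -> lower_semicontinuous (fun p : R * R => slice_int k (p.1 +i* p.2)%C).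
Proof.
move=> gk; have [_ lk] := lscge0_iter_int (map (lshift 1) (enum 'I_N)) gk.
have := @lsc_comp R (R * R)%type _ _ (fun p : R * R => upd (0 : 'rV[C]_(N+1)) (rshift N ord0) (p.1 +i* p.2)%C) lk.
have H : continuous (fun p : R * R => upd (0 : 'rV[C]_(N+1)) (rshift N ord0) (p.1 +i* p.2)%C).
  by apply: upd_continuous => p; [exact: cvg_fst|exact: cvg_snd].
move=> /(_ H); congr lower_semicontinuous; apply: funext => p /=.
rewrite /slice_int /vol_int -iter_int_lshift; congr (iter_int _ _ _).
apply/rowP => j; rewrite mxE; case: (split_ordP j) => j' ->.
  by rewrite app_lastE !mxE eq_lrshift.
by rewrite app_last_last (ord1 j') eqxx.
Qed.

(** The last coordinate is moved to the front of the iteration, and its two real integrals are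
    joined by Tonelli into one over the plane. *)
Lemma vol_int_slice k : lscge0 k ->
  vol_int k = (\int[(mu \x mu)%E]_p slice_int k (p.1 +i* p.2)%C)%E.
Proof.
move=> gk.
have P : perm_eq (enum 'I_(N + 1)) (rshift N ord0 :: map (lshift 1) (enum 'I_N)).
  apply: uniq_perm; first exact: enum_uniq.
    rewrite /= map_inj_uniq ?enum_uniq ?andbT; last exact: (@lshift_inj _ _).
    by apply/mapP => -[j _ /eqP]; rewrite eq_rlshift.
  move=> j; rewrite mem_enum inE; apply/esym; case: (split_ordP j) => j' ->.
    by rewrite in_cons eq_lrshift /= map_f// mem_enum.
  by rewrite (ord1 j') mem_head.
rewrite /vol_int (iter_int_perm gk P) /=.
rewrite fubini_tonelli1 /=; last 2 first.
- by apply: lsc_measurable_prod; exact: lsc_slice.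
- by move=> p; exact: slice_int_ge0.
apply: eq_integral => x _; apply: eq_integral => y _ /=.
rewrite /slice_int /vol_int -iter_int_lshift; congr (iter_int _ _ _).
apply/rowP => j; rewrite mxE; case: (split_ordP j) => j' ->.
  by rewrite app_lastE !mxE eq_lrshift.
by rewrite app_last_last (ord1 j') eqxx.
Qed.

End Slices.

(** * Complex analysis in one and several variables *)

Section ComplexDerivative.
Variable R : realType.
Local Notation C := (Cx R).
Implicit Types (f g : C -> C) (z w d e : C).

(* Caratheodory's form of complex differentiability. *)
Definition cder f z d := exists phi : C -> C,
  [/\ ccont phi z, phi z = d & forall w, f w = f z + phi w * (w - z)].

Lemma cder_cvgP f z d :
  cder f z d <-> (fun h => h^-1 * (f (h + z) - f z)) @ (0 : C)^' --> d.
Proof.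
split=> [[phi [cphi <- fE]]|fd].
  apply/cvgCP => e e0; have /ccont_epsP/(_ e e0)[r r0 hr] := cphi.
  apply/nbhsCP; exists r => // h; rewrite subr0 => hr' h0.
  have -> : h^-1 * (f (h + z) - f z) = phi (h + z) by rewrite (fE (h + z)); field.
  by apply: hr; rewrite addrK.
exists (fun w => if w == z then d else (w - z)^-1 * (f w - f z)); rewrite eqxx; split; last first.
- move=> w; case: eqVneq => [->|wz]; first by rewrite subrr mulr0 addr0.
  by rewrite mulrAC mulVf ?subr_eq0// mul1r addrC subrK.
- by [].
apply/ccont_epsP => e e0; rewrite eqxx; have /cvgCP/(_ e e0)/nbhsCP[r r0 hr] := fd.
exists r => // w wz; case: eqVneq => [_|wnz]; first by rewrite subrr cabs0.
have := hr (w - z); rewrite subr0 subrK; apply => //.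
by rewrite subr_eq0.
Qed.

Lemma cder_cont f z d : cder f z d -> ccont f z.
Proof.
move=> [phi [cphi _ fE]]; apply: (eq_ccont fE).
apply: ccontD; first exact: ccont_cst.
by apply: ccontM cphi _; apply: ccontB; [exact: ccont_id|exact: ccont_cst].
Qed.

Lemma cder_cst a z : cder (fun=> a) z 0.
Proof. by exists (fun=> 0); split; [exact: ccont_cst| |move=> w; rewrite mul0r addr0]. Qed.

Lemma cder_id z : cder (fun w => w) z 1.
Proof. by exists (fun=> 1); split; [exact: ccont_cst| |move=> w; rewrite mul1r addrC subrK]. Qed.

Lemma cderD f g z d e : cder f z d -> cder g z e -> cder (fun w => f w + g w) z (d + e).
Proof.
move=> [p [cp <- fE]] [q [cq <- gE]]; exists (fun w => p w + q w); split; [exact: ccontD|by []|move=> w].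
by rewrite fE gE; ring.
Qed.

Lemma cderM f g z d e : cder f z d -> cder g z e ->
  cder (fun w => f w * g w) z (d * g z + f z * e).
Proof.
move=> fd ge; have cg := cder_cont ge.
move: fd ge => [p [cp <- fE]] [q [cq <- gE]]; exists (fun w => p w * g w + f z * q w); split; [|by []|move=> w].
  by apply: ccontD; [exact: ccontM cp cg|apply: ccontM cq; exact: ccont_cst].
by rewrite {1}fE (gE w); ring.
Qed.

Lemma cderZ a f z d : cder f z d -> cder (fun w => a * f w) z (a * d).
Proof. by move=> fd; have := cderM (cder_cst a z) fd; rewrite mul0r add0r. Qed.

Lemma cderN f z d : cder f z d -> cder (fun w => - f w) z (- d).
Proof.
by move=> [p [cp <- fE]]; exists (fun w => - p w); split; [exact: ccontN| |move=> w; rewrite fE; ring].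
Qed.

Lemma cderB f g z d e : cder f z d -> cder g z e -> cder (fun w => f w - g w) z (d - e).
Proof. by move=> fd ge; apply: cderD fd (cderN ge). Qed.

Lemma cder_comp f g z d e : cder f z d -> cder g (f z) e -> cder (fun w => g (f w)) z (e * d).
Proof.
move=> fd ge; have cf := cder_cont fd.
move: fd ge => [p [cp <- fE]] [q [cq <- gE]]; exists (fun w => q (f w) * p w); split; [|by []|move=> w].
  by apply: ccontM cp; exact: (ccont_compC cf cq).
by rewrite (gE (f w)) {2}(fE w); ring.
Qed.

Lemma cder_inv z : z != 0 -> cder (fun w => w^-1) z (- z ^- 2).
Proof.
move=> z0.
(* The slope [- (z w)^-1] is meaningless at [w = 0]. The function is replaced at that single point
   by the value of its tangent at [z], which does not affect the derivative at [z]. *)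
have H : cder (fun w => if w == 0 then 2 / z - w / z ^+ 2 else w^-1) z (- z ^- 2).
  exists (fun w => if w == 0 then - z ^- 2 else - (z * w)^-1); rewrite (negbTE z0); split.
  - apply: (@ccont_near _ _ (fun w => - (z * w)^-1)); last first.
      apply: ccontN; apply: ccontV; first by rewrite mulf_neq0.
      by apply: ccontM; [exact: ccont_cst|exact: ccont_id].
    apply/nbhsCP; exists (cabs z) => [|w wz]; first by rewrite cabs_gt0.
    by case: eqP wz => // ->; rewrite sub0r cabsN ltxx.
  - by rewrite expr2.
  - move=> w; case: eqVneq => [->|w0]; first by field.
    by field; rewrite z0 w0.
have := H; rewrite !cder_cvgP; apply: cvg_trans; apply: near_eq_cvg.
apply/nbhsCP; exists (cabs z) => [|h]; first by rewrite cabs_gt0.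
rewrite subr0 => hz h0; rewrite (negbTE z0); case: eqVneq => // hz0.
by move: hz; rewrite -(addr0_eq hz0) cabsN ltxx.
Qed.

Lemma cderV f z d : f z != 0 -> cder f z d -> cder (fun w => (f w)^-1) z (- f z ^- 2 * d).
Proof. by move=> f0 fd; apply: (cder_comp fd); exact: cder_inv. Qed.

Lemma cder_near f g z d : (\forall w \near z, f w = g w) -> cder f z d -> cder g z d.
Proof.
move=> fg /cder_cvgP fd; apply/cder_cvgP; apply: cvg_trans fd; apply: near_eq_cvg.
have fz := nbhs_singleton fg; move: fg => /nbhsCP[r r0 hr].
apply/nbhsCP; exists r => // h; rewrite subr0 => hr' _.
by rewrite fz hr// addrK.
Qed.

Lemma cder_conj f z d : cder f z d -> cder (fun w => cconj (f (cconj w))) (cconj z) (cconj d).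
Proof.
move=> [p [cp <- fE]]; exists (fun w => cconj (p (cconj w))); rewrite !cconjK; split; [|by []|move=> w].
  apply: ccont_conj; apply: (@ccont_compC _ _ (@cconj R)); last by rewrite cconjK.
  by apply: ccont_conj; exact: ccont_id.
by rewrite fE cconjD cconjM cconjB cconjK.
Qed.

(** The bridge to real calculus: through it the fundamental theorem of calculus and the real mean
    value theorem apply to holomorphic functions along segments. *)
Lemma cder_real f (x : R) d : cder f (creal x) d ->
  is_derive x 1 (fun t : R => cre (f (creal t))) (cre d) /\
  is_derive x 1 (fun t : R => cim (f (creal t))) (cim d).
Proof.
move=> [p [cp <- fE]].
have cpr : (fun h : R => p (creal (h + x))) @ 0^' --> p (creal x).
  have : ccont (fun h : R => p (creal (h + x))) 0.
    apply: ccont_compC; last by rewrite add0r.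
    by apply: ccont_creal; apply: rcontD; [exact: rcont_id|exact: rcont_cst].
  rewrite /ccont add0r => H P nP; have : nbhs (0 : R) [set h | P (p (creal (h + x)))] by exact: H.
  by apply: filterS => h Ph _.
have [hre him] := proj1 (@cvg_creimP R _ _ _ _ _) cpr.
split.
  have H : (fun h : R => h^-1 *: (((fun t => cre (f (creal t))) \o shift x) (h *: (1 : R)) - cre (f (creal x)))) @ 0^' --> cre (p (creal x)).
    apply: cvg_trans hre; apply: near_eq_cvg; near=> h.
    have h0 : h != 0 by near: h; exact: nbhs_dnbhs_neq.
    have E : f (creal (h + x)) = f (creal x) + p (creal (h + x)) * creal h by rewrite {1}fE -crealB addrK.
    by rewrite /= /GRing.scale /= mulr1 E creD creM cre_creal cim_creal; field.
  by split; [apply/cvg_ex; exists (cre (p (creal x)))|exact/cvg_lim].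
have H : (fun h : R => h^-1 *: (((fun t => cim (f (creal t))) \o shift x) (h *: (1 : R)) - cim (f (creal x)))) @ 0^' --> cim (p (creal x)).
  apply: cvg_trans him; apply: near_eq_cvg; near=> h.
  have h0 : h != 0 by near: h; exact: nbhs_dnbhs_neq.
  have E : f (creal (h + x)) = f (creal x) + p (creal (h + x)) * creal h by rewrite {1}fE -crealB addrK.
  by rewrite /= /GRing.scale /= mulr1 E cimD cimM cre_creal cim_creal; field.
by split; [apply/cvg_ex; exists (cim (p (creal x)))|exact/cvg_lim].
Unshelve. all: by end_near. Qed.

End ComplexDerivative.

Section PartialDerivatives.
Variables (R : realType) (N : nat).
Local Notation C := (Cx R).
Implicit Types (v : 'rV[C]_N) (j : 'I_N) (f : 'rV[C]_N -> C).

Lemma addr_evec v j (h : C) : h *: evec R j + v = upd v j (h + v 0 j).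
Proof.
apply/rowP => k; rewrite !mxE eqxx /=; case: eqVneq => [->|_]; first by rewrite mulr1.
by rewrite mulr0 add0r.
Qed.

Lemma upd_id v j : upd v j (v 0 j) = v.
Proof. by apply/rowP => k; rewrite mxE; case: eqP => // ->. Qed.

Lemma derive_cder f v j (d : C) : cder (fun t => f (upd v j t)) (v 0 j) d <->
  derivable f v (evec R j) /\ 'D_(evec R j) f v = d.
Proof.
have E : (fun h : C => h^-1 *: ((f \o shift v) (h *: evec R j) - f v)) =
         (fun h => h^-1 * (f (upd v j (h + v 0 j)) - f (upd v j (v 0 j)))).
  by apply: funext => h; rewrite /= addr_evec upd_id.
rewrite /derivable /derive /= E; split=> [/cder_cvgP fd|[fl <-]].
  split; first exact (cvgP d fd).
  exact (cvg_lim (@norm_hausdorff _ _) fd).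
by apply/cder_cvgP; exact fl.
Qed.

End PartialDerivatives.

(** * Integrals of complex-valued functions over real intervals *)

Section LineIntegrals.
Variable R : realType.
Local Notation C := (Cx R).
Local Notation mu := (@lebesgue_measure R).
Implicit Types (a b c : R) (f g : R -> C).

Definition cont_on a b f := forall x : R, a <= x <= b -> ccont f x.

Definition rint a b f : C :=
  (Rintegral mu `[a, b] (fun x => cre (f x)) +i* Rintegral mu `[a, b] (fun x => cim (f x)))%C.

Lemma cont_within a b (u : R -> R) : (forall x : R, a <= x <= b -> u @ x --> u x) ->
  {within `[a, b], continuous u}.
Proof.
move=> h; apply: continuous_in_subspaceT => x; rewrite inE /= in_itv /=; exact: h.
Qed.

Lemma cont_integrable a b (u : R -> R) : (forall x : R, a <= x <= b -> u @ x --> u x) ->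
  mu.-integrable `[a, b] (EFin \o u).
Proof.
move=> h; apply: continuous_compact_integrable; first exact: segment_compact.
exact: cont_within.
Qed.

Lemma cont_on_re a b f : cont_on a b f -> forall x : R, a <= x <= b -> (fun t => cre (f t)) @ x --> cre (f x).
Proof. by move=> h x /h /rcont_re. Qed.

Lemma cont_on_im a b f : cont_on a b f -> forall x : R, a <= x <= b -> (fun t => cim (f t)) @ x --> cim (f x).
Proof. by move=> h x /h /rcont_im. Qed.

Lemma cont_onM a b f g : cont_on a b f -> cont_on a b g -> cont_on a b (fun x => f x * g x).
Proof. by move=> hf hg x xab; apply: ccontM; [exact: hf|exact: hg]. Qed.
Lemma cont_onB a b f g : cont_on a b f -> cont_on a b g -> cont_on a b (fun x => f x - g x).
Proof. by move=> hf hg x xab; apply: ccontB; [exact: hf|exact: hg]. Qed.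
Lemma cont_on_cst a b (k : C) : cont_on a b (fun=> k).
Proof. by move=> x _; exact: ccont_cst. Qed.

Lemma rintD a b f g : cont_on a b f -> cont_on a b g ->
  rint a b (fun x => f x + g x) = rint a b f + rint a b g.
Proof.
move=> cf cg; apply: complex_eqP; rewrite /rint !cE.
  rewrite -RintegralD//; try (by apply: cont_integrable; exact: cont_on_re).
  by under eq_Rintegral do rewrite creD.
rewrite -RintegralD//; try (by apply: cont_integrable; exact: cont_on_im).
by under eq_Rintegral do rewrite cimD.
Qed.

Lemma rintZ a b f (k : C) : cont_on a b f -> rint a b (fun x => k * f x) = k * rint a b f.
Proof.
move=> cf.
have ir : mu.-integrable `[a, b] (EFin \o (fun x => cre (f x))) by apply: cont_integrable; exact: cont_on_re.
have ii : mu.-integrable `[a, b] (EFin \o (fun x => cim (f x))) by apply: cont_integrable; exact: cont_on_im.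
have irZ r : mu.-integrable `[a, b] (EFin \o (fun x => r * cre (f x))).
  by apply: cont_integrable => x xab; apply: cvgM; [exact: cvg_cst|exact: cont_on_re xab].
have iiZ r : mu.-integrable `[a, b] (EFin \o (fun x => r * cim (f x))).
  by apply: cont_integrable => x xab; apply: cvgM; [exact: cvg_cst|exact: cont_on_im xab].
apply: complex_eqP; rewrite /rint !cE -!RintegralZl//.
  by rewrite -RintegralB//; under eq_Rintegral do rewrite creM.
by rewrite -RintegralD//; under eq_Rintegral do rewrite cimM.
Qed.

Lemma rintB a b f g : cont_on a b f -> cont_on a b g ->
  rint a b (fun x => f x - g x) = rint a b f - rint a b g.
Proof.
move=> cf cg; have cg' := cont_onM (@cont_on_cst a b (-1)) cg.
rewrite -mulN1r -rintZ// -rintD//.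
by congr rint; apply: funext => x; rewrite mulN1r.
Qed.

Lemma eq_rint a b f g : (forall x : R, a <= x <= b -> f x = g x) -> rint a b f = rint a b g.
Proof.
move=> fg; apply: complex_eqP; rewrite /rint !cE; apply: eq_Rintegral => x;
  by rewrite inE /= in_itv /= => /fg ->.
Qed.

Lemma fine_measure_itv a b : a <= b -> fine (@lebesgue_measure R [set` `[a, b]]) = b - a.
Proof.
rewrite lebesgue_measure_itv /= lte_fin le_eqVlt => /predU1P[->|->]; last by [].
by rewrite ltxx subrr.
Qed.

Lemma rint_cst a b (k : C) : a <= b -> rint a b (fun=> k) = creal (b - a) * k.
Proof.
move=> ab; have lab := fine_measure_itv ab.
apply: complex_eqP; rewrite /rint !cE Rintegral_cst// (_ : fine _ = b - a) //; ring.
Qed.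

Lemma rint_split a b c f : a <= c -> c <= b -> cont_on a b f -> rint a b f = rint a c f + rint c b f.
Proof.
move=> ac cb cf.
have H (u : R -> R) : (forall x : R, a <= x <= b -> u @ x --> u x) ->
    Rintegral mu `[a, b] u = Rintegral mu `[a, c] u + Rintegral mu `[c, b] u.
  move=> cu; have iu := cont_integrable cu.
  have := @Rintegral_itvB R u (BLeft a) (BRight b) c iu.
  rewrite !bnd_simp => /(_ ac cb); rewrite Rintegral_itv_obnd_cbnd; last first.
    apply: integrableS iu => //; apply: subset_itvr; rewrite bnd_simp //.
  by move=> <-; rewrite addrC subrK.
by apply: complex_eqP; rewrite /rint !cE H//; [exact: cont_on_re|exact: cont_on_im].
Qed.

(* The factor 2 comes from estimating real and imaginary parts separately. *)
Lemma rint_bound a b f (M : R) : a <= b -> cont_on a b f ->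
  (forall x, a <= x <= b -> cabs (f x) <= M) -> cabs (rint a b f) <= 2 * (M * (b - a)).
Proof.
move=> ab cf fM.
have H (u : R -> R) : (forall x : R, a <= x <= b -> u @ x --> u x) -> (forall x, a <= x <= b -> `|u x| <= M) ->
    `|Rintegral mu `[a, b] u| <= M * (b - a).
  move=> cu uM; have iu := cont_integrable cu.
  apply: (le_trans (le_normr_Rintegral _ iu)) => //.
  have -> : M * (b - a) = Rintegral mu `[a, b] (fun=> M).
    by rewrite Rintegral_cst// (_ : fine _ = b - a)//; exact: fine_measure_itv.
  apply: le_Rintegral => //.
  - by apply: cont_integrable => x /cu; exact: cvg_norm.
  - by apply: cont_integrable => x _; exact: cvg_cst.
rewrite (le_trans (cabs_le _))// /rint !cE mulrDl mul1r.
apply: lerD.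
  apply: (H (fun x => cre (f x))) => [|x xab]; first exact: cont_on_re.
  by rewrite (le_trans (cre_le _))// fM.
apply: (H (fun x => cim (f x))) => [|x xab]; first exact: cont_on_im.
by rewrite (le_trans (cim_le _))// fM.
Qed.

Lemma rint_FTC a b (G : R -> C) f : a <= b -> cont_on a b f ->
  (forall x : R, a <= x <= b -> is_derive x 1 (fun t => cre (G t)) (cre (f x)) /\
     is_derive x 1 (fun t => cim (G t)) (cim (f x))) ->
  rint a b f = G b - G a.
Proof.
rewrite le_eqVlt => /predU1P[<- _ _|ab cf dG].
  by apply: complex_eqP; rewrite /rint !cE set_itv1 !Rintegral_set1 subrr.
have H (u U : R -> R) : (forall x : R, a <= x <= b -> u @ x --> u x) ->
    (forall x : R, a <= x <= b -> is_derive x 1 U (u x)) -> Rintegral mu `[a, b] u = U b - U a.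
  move=> cu dU; rewrite /Rintegral (@continuous_FTC2 _ u U)//.
  - exact: cont_within.
  - have cU x : a <= x <= b -> U @ x --> U x.
      move=> /dU [dx _]; apply: differentiable_continuous; exact/derivable1_diffP.
    split.
    + by move=> x; rewrite in_itv /= => /andP[ax xb]; apply: (@ex_derive _ _ _ _ _ _ _ (dU x _)); rewrite !ltW.
    + by apply: cvg_at_right_filter; apply: cU; rewrite lexx ltW.
    + by apply: cvg_at_left_filter; apply: cU; rewrite lexx ltW.
  - by move=> x; rewrite in_itv /= => /andP[ax xb]; rewrite derive1E; apply: derive_val; apply: dU; rewrite !ltW.
apply: complex_eqP; rewrite /rint !cE.
  by apply: (H (fun x => cre (f x)) (fun t => cre (G t))) => [|x /dG[]//]; exact: cont_on_re.
by apply: (H (fun x => cim (f x)) (fun t => cim (G t))) => [|x /dG[]//]; exact: cont_on_im.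
Qed.

End LineIntegrals.

(** * Contour integrals over rectangles and Goursat's theorem *)

Section Goursat.
Variable R : realType.
Local Notation C := (Cx R).
Implicit Types (F : C -> C) (a b c w h x y : R).

Definition mkC x y : C := (x +i* y)%C.
Definition ci : C := mkC 0 1.

Lemma mkCE x y : mkC x y = creal x + ci * creal y.
Proof. by apply: complex_eqP; rewrite !cE; ring. Qed.

Lemma mkC_eta (z : C) : mkC (cre z) (cim z) = z. Proof. by case: z. Qed.

(** The counterclockwise contour integral over the rectangle with lower left corner [a + i c] and
    sides [w], [h]; the factor [ci] is [dz = i dy] on the vertical sides. *)
Definition rect_int F a c w h : C :=
  rint a (a + w) (fun x => F (mkC x c)) - rint a (a + w) (fun x => F (mkC x (c + h)))
  + ci * (rint c (c + h) (fun y => F (mkC (a + w) y)) - rint c (c + h) (fun y => F (mkC a y))).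

Definition cont_rect F a c w h := forall x y, a <= x <= a + w -> c <= y <= c + h -> ccont F (mkC x y).

Lemma cont_rect_h F a c w h y : cont_rect F a c w h -> c <= y <= c + h ->
  cont_on a (a + w) (fun x => F (mkC x y)).
Proof.
move=> cF yc x xa; apply: (@ccont_compC R R (fun x => mkC x y) F); last exact: cF.
by apply: ccont_mk; [exact: rcont_id|exact: rcont_cst].
Qed.

Lemma cont_rect_v F a c w h x : cont_rect F a c w h -> a <= x <= a + w ->
  cont_on c (c + h) (fun y => F (mkC x y)).
Proof.
move=> cF xa y ya; apply: (@ccont_compC R R (fun y => mkC x y) F); last exact: cF.
by apply: ccont_mk; [exact: rcont_cst|exact: rcont_id].
Qed.

Lemma cont_rect_sub F a c w h a' c' w' h' : a <= a' -> a' + w' <= a + w -> c <= c' -> c' + h' <= c + h ->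
  cont_rect F a c w h -> cont_rect F a' c' w' h'.
Proof.
move=> ha hw hc hh cF x y /andP[x1 x2] /andP[y1 y2].
by apply: cF; apply/andP; split; lra.
Qed.

(** Each inner edge is traversed once in either direction and cancels. *)
Lemma rect_int_split F a c w h : 0 <= w -> 0 <= h -> cont_rect F a c w h ->
  rect_int F a c w h =
    rect_int F a c (w / 2) (h / 2) + rect_int F (a + w / 2) c (w / 2) (h / 2)
  + (rect_int F a (c + h / 2) (w / 2) (h / 2) + rect_int F (a + w / 2) (c + h / 2) (w / 2) (h / 2)).
Proof.
move=> w0 h0 cF.
have H y : c <= y <= c + h -> rint a (a + w) (fun x => F (mkC x y)) =
    rint a (a + w / 2) (fun x => F (mkC x y)) + rint (a + w / 2) (a + w) (fun x => F (mkC x y)).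
  move=> yc; apply: rint_split; [lra|lra|]; exact: cont_rect_h cF yc.
have V x : a <= x <= a + w -> rint c (c + h) (fun y => F (mkC x y)) =
    rint c (c + h / 2) (fun y => F (mkC x y)) + rint (c + h / 2) (c + h) (fun y => F (mkC x y)).
  move=> xa; apply: rint_split; [lra|lra|]; exact: cont_rect_v cF xa.
rewrite /rect_int !H ?V; try (apply/andP; split; lra).
have -> : a + w / 2 + w / 2 = a + w by lra.
have -> : c + h / 2 + h / 2 = c + h by lra.
ring.
Qed.

(** The constant 4 is the perimeter [2 (w + h)] times the factor 2 lost in [rint_bound]. *)
Lemma rect_int_bound F a c w h (M : R) : 0 <= w -> 0 <= h -> cont_rect F a c w h ->
  (forall x y, a <= x <= a + w -> c <= y <= c + h -> cabs (F (mkC x y)) <= M) ->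
  cabs (rect_int F a c w h) <= 4 * M * (w + h).
Proof.
move=> w0 h0 cF FM.
have H y : c <= y <= c + h -> cabs (rint a (a + w) (fun x => F (mkC x y))) <= 2 * (M * w).
  move=> yc; have := @rint_bound R a (a + w) _ M _ (cont_rect_h cF yc).
  by rewrite (addrC a) addrK; apply; [lra|move=> x; rewrite addrC => xa; exact: FM].
have V x : a <= x <= a + w -> cabs (rint c (c + h) (fun y => F (mkC x y))) <= 2 * (M * h).
  move=> xa; have := @rint_bound R c (c + h) _ M _ (cont_rect_v cF xa).
  by rewrite (addrC c) addrK; apply; [lra|move=> y; rewrite addrC => yc; exact: FM].
have H1 := H c ltac:(apply/andP; split; lra); have H2 := H (c + h) ltac:(apply/andP; split; lra).
have V1 := V a ltac:(apply/andP; split; lra); have V2 := V (a + w) ltac:(apply/andP; split; lra).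
rewrite /rect_int (le_trans (cabsD _ _))// cabsM.
have -> : cabs ci = 1 by rewrite /cabs !cE expr0n add0r expr1n sqrtr1.
rewrite mul1r; have := cabsB (rint a (a + w) (fun x => F (mkC x c))) (rint a (a + w) (fun x => F (mkC x (c + h)))).
have := cabsB (rint c (c + h) (fun y => F (mkC (a + w) y))) (rint c (c + h) (fun y => F (mkC a y))).
lra.
Qed.

Lemma rect_intD F G a c w h : 0 <= w -> 0 <= h -> cont_rect F a c w h -> cont_rect G a c w h ->
  rect_int (fun z => F z + G z) a c w h = rect_int F a c w h + rect_int G a c w h.
Proof.
move=> w0 h0 cF cG; rewrite /rect_int !rintD; first ring.
all: by [apply: cont_rect_h cF _; apply/andP; split; lra|apply: cont_rect_h cG _; apply/andP; split; lra|apply: cont_rect_v cF _; apply/andP; split; lra|apply: cont_rect_v cG _; apply/andP; split; lra].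
Qed.

Lemma cder_hline F c x d : cder F (mkC x c) d ->
  is_derive x 1 (fun t : R => cre (F (mkC t c))) (cre d) /\
  is_derive x 1 (fun t : R => cim (F (mkC t c))) (cim d).
Proof.
move=> Fd; have E t : mkC t c = creal t + mkC 0 c by apply: complex_eqP; rewrite !cE; ring.
have : cder (fun u : C => F (u + mkC 0 c)) (creal x) d.
  rewrite -[d]mulr1 -[1]addr0; apply: cder_comp; last by rewrite -E.
  by apply: cderD; [exact: cder_id|exact: cder_cst].
by move=> /cder_real; under [X in is_derive _ _ X (cre d)]eq_fun do rewrite -E; under [X in is_derive _ _ X (cim d)]eq_fun do rewrite -E.
Qed.

Lemma cder_vline F a y d : cder F (mkC a y) d ->
  is_derive y 1 (fun t : R => cre (F (mkC a t))) (cre (ci * d)) /\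
  is_derive y 1 (fun t : R => cim (F (mkC a t))) (cim (ci * d)).
Proof.
move=> Fd; have E t : mkC a t = ci * creal t + creal a by apply: complex_eqP; rewrite !cE; ring.
have : cder (fun u : C => F (ci * u + creal a)) (creal y) (ci * d).
  rewrite mulrC -[ci in d * ci]mulr1 -[ci * 1]addr0; apply: cder_comp; last by rewrite -E.
  by apply: cderD; [apply: cderZ; exact: cder_id|exact: cder_cst].
by move=> /cder_real; under [X in is_derive _ _ X (cre _)]eq_fun do rewrite -E; under [X in is_derive _ _ X (cim _)]eq_fun do rewrite -E.
Qed.

Lemma rect_int_primitive F G a c w h : 0 <= w -> 0 <= h -> cont_rect F a c w h ->
  (forall z, cder G z (F z)) -> rect_int F a c w h = 0.
Proof.
move=> w0 h0 cF dG.
have H y : c <= y <= c + h -> rint a (a + w) (fun x => F (mkC x y)) = G (mkC (a + w) y) - G (mkC a y).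
  move=> yc; apply: (@rint_FTC R a (a + w) (fun x => G (mkC x y))); [lra|exact: cont_rect_h cF yc|].
  by move=> x _; exact: cder_hline.
have V x : a <= x <= a + w -> ci * rint c (c + h) (fun y => F (mkC x y)) = G (mkC x (c + h)) - G (mkC x c).
  move=> xa; rewrite -rintZ; last exact: cont_rect_v cF xa.
  apply: (@rint_FTC R c (c + h) (fun y => G (mkC x y))); [lra| |].
    by apply: cont_onM; [exact: cont_on_cst|exact: cont_rect_v cF xa].
  by move=> y _; exact: cder_vline.
rewrite /rect_int mulrBr !H ?V; try (apply/andP; split; lra).
ring.
Qed.

End Goursat.

Section GoursatTheorem.
Variable R : realType.
Local Notation C := (Cx R).
Variables (F : C -> C) (a c w h : R).
Hypothesis w0 : 0 <= w.
Hypothesis h0 : 0 <= h.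
Hypothesis dF : forall x y, a <= x <= a + w -> c <= y <= c + h -> exists d, cder F (mkC x y) d.

Let contF : cont_rect F a c w h.
Proof. by move=> x y xa yc; have [d /cder_cont] := dF xa yc. Qed.

Let wn n : R := w / 2 ^+ n.
Let hn n : R := h / 2 ^+ n.
Let I (p : R * R) n := cabs (rect_int F p.1 p.2 (wn n) (hn n)).

(** Chooses a quarter whose contour integral has at least a quarter of the modulus of the whole. The
    last quarter is taken untested: by the triangle inequality it qualifies when the other three
    fail. *)
Let step (p : R * R) n : R * R :=
  let e := I p n / 4 in let u := wn n / 2 in let v := hn n / 2 in
  if e <= I p n.+1 then p else
  if e <= I (p.1 + u, p.2) n.+1 then (p.1 + u, p.2) else
  if e <= I (p.1, p.2 + v) n.+1 then (p.1, p.2 + v) else (p.1 + u, p.2 + v).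

Fixpoint goursat_corner n : R * R := if n is m.+1 then step (goursat_corner m) m else (a, c).
Local Notation q := goursat_corner.

Let wnS n : wn n.+1 = wn n / 2. Proof. by rewrite /wn exprS; field; rewrite expf_neq0. Qed.
Let hnS n : hn n.+1 = hn n / 2. Proof. by rewrite /hn exprS; field; rewrite expf_neq0. Qed.
Let wn0 n : 0 <= wn n. Proof. by rewrite divr_ge0// exprn_ge0. Qed.
Let hn0 n : 0 <= hn n. Proof. by rewrite divr_ge0// exprn_ge0. Qed.

Let stepP p n : [/\ p.1 <= (step p n).1 <= p.1 + wn n / 2 & p.2 <= (step p n).2 <= p.2 + hn n / 2].
Proof.
by have := wn0 n; have := hn0 n; rewrite /step; case: ifP => _; [|case: ifP => _; [|case: ifP => _]];
  split; apply/andP; split => /=; lra.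
Qed.

Let qS n : [/\ (q n).1 <= (q n.+1).1, (q n.+1).1 + wn n.+1 <= (q n).1 + wn n,
  (q n).2 <= (q n.+1).2 & (q n.+1).2 + hn n.+1 <= (q n).2 + hn n].
Proof.
rewrite wnS hnS /=; have [/andP[h1 h2] /andP[h3 h4]] := stepP (q n) n.
split; lra.
Qed.

Let q_mono m n : (m <= n)%N -> [/\ (q m).1 <= (q n).1, (q n).1 + wn n <= (q m).1 + wn m,
  (q m).2 <= (q n).2 & (q n).2 + hn n <= (q m).2 + hn m].
Proof.
elim: n => [|n IH]; first by rewrite leqn0 => /eqP ->.
rewrite leq_eqVlt => /predU1P[->|]; first by [].
rewrite ltnS => /IH[h1 h2 h3 h4]; have [h5 h6 h7 h8] := qS n; split; lra.
Qed.

Let cont_q n : cont_rect F (q n).1 (q n).2 (wn n) (hn n).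
Proof.
have [h1 h2 h3 h4] := q_mono (leq0n n); move: h1 h2 h3 h4; rewrite /= {2}/wn {2}/hn expr0 !divr1 => *.
by apply: cont_rect_sub contF.
Qed.

Let stepI p n : cont_rect F p.1 p.2 (wn n) (hn n) -> I p n <= 4 * I (step p n) n.+1.
Proof.
move=> cF; rewrite /step; case: ifP => [|/negbT]; rewrite -?ltNge; first lra.
case: ifP => [|/negbT]; rewrite -?ltNge; first lra.
case: ifP => [|/negbT]; rewrite -?ltNge; first lra.
rewrite /I /= wnS hnS (rect_int_split (wn0 n) (hn0 n) cF).
set A := rect_int F p.1 p.2 _ _; set B := rect_int F _ p.2 _ _; set D := rect_int F p.1 _ _ _.
set E := rect_int F _ _ _ _.
move=> *; have := cabsD (A + B) (D + E); have := cabsD A B; have := cabsD D E. lra.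
Qed.

Let q_int n : cabs (rect_int F a c w h) <= 4 ^+ n * I (q n) n.
Proof.
elim: n => [|n IH]; first by rewrite expr0 mul1r /I /wn /hn expr0 !divr1.
rewrite (le_trans IH)// exprSr -mulrA ler_wpM2l ?exprn_ge0//; exact: stepI.
Qed.

(** The nested rectangles meet in a point [z0], where [F] is an affine function [L] plus an error
    [E] that is small against [|z - z0|]. [L] has a primitive and contributes nothing; the integral
    of [E] over the [n]-th rectangle is small against the square of its size, and this square gains
    exactly the factor [4^-n] that offsets the [4^n] lost in the selection. *)
Lemma goursat : rect_int F a c w h = 0.
Proof.
have hasup (u l : nat -> R) : (forall m n, (m <= n)%N -> u m <= u n /\ u n + l n <= u m + l m) ->
    (forall n, 0 <= l n) -> exists x, forall n, u n <= x <= u n + l n.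
  move=> um l0; have ub m n : u m <= u n + l n.
    have [mn|nm] := leqP m n; first by have [? _] := um _ _ mn; have := l0 n; lra.
    by have [_ ?] := um _ _ (ltnW nm); have := l0 m; lra.
  exists (sup (range u)) => n; apply/andP; split.
    by apply: ub_le_sup; [exists (u 0%N + l 0%N) => _ [m _ <-]|exists n].
  by apply: ge_sup => [|_ [m _ <-]]; first by exists (u 0%N), 0%N.
have [x hx] := hasup (fun n => (q n).1) wn ltac:(by move=> m n /q_mono[]) wn0.
have [y hy] := hasup (fun n => (q n).2) hn ltac:(by move=> m n /q_mono[]) hn0.
have [d [phi [cphi phid FE]]] : exists d, cder F (mkC x y) d.
  by apply: dF; [have := hx 0%N|have := hy 0%N]; rewrite /= /wn /hn expr0 divr1.
set z0 := mkC x y in cphi phid FE *.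
pose L (z : C) := F z0 + d * (z - z0).
pose E (z : C) := (phi z - d) * (z - z0).
have FLE z : F z = L z + E z by rewrite /L /E FE; ring.
have dL z : cder (fun z => F z0 * z + d / 2 * (z - z0) * (z - z0)) z (L z).
  have d1 : cder (fun z => z - z0) z (1 - 0) by apply: cderB; [exact: cder_id|exact: cder_cst].
  rewrite (_ : L z = F z0 * 1 + ((d / 2 * (1 - 0)) * (z - z0) + (d / 2 * (z - z0)) * (1 - 0))); last first.
    by rewrite /L; field.
  by apply: cderD; [apply: cderZ; exact: cder_id|apply: cderM; [exact: cderZ|exact: d1]].
have cL z : ccont L z.
  apply: ccontD; first exact: ccont_cst.
  by apply: ccontM; [exact: ccont_cst|apply: ccontB; [exact: ccont_id|exact: ccont_cst]].
have small (e : R) : 0 < e -> cabs (rect_int F a c w h) <= 4 * e * (w + h) ^+ 2.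
  move=> e0; have /ccont_epsP/(_ e e0)[r r0 hr] := cphi.
  have [n hn_] : exists n, wn n + hn n < r.
    have [n nr] : exists n : nat, (w + h) / r < n%:R.
      exists (Num.trunc ((w + h) / r)).+1; exact: truncnS_gt.
    exists n; rewrite /wn /hn -mulrDl ltr_pdivrMr ?exprn_gt0//.
    rewrite ltr_pdivrMr// mulrC in nr; apply: (lt_le_trans nr).
    rewrite ler_pM2l// -natrX ler_nat; exact: ltnW (ltn_expl _ _).
  have near_z0 s t : (q n).1 <= s <= (q n).1 + wn n -> (q n).2 <= t <= (q n).2 + hn n ->
      cabs (mkC s t - z0) <= wn n + hn n.
    move=> /andP[s1 s2] /andP[t1 t2]; have /andP[x1 x2] := hx n; have /andP[y1 y2] := hy n.
    rewrite (le_trans (cabs_le _))// creB cimB /z0 /mkC !cE.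
    by apply: lerD; rewrite ler_norml; apply/andP; split; lra.
  have cE : cont_rect E (q n).1 (q n).2 (wn n) (hn n).
    move=> s t hs ht; apply: (@eq_ccont _ _ _ (fun z => F z - L z)).
      by move=> z; rewrite FLE addrC addKr.
    by apply: ccontB; [exact: (cont_q hs ht)|exact: cL].
  have Eb : cabs (rect_int E (q n).1 (q n).2 (wn n) (hn n)) <= 4 * (e * (wn n + hn n)) * (wn n + hn n).
    apply: (rect_int_bound (wn0 n) (hn0 n) cE) => s t hs ht; have hz := near_z0 s t hs ht.
    rewrite /E cabsM ler_pM ?cabs_ge0//; rewrite -phid ltW//; apply: hr; exact: le_lt_trans hz hn_.
  have FE' : rect_int F (q n).1 (q n).2 (wn n) (hn n) = rect_int E (q n).1 (q n).2 (wn n) (hn n).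
    have cL' : cont_rect L (q n).1 (q n).2 (wn n) (hn n) by move=> s t _ _; exact: cL.
    transitivity (rect_int (fun z => L z + E z) (q n).1 (q n).2 (wn n) (hn n)).
      by rewrite (_ : F = (fun z => L z + E z)); [|exact: funext].
    by rewrite (rect_intD (wn0 n) (hn0 n) cL' cE) (rect_int_primitive (wn0 n) (hn0 n) cL' dL) add0r.
  apply: (le_trans (q_int n)); rewrite /I FE'.
  apply: (le_trans (ler_wpM2l _ Eb)); first exact: exprn_ge0.
  have -> : 4 ^+ n = (2 ^+ n) ^+ 2 :> R by rewrite -exprM mulnC exprM; congr (_ ^+ _); ring.
  rewrite le_eqVlt; apply/orP; left; apply/eqP; rewrite /wn /hn; field; by rewrite expf_neq0.
apply/eqP; rewrite -cabs_eq0 eq_le cabs_ge0 andbT; apply/ler_addgt0Pr => e e0; rewrite add0r.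
have W0 : 0 <= (w + h) ^+ 2 by exact: sqr_ge0.
apply: (le_trans (small (e / (4 * ((w + h) ^+ 2 + 1))) _)); first by apply: divr_gt0 => //; lra.
rewrite mulrAC mulrA ler_pdivrMr; last lra.
nra.
Qed.

End GoursatTheorem.

(** * The complex exponential *)

Section Exponential.
Variable R : realType.
Local Notation C := (Cx R).
Implicit Types (z : C).

Lemma real_caratheodory (u : R -> R) (x d : R) : is_derive x 1 u d ->
  exists phi : R -> R, [/\ rcont phi x, phi x = d & forall y, u y = u x + phi y * (y - x)].
Proof.
move=> [du dE].
have ud : (fun h => h^-1 *: ((u \o shift x) (h *: (1 : R)) - u x)) @ 0^' --> d by rewrite -dE; exact: du.
exists (fun y => if y == x then d else (y - x)^-1 * (u y - u x)); rewrite eqxx; split; last first.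
- move=> y; case: eqVneq => [->|yx]; first by rewrite subrr mulr0 addr0.
  by rewrite mulrAC mulVf ?subr_eq0// mul1r addrC subrK.
- by [].
rewrite /rcont; apply/cvgrPdist_lt => e e0; rewrite eqxx.
have /cvgrPdist_lt/(_ e e0)/nbhs_ballP[r /= r0 hr] := ud.
apply/nbhs_ballP; exists r => // y xy; rewrite /=; case: eqVneq => [_|yx]; first by rewrite subrr normr0.
have := hr (y - x); rewrite /= /GRing.scale /= mulr1 subrK; apply; last by rewrite subr_eq0.
by move: xy; rewrite -!ball_normE /= sub0r normrN distrC.
Qed.

Lemma cder_phi (f : C -> C) z d (phi : C -> C) : ccont phi z -> phi z = d ->
  (\forall w \near z, f w = f z + phi w * (w - z)) -> cder f z d.
Proof.
move=> cphi phid H; apply: (@cder_near _ (fun w => f z + phi w * (w - z))).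
  by apply: filterS H => w ->.
by exists phi; split => // w; rewrite subrr mulr0 addr0.
Qed.

(** A real first-order expansion with complex linear main part: real and imaginary increments are at
    most [|w - z|], and their coefficients [A] and [B] tend to 0, so the error is [o(|w - z|)]. *)
Lemma cder_re_im (f A B : C -> C) z d : ccont A z -> ccont B z -> A z = 0 -> B z = 0 ->
  (forall w, f w = f z + d * (w - z) + creal (cre (w - z)) * A w + creal (cim (w - z)) * B w) ->
  cder f z d.
Proof.
move=> cA cB A0 B0 fE.
exists (fun w => if w == z then d else d + (creal (cre (w - z)) * A w + creal (cim (w - z)) * B w) / (w - z)).
rewrite eqxx; split; [|by []|]; last first.
  move=> w; rewrite {1}fE; case: eqVneq => [->|wz]; first by rewrite subrr !cre0 !cim0 creal0; ring.
  by rewrite mulrDl divfK ?subr_eq0//; ring.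
apply/ccont_epsP => e e0; rewrite eqxx.
have /ccont_epsP/(_ (e / 2) ltac:(lra))[r r0 hr] := cA.
have /ccont_epsP/(_ (e / 2) ltac:(lra))[s s0 hs] := cB.
exists (Num.min r s); first by rewrite lt_min r0 s0.
move=> w; rewrite lt_min => /andP[wr ws]; case: eqVneq => [_|wz]; first by rewrite subrr cabs0.
rewrite addrC addKr cabsM cabsV ltr_pdivrMr ?cabs_gt0 ?subr_eq0//.
have := hr w wr; have := hs w ws; rewrite A0 B0 !subr0 => hB hA.
rewrite (le_lt_trans (cabsD _ _))// !cabsM !cabs_creal.
have := cre_le (w - z); have := cim_le (w - z).
have h0 : 0 < cabs (w - z) by rewrite cabs_gt0 subr_eq0.
have := cabs_ge0 (A w); have := cabs_ge0 (B w).
have := normr_ge0 (cre (w - z)); have := normr_ge0 (cim (w - z)).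
move: h0 hA hB; set p := `|_|; set q := `|_|; set t := cabs (w - z); set a := cabs _; set b := cabs _.
move=> *; nra.
Qed.

Definition cexp z : C := creal (expR (cre z)) * mkC (cos (cim z)) (sin (cim z)).

Lemma cexpD z w : cexp (z + w) = cexp z * cexp w.
Proof. by apply: complex_eqP; rewrite /cexp /mkC !cE expRD cosD sinD; ring. Qed.

Lemma cexp0 : cexp 0 = 1.
Proof. by apply: complex_eqP; rewrite /cexp /mkC !cE expR0 cos0 sin0; ring. Qed.

Lemma cabs_cexp z : cabs (cexp z) = expR (cre z).
Proof.
rewrite cabsM cabs_creal ger0_norm ?expR_ge0// [cabs (mkC _ _)]/cabs !cE.
by rewrite cos2Dsin2 sqrtr1 mulr1.
Qed.

Lemma rcont_rre (u : R -> R) z : rcont u (cre z) -> rcont (fun w : C => u (cre w)) z.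
Proof. by move=> cu; apply: (@rcont_compR R C (@cre R) u) => //; apply: rcont_re; exact: ccont_id. Qed.
Lemma rcont_rim (u : R -> R) z : rcont u (cim z) -> rcont (fun w : C => u (cim w)) z.
Proof. by move=> cu; apply: (@rcont_compR R C (@cim R) u) => //; apply: rcont_im; exact: ccont_id. Qed.

Lemma cder_cexp0 : cder cexp 0 1.
Proof.
have [a [ca a0 aE]] := real_caratheodory (is_derive_expR (0 : R)).
have [b [cb b0 bE]] := real_caratheodory (is_derive_cos (0 : R)).
have [c [cc c0 cE']] := real_caratheodory (is_derive_sin (0 : R)).
rewrite expR0 in a0 aE; rewrite cos0 sin0 ?oppr0 in b0 bE c0 cE'.
(* For [w = x + i y], insert [expR x = 1 + x a], [cos y = 1 + y b] and [sin y = y c]: then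
   [cexp w - 1 - w] is [x A + y B] with these [A] and [B]. *)
pose A (w : C) : C := creal (a (cre w) - 1).
pose B (w : C) : C := mkC (b (cim w) * (1 + cre w * a (cre w))) ((1 + cre w * a (cre w)) * c (cim w) - 1).
have ra : rcont (fun w : C => a (cre w)) 0 by exact: rcont_rre.
have rb : rcont (fun w : C => b (cim w)) 0 by exact: rcont_rim.
have rc : rcont (fun w : C => c (cim w)) 0 by exact: rcont_rim.
have rr : rcont (fun w : C => cre w) 0 by apply: rcont_re; exact: ccont_id.
have rk k : rcont (fun w : C => (k : R)) 0 by exact: rcont_cst.
have r1 : rcont (fun w : C => 1 + cre w * a (cre w)) 0 by apply: rcontD => //; exact: rcontM.
apply: (@cder_re_im _ A B).
- by apply: ccont_creal; exact: rcontB.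
- by apply: ccont_mk; [exact: rcontM|apply: rcontB => //; exact: rcontM].
- by rewrite /A cre0 a0 subrr.
- by rewrite /B cre0 cim0 b0 c0; apply: complex_eqP; rewrite /mkC !cE; ring.
move=> w; rewrite cexp0 subr0 /cexp (aE (cre w)) (bE (cim w)) (cE' (cim w)) /A /B !subr0.
by apply: complex_eqP; rewrite /mkC !cE; ring.
Qed.

Lemma cder_cexp z : cder cexp z (cexp z).
Proof.
have H : cder (fun w => cexp z * cexp (w - z)) z (cexp z * (1 * (1 - 0))).
  apply: cderZ; apply: (@cder_comp _ (fun w => w - z) cexp); last by rewrite subrr; exact: cder_cexp0.
  by apply: cderB; [exact: cder_id|exact: cder_cst].
have E : cexp = (fun w => cexp z * cexp (w - z)) by apply: funext => w; rewrite -cexpD addrC subrK.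
by rewrite {1}E; move: H; rewrite subr0 !mulr1.
Qed.

Lemma cexp_2pi x : cexp (mkC x (2 * pi)) = cexp (mkC x 0).
Proof.
have e : 2 * pi = 0 + pi *+ 2 :> R by rewrite add0r mulr_natl.
by rewrite /cexp /mkC !cE e cosD2pi sinD2pi.
Qed.

Lemma ccont_cexp z : ccont cexp z. Proof. exact: cder_cont (cder_cexp z). Qed.

End Exponential.

(** * The mean value property and its consequences *)

Section MeanValue.
Variable R : realType.
Local Notation C := (Cx R).
Implicit Types (f : C -> C) (z a : C) (rho : R).

Lemma ci_neq0 : ci R != 0.
Proof. by rewrite -cabs_gt0 /cabs !cE expr0n add0r expr1n sqrtr1. Qed.

Definition circ rho (t : R) : C := creal rho * cexp (mkC 0 t).

Lemma cabs_circ rho t : 0 <= rho -> cabs (circ rho t) = rho.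
Proof. by move=> r0; rewrite /circ cabsM cabs_creal cabs_cexp expR0 mulr1 ger0_norm. Qed.

Lemma circE rho t : 0 < rho -> circ rho t = cexp (mkC (ln rho) t).
Proof.
move=> r0; have -> : mkC (ln rho) t = creal (ln rho) + mkC 0 t.
  by apply: complex_eqP; rewrite /mkC !cE; ring.
rewrite cexpD /circ; congr (_ * _); apply: complex_eqP; rewrite /cexp /mkC !cE lnK ?posrE// cos0 sin0; ring.
Qed.

Lemma ccont_circ rho t : ccont (circ rho) t.
Proof.
apply: ccontM; first exact: ccont_cst.
apply: (@ccont_compC R R (fun t => mkC 0 t) (@cexp R)); last exact: ccont_cexp.
by apply: ccont_mk; [exact: rcont_cst|exact: rcont_id].
Qed.

Lemma mean_value f a rho : 0 < rho -> ccont f a ->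
  (forall z, 0 < cabs (z - a) <= rho -> exists d, cder f z d) ->
  rint 0 (2 * pi) (fun t => f (a + circ rho t)) = creal (2 * pi) * f a.
Proof.
move=> r0 cfa df.
pose F z := f (a + cexp z).
have cabsF z : cabs (a + cexp z - a) = expR (cre z) by rewrite addrAC subrr add0r cabs_cexp.
have dF z : cre z <= ln rho -> exists d, cder F z d.
  move=> zr; have [|d fd] := df (a + cexp z).
    by rewrite cabsF expR_gt0 /= -(lnK (_ : rho \is Num.pos)) ?posrE// ler_expR.
  exists (d * (0 + cexp z)); apply: (@cder_comp _ (fun z => a + cexp z) f z (0 + cexp z) d); last exact: fd.
  by apply: cderD; [exact: cder_cst|exact: cder_cexp].
have pi0 : 0 <= 2 * pi :> R by rewrite mulr_ge0// pi_ge0.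
pose V s := rint 0 (2 * pi) (fun t => F (mkC s t)).
have cV s : s <= ln rho -> cont_on 0 (2 * pi) (fun t => F (mkC s t)).
  move=> sr t _; apply: (@ccont_compC R R (fun t => mkC s t) F); last first.
    by have [d /cder_cont] := dF (mkC s t) sr.
  by apply: ccont_mk; [exact: rcont_cst|exact: rcont_id].
have Vconst s : s <= ln rho -> V s = V (ln rho).
  move=> sr; have := @goursat R F s 0 (ln rho - s) (2 * pi) ltac:(lra) pi0.
  have -> : s + (ln rho - s) = ln rho by ring.
  move=> /(_ (fun x y hx _ => dF (mkC x y) (proj2 (andP hx)))).
  rewrite /rect_int add0r (_ : s + (ln rho - s) = ln rho); last by ring.
  rewrite (@eq_rint _ _ _ (fun x => F (mkC x 0)) (fun x => F (mkC x (2 * pi)))); last first.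
    by move=> x _; rewrite /F cexp_2pi.
  rewrite subrr add0r -/(V s) -/(V (ln rho)) => /eqP.
  by rewrite mulf_eq0 (negbTE (ci_neq0)) subr_eq0 => /eqP ->.
have -> : rint 0 (2 * pi) (fun t => f (a + circ rho t)) = V (ln rho).
  by apply: eq_rint => t _; rewrite circE.
apply/eqP; rewrite -subr_eq0 -cabs_eq0 eq_le cabs_ge0 andbT; apply/ler_addgt0Pr => e e0; rewrite add0r.
(* [rint_bound] over an interval of length [2 pi] costs the factor [4 pi]. *)
pose e1 := e / (4 * pi + 1).
have p1 : 0 < 4 * pi + 1 :> R by have := pi_ge0 R; lra.
have e10 : 0 < e1 by rewrite divr_gt0.
have /ccont_epsP/(_ e1 e10)[r rp hr] := cfa.
pose s := ln (Num.min rho (r / 2)).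
have m0 : 0 < Num.min rho (r / 2) by rewrite lt_min r0 /=; lra.
have sr : s <= ln rho by rewrite ler_ln ?posrE// ge_min lexx.
rewrite -(Vconst s sr).
have -> : creal (2 * pi) * f a = rint 0 (2 * pi) (fun=> f a) by rewrite rint_cst// subr0.
rewrite -rintB; [|exact: cV|exact: cont_on_cst].
apply: (le_trans (@rint_bound R 0 (2 * pi) _ e1 pi0 _ _)).
- by apply: cont_onB; [exact: cV|exact: cont_on_cst].
- move=> t _; apply/ltW; apply: hr; rewrite cabsF /= lnK ?posrE//.
  by rewrite gt_min; apply/orP; right; lra.
have key (P : R) : 0 <= P -> 2 * (e / (4 * P + 1) * (2 * P)) <= e.
  move=> P0; have q0 : 4 * P + 1 != 0 by apply: lt0r_neq0; lra.
  rewrite (_ : 2 * _ = e * (4 * P) / (4 * P + 1)); last by field.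
  by rewrite ler_pdivrMr ?ler_pM2l//; lra.
by rewrite subr0; apply: key; exact: pi_ge0.
Qed.

(** The mean value property of the Caratheodory slope [phi], which is continuous at [a] with value
    [d] and is the difference quotient elsewhere. *)
Lemma derivative_formula f a rho d : 0 < rho -> cder f a d ->
  (forall z, cabs (z - a) <= rho -> exists d, cder f z d) ->
  creal (2 * pi) * d = rint 0 (2 * pi) (fun t => (circ rho t)^-1 * (f (a + circ rho t) - f a)).
Proof.
move=> r0 [phi [cphi phid fE]] df.
rewrite -phid -(mean_value r0 cphi).
  apply: eq_rint => t _; rewrite (fE (a + circ rho t)); field.
  by rewrite -cabs_gt0 cabs_circ// ltW.
move=> z /andP[z0 zr]; have [d' fd'] := df z zr.
have za : z - a != 0 by rewrite -cabs_gt0.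
have d1 : cder (fun w => w - a) z (1 - 0) by apply: cderB; [exact: cder_id|exact: cder_cst].
have d2 : cder (fun w => f w - f a) z (d' - 0) by apply: cderB => //; exact: cder_cst.
have H := cderM d2 (@cderV R (fun w => w - a) z _ za d1); eexists; refine (@cder_near R _ phi z _ _ H).
apply/nbhsCP; exists (cabs (z - a)); [by []|move=> w wz].
have wa : w - a != 0.
  by rewrite subr_eq0; apply: contraTneq wz => ->; rewrite cabs_distC ltxx.
by rewrite (fE w); field.
Qed.

(* Precomposing with a disc automorphism moves an arbitrary point of the disc to its centre. *)
Lemma eq0_on_disc f : (forall z, cabs z <= 1 -> exists d, cder f z d) ->
  (forall z, cabs z = 1 -> f z = 0) -> forall z, cabs z <= 1 -> f z = 0.
Proof.
move=> df f0 a; rewrite le_eqVlt => /predU1P[/f0//|a1].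
pose m (z : C) := (z + a) / (1 + cconj a * z).
have den z : cabs z <= 1 -> 1 + cconj a * z != 0.
  move=> z1; apply/eqP => h; have u1 : cconj a * z = - 1 by apply/eqP; rewrite -addr_eq0 addrC h.
  have : cabs (cconj a * z) = 1 by rewrite u1 cabsN cabs1.
  rewrite cabsM cabs_conj => h1; have := cabs_ge0 a; have := cabs_ge0 z; nra.
have mE z : cabs z <= 1 -> 1 - cabs (m z) ^+ 2 = (1 - cabs a ^+ 2) * (1 - cabs z ^+ 2) / cabs (1 + cconj a * z) ^+ 2.
  move=> z1; rewrite /m cabsM cabsV exprMn exprVn.
  have d0 : cabs (1 + cconj a * z) ^+ 2 != 0 by rewrite expf_neq0// cabs_eq0 den.
  apply: (mulIf d0); rewrite mulrBl divfK// divfK// mul1r !sqr_cabs !cE; ring.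
have m1 z : cabs z <= 1 -> cabs (m z) <= 1.
  move=> z1; rewrite -(@ler_pXn2r _ 2)// ?nnegrE ?cabs_ge0// expr1n -subr_ge0 mE//.
  by rewrite !mulr_ge0 ?invr_ge0 ?sqr_ge0// subr_ge0 expr_le1 ?cabs_ge0// ltW.
have m_eq1 z : cabs z = 1 -> cabs (m z) = 1.
  move=> z1; apply/eqP; rewrite -(@eqrXn2 _ 2)// ?cabs_ge0// expr1n eq_sym -subr_eq0 mE ?z1// expr1n subrr.
  by rewrite mulr0 mul0r.
have dfm z : cabs z <= 1 -> exists d, cder (fun z => f (m z)) z d.
  move=> z1; have [d fd] := df _ (m1 z z1); eexists; apply: (@cder_comp _ m f); last exact: fd.
  apply: cderM; first by apply: cderD; [exact: cder_id|exact: cder_cst].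
  apply: cderV; first exact: den.
  by apply: cderD; [exact: cder_cst|apply: cderZ; exact: cder_id].
have c0 : ccont (fun z => f (m z)) 0 by have [d /cder_cont] := dfm 0 ltac:(by rewrite cabs0).
have := @mean_value (fun z => f (m z)) 0 1 ltr01 c0.
have -> : f (m 0) = f a by rewrite /m mulr0 addr0 add0r divr1.
rewrite (@eq_rint _ _ _ _ (fun=> 0)); last first.
  by move=> t _; rewrite f0// m_eq1// add0r cabs_circ.
rewrite rint_cst ?mulr0; last by rewrite mulr_ge0// pi_ge0.
move=> H; have {H} /esym/eqP := H (fun z hz => dfm z ltac:(by move: hz; rewrite subr0 => /andP[])).
by rewrite mulf_eq0 creal_eq0 mulf_eq0 pnatr_eq0 (gt_eqF (pi_gt0 R)) => /eqP.
Qed.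

(** The real mean value theorem is applied to the real and to the imaginary part of [f] minus its
    linear part along the segment; hence the factor 2. *)
Lemma mvt_bound f a b d (f' : C -> C) (e : R) :
  (forall t : R, 0 <= t <= 1 -> cder f (a + creal t * (b - a)) (f' (a + creal t * (b - a)))) ->
  (forall t : R, 0 <= t <= 1 -> cabs (f' (a + creal t * (b - a)) - d) <= e) ->
  cabs (f b - f a - d * (b - a)) <= 2 * (e * cabs (b - a)).
Proof.
move=> df dfe.
pose g (t : C) := f (a + t * (b - a)) - d * (t * (b - a)).
have dg (t : R) : 0 <= t <= 1 -> cder g (creal t) ((f' (a + creal t * (b - a)) - d) * (b - a)).
  move=> t01; have d1 : cder (fun t => t * (b - a)) (creal t) (b - a).
    by have := cderM (@cder_id R (creal t)) (@cder_cst R (b - a) (creal t)); rewrite mul1r mulr0 addr0.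
  have d2 : cder (fun t => a + t * (b - a)) (creal t) (b - a).
    by have := cderD (@cder_cst R a (creal t)) d1; rewrite add0r.
  rewrite mulrBl; apply: cderB (cderZ d d1).
  exact: (@cder_comp R (fun t => a + t * (b - a)) f _ _ _ d2 (df t t01)).
have gE : f b - f a - d * (b - a) = g 1 - g 0.
  rewrite /g mul1r mul0r mulr0 addr0 subr0 (addrC a) subrK; ring.
have H (u : R -> R) (u' : R -> R) : (forall t : R, 0 <= t <= 1 -> is_derive t 1 u (u' t)) ->
    (forall t : R, 0 <= t <= 1 -> `|u' t| <= e * cabs (b - a)) -> `|u 1 - u 0| <= e * cabs (b - a).
  move=> du ub; have [|c|c c01] := @MVT R u u' 0 1 ltr01.
  - move=> x; rewrite in_itv /= => /andP[x0 x1]; apply: du; rewrite !ltW//.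
  - apply: cont_within => x /du[dx _]; apply: differentiable_continuous; exact/derivable1_diffP.
  - rewrite subr0 mulr1 => ->; apply: ub; move: c01; rewrite in_itv /= => /andP[h1 h2]; by rewrite !ltW.
rewrite gE (le_trans (cabs_le _))// creB cimB mulr_natl mulr2n.
have bnd (t : R) : 0 <= t <= 1 -> cabs ((f' (a + creal t * (b - a)) - d) * (b - a)) <= e * cabs (b - a).
  by move=> t01; rewrite cabsM ler_wpM2r ?cabs_ge0// dfe.
apply: lerD.
  apply: (H (fun t => cre (g (creal t))) (fun t => cre ((f' (a + creal t * (b - a)) - d) * (b - a)))) => t t01.
    by have [] := cder_real (dg t t01).
  by rewrite (le_trans (cre_le _))// bnd.
apply: (H (fun t => cim (g (creal t))) (fun t => cim ((f' (a + creal t * (b - a)) - d) * (b - a)))) => t t01.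
  by have [] := cder_real (dg t t01).
by rewrite (le_trans (cim_le _))// bnd.
Qed.

End MeanValue.

(** * Joint differentiability and the chain rule in several variables *)

Section SeveralVariables.
Variables (R : realType) (N : nat).
Local Notation C := (Cx R).
Implicit Types (D : set 'rV[C]_N) (f : 'rV[C]_N -> C) (v w : 'rV[C]_N) (j k : 'I_N).

Local Notation "'d_ j f" := (fun v => 'D_(evec R j) f v) (at level 10, j at level 8, f at next level).

Lemma ccontP (T : topologicalType) (h : T -> C) (t : T) :
  ccont h t <-> forall e : R, 0 < e -> \forall s \near t, cabs (h s - h t) < e.
Proof. exact: cvgCP. Qed.

Lemma holo_cont D f v : holomorphic_on D f -> D v -> ccont f v.
Proof. by move=> [_ h] /h[]. Qed.

Lemma holo_cder D f v j (t : C) : holomorphic_on D f -> D (upd v j t) ->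
  cder (fun s => f (upd v j s)) t ('D_(evec R j) f (upd v j t)).
Proof.
move=> [_ h] /h[_ /(_ j) dj].
have := proj2 (derive_cder f (upd v j t) j ('D_(evec R j) f (upd v j t))) (conj dj erefl).
rewrite updE eqxx; congr cder.
by apply: funext => s; rewrite upd_upd.
Qed.

Lemma ccont_rVP (T : topologicalType) (h : T -> 'rV[C]_N) t :
  (forall k, ccont (fun s => h s 0 k) t) -> h @ t --> h t.
Proof. by move=> H; apply: (proj2 (@cvg_rVP R N T (nbhs t) _ h (h t))) => k; exact: H. Qed.

Lemma ccont_comp_rV (T : topologicalType) (h : T -> 'rV[C]_N) f t :
  (forall k, ccont (fun s => h s 0 k) t) -> ccont f (h t) -> ccont (fun s => f (h s)) t.
Proof. by move=> /ccont_rVP; exact: ccont_comp. Qed.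

(** The tube lemma: compactness of [[a, b]] turns continuity along [{v} x [a, b]] into closeness
    uniform in [t]. *)
Lemma tube_unif (T : topologicalType) (g : T * R -> C) (v : T) (a b : R) :
  (forall t : R, a <= t <= b -> ccont g (v, t)) -> forall e : R, 0 < e ->
  \forall s \near v, forall t, a <= t <= b -> cabs (g (s, t) - g (v, t)) < e.
Proof.
move=> cg e e0.
have /compact_near_coveringP cK := @segment_compact R a b.
have := cK T (nbhs v) (fun s t => cabs (g (s, t) - g (v, t)) < e) _.
have H : forall t, `[a, b]%classic t -> \forall t' \near t & s \near v, cabs (g (s, t') - g (v, t')) < e.
  move=> t; rewrite /= in_itv /= => /cg cgt.
  have /ccontP/(_ (e / 2) ltac:(lra)) := cgt.
  move=> [[P Q] /= [nP nQ] PQ].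
  exists (Q, P); first by split.
  move=> [t' s] [/= Qt' Pw].
  have h1 := PQ (s, t') (conj Pw Qt'); have h2 := PQ (v, t') (conj (nbhs_singleton nP) Qt').
  rewrite (_ : _ - _ = (g (s, t') - g (v, t)) - (g (v, t') - g (v, t))); last by ring.
  by rewrite (le_lt_trans (cabsB _ _))// [e]splitr ltrD.
move=> /(_ _ H); apply: filterS => s hs t tab; apply: hs.
by rewrite /= in_itv.
Qed.

(** For all [w] near [v], [derivative_formula] expresses the partial derivative as an integral over
    a circle of one fixed radius. Its integrand is jointly continuous in [w] and the angle, so
    [tube_unif] passes the continuity through the integral. *)
Lemma ccont_partial D f j v : holomorphic_on D f -> D v -> ccont ('d_j f) v.
Proof.
move=> hf Dv; have oD := hf.1.
have /nbhs_rVP[r r0 rD] : nbhs v D by exact: open_nbhs_nbhs.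
(* A circle of radius [rho] about the [j]-th coordinate of a point within [rho] of [v] stays within
   [2 rho < r]. *)
pose rho := r / 4; have rho0 : 0 < rho by rewrite divr_gt0.
have Dw w z : (forall k, cabs (w 0 k - v 0 k) < rho) -> cabs (z - w 0 j) <= rho -> D (upd w j z).
  move=> wv zw; apply: rD => k; rewrite updE; case: eqP => [->|_].
    rewrite (_ : z - _ = (z - w 0 j) + (w 0 j - v 0 j)); last by ring.
    by rewrite (le_lt_trans (cabsD _ _))//; have := wv j; rewrite /rho in zw *; lra.
  by have := wv k; rewrite /rho; lra.
pose g (p : 'rV[C]_N * R) : C := (circ rho p.2)^-1 * (f (upd p.1 j (p.1 0 j + circ rho p.2)) - f p.1).
have circ0 t : circ rho t != 0 by rewrite -cabs_gt0 cabs_circ// ltW.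
have ccirc (p : 'rV[C]_N * R) : ccont (fun p : 'rV[C]_N * R => circ rho p.2) p.
  by apply: (@ccont_compR R ('rV[C]_N * R)%type (fun p => p.2) (circ rho)); [exact: cvg_snd|exact: ccont_circ].
have cco (p : 'rV[C]_N * R) k : ccont (fun p : 'rV[C]_N * R => p.1 0 k) p.
  by apply: (@ccont_comp R _ _ (fun p : 'rV[C]_N * R => p.1) (fun x : 'rV[C]_N => x 0 k)); [exact: cvg_fst|exact: ccont_coord].
have cg w t : (forall k, cabs (w 0 k - v 0 k) < rho) -> ccont g (w, t).
  move=> wv; apply: ccontM; first by apply: ccontV; [exact: circ0|exact: ccirc].
  apply: ccontB.
    apply: (@ccont_comp_rV _ (fun p : 'rV[C]_N * R => upd p.1 j (p.1 0 j + circ rho p.2)) f).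
      move=> k; apply: (@eq_ccont _ _ _ (fun p : 'rV[C]_N * R => if k == j then p.1 0 j + circ rho p.2 else p.1 0 k)).
        by move=> p; exact: updE.
      by case: (k == j); [apply: ccontD; [exact: cco|exact: ccirc]|exact: cco].
    apply: holo_cont hf _; apply: Dw => //=.
    by rewrite addrAC subrr add0r cabs_circ// ltW.
  apply: (@ccont_comp R _ _ (fun p : 'rV[C]_N * R => p.1) f); first exact: cvg_fst.
  apply: holo_cont hf _; rewrite /= -(upd_id w j); apply: Dw => //.
  by rewrite subrr cabs0 ltW.
have self : forall k, cabs (v 0 k - v 0 k) < rho by move=> k; rewrite subrr cabs0.
have formula w : (forall k, cabs (w 0 k - v 0 k) < rho) ->
    creal (2 * pi) * 'D_(evec R j) f w = rint 0 (2 * pi) (fun t => g (w, t)).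
  move=> wv.
  have H z : cabs (z - w 0 j) <= rho -> cder (fun s => f (upd w j s)) z ('D_(evec R j) f (upd w j z)).
    by move=> hz; apply: holo_cder hf _; exact: Dw.
  have h0 : cabs (w 0 j - w 0 j) <= rho by rewrite subrr cabs0 ltW.
  have := @derivative_formula R (fun s => f (upd w j s)) (w 0 j) rho _ rho0 (H _ h0).
  rewrite upd_id; apply => z hz; eexists; exact: (H z hz).
have pi0 : 0 <= 2 * pi :> R by rewrite mulr_ge0// pi_ge0.
have cgt w : (forall k, cabs (w 0 k - v 0 k) < rho) -> cont_on 0 (2 * pi) (fun t => g (w, t)).
  move=> wv t _; apply: (@ccont_comp R _ _ (fun t : R => (w, t)) g); last exact: cg.
  move=> A [[P Q] /= [nP nQ] PQ]; apply: filterS nQ => t' Qt'.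
  have Pw : P w := @nbhs_singleton _ w P nP.
  exact (PQ (w, t') (conj Pw Qt')).
apply/ccontP => e e0.
have e20 : 0 < e / 4 by lra.
have nv : nbhs v [set w : 'rV[C]_N | forall k, cabs (w 0 k - v 0 k) < rho] by apply/nbhs_rVP; exists rho.
have := tube_unif (fun t (_ : 0 <= t <= 2 * pi) => cg v t self) e20.
move: nv; apply: filterS2 => w wv ht.
have p0 : 0 < 2 * pi :> R by rewrite mulr_gt0// pi_gt0.
have E : creal (2 * pi) * ('D_(evec R j) f w - 'D_(evec R j) f v) =
    rint 0 (2 * pi) (fun t => g (w, t) - g (v, t)).
  rewrite (rintB (cgt w wv) (cgt v self)) -(formula w wv) -(formula v self).
  exact: mulrBr.
have B := rint_bound pi0 (cont_onB (cgt w wv) (cgt v self)) (fun t t01 => ltW (ht t t01)).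
move: B; rewrite -E {E}.
rewrite cabsM cabs_creal ger0_norm// subr0; move: (cabs _) p0 => A; move: (2 * pi : R) => P *.
suff : A <= e / 2 by lra.
by rewrite -(@ler_pM2l _ P)//; lra.
Qed.

Definition splice v w n : 'rV[C]_N := \row_k (if (k < n)%N then w 0 k else v 0 k).

(* The increment of f is telescoped along the coordinates; each slope is controlled by the
   continuity of the corresponding partial derivative. *)
Lemma holo_total D f v : holomorphic_on D f -> D v -> exists Phi : 'I_N -> 'rV[C]_N -> C,
  [/\ forall j, ccont (Phi j) v, forall j, Phi j v = 'D_(evec R j) f v &
   nbhs v [set w : 'rV[C]_N | f w = f v + \sum_j Phi j w * (w 0 j - v 0 j)]].
Proof.
move=> hf Dv; have oD := hf.1.
have /nbhs_rVP[r r0 rD] : nbhs v D by exact: open_nbhs_nbhs.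
pose d j : C := 'D_(evec R j) f v.
pose slope j w : C := if w 0 j == v 0 j then d j else
  (f (splice v w j.+1) - f (splice v w j)) / (w 0 j - v 0 j).
have spliceS w (j : 'I_N) : splice v w j.+1 = upd (splice v w j) j (w 0 j).
  apply/rowP => k; rewrite !mxE ltnS leq_eqVlt.
  have [->|kj] := eqVneq k j; first by rewrite eqxx.
  by rewrite (_ : (k == j :> nat) = false)//; apply/negbTE.
have splicej w (j : 'I_N) : splice v w j = upd (splice v w j) j (v 0 j).
  apply/rowP => k; rewrite !mxE.
  by have [->|kj] := eqVneq k j; rewrite ?ltnn.
exists slope; split.
- move=> j; apply/ccontP => e e0.
  have e20 : 0 < e / 4 by lra.
  have /ccontP/(_ _ e20) := @ccont_partial D f j v hf Dv.
  move=> /nbhs_rVP[s s0 hs].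
  apply/nbhs_rVP; exists (Num.min r s) => [|w wv]; first by rewrite lt_min r0 s0.
  have wr k : cabs (w 0 k - v 0 k) < r by have := wv k; rewrite lt_min => /andP[].
  have ws k : cabs (w 0 k - v 0 k) < s by have := wv k; rewrite lt_min => /andP[].
  rewrite {2}/slope eqxx /slope; case: eqVneq => [_|wvj]; first by rewrite subrr cabs0.
  have wv0 : w 0 j - v 0 j != 0 by rewrite subr_eq0.
  rewrite (_ : _ - d j = (f (splice v w j.+1) - f (splice v w j) - d j * (w 0 j - v 0 j)) / (w 0 j - v 0 j)); last by field.
  rewrite cabsM cabsV ltr_pdivrMr ?cabs_gt0//.
  have pt (t : R) : 0 <= t <= 1 -> forall k, cabs (upd (splice v w j) j (v 0 j + creal t * (w 0 j - v 0 j)) 0 k - v 0 k) <= cabs (w 0 k - v 0 k).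
    move=> /andP[t0 t1] k; rewrite !mxE; case: eqP => [->|_].
      rewrite addrAC subrr add0r cabsM cabs_creal ger0_norm//.
      by have := cabs_ge0 (w 0 j - v 0 j); nra.
    by case: ifP => _ //; rewrite subrr cabs0 cabs_ge0.
  have := @mvt_bound R (fun t => f (upd (splice v w j) j t)) (v 0 j) (w 0 j) (d j)
     (fun t => 'D_(evec R j) f (upd (splice v w j) j t)) (e / 4) _ _.
  rewrite -spliceS -splicej => H; apply: le_lt_trans (H _ _) _.
  - move=> t t01; apply: holo_cder hf _; apply: rD => k; exact: le_lt_trans (pt t t01 k) (wr k).
  - move=> t t01; apply/ltW; apply: hs => k; exact: le_lt_trans (pt t t01 k) (ws k).
  by have : 0 < cabs (w 0 j - v 0 j) by [rewrite cabs_gt0]; nra.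
- by move=> j; rewrite /slope eqxx.
- apply/nbhs_rVP; exists 1; [exact: ltr01|move=> w _ /=].
  have : \sum_(j < N) (f (splice v w j.+1) - f (splice v w j)) = f w - f v.
    rewrite -(big_mkord xpredT (fun l : nat => f (splice v w l.+1) - f (splice v w l))).
    rewrite (telescope_sumr (fun l : nat => f (splice v w l)) (leq0n N)).
    have -> : splice v w N = w by apply/rowP => k; rewrite mxE ltn_ord.
    by have -> : splice v w 0 = v by apply/rowP => k; rewrite mxE.
  move=> E; rewrite [LHS](_ : _ = f v + (f w - f v)); last by rewrite addrC subrK.
  rewrite -E; congr (_ + _); apply: eq_bigr => j _; rewrite /slope; case: eqVneq => [wv|wv].
    by rewrite spliceS wv -splicej !subrr mulr0.
  by rewrite divfK// subr_eq0.
Qed.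

Lemma holo_chain D f (P : C -> 'rV[C]_N) (z : C) (dP : 'I_N -> C) : holomorphic_on D f -> D (P z) ->
  (forall j, cder (fun t => P t 0 j) z (dP j)) ->
  cder (fun t => f (P t)) z (\sum_j 'D_(evec R j) f (P z) * dP j).
Proof.
move=> hf DP dPz; have [Phi [cPhi PhiE fE]] := holo_total hf DP.
have [p Hp] := choice (fun j => dPz j).
have cP : P @ z --> P z by apply: (@ccont_rVP C P z) => k; exact: cder_cont (dPz k).
apply: (@cder_phi _ _ _ _ (fun t => \sum_j Phi j (P t) * p j t)).
- apply: ccont_sum => j _; apply: ccontM; first exact: (ccont_comp cP (cPhi j)).
  by have [] := Hp j.
- by apply: eq_bigr => j _; rewrite PhiE; have [_ ->] := Hp j.
have nf : nbhs z [set t | f (P t) = f (P z) + \sum_j Phi j (P t) * (P t 0 j - P z 0 j)] by exact: cP fE.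
apply: (@filterS _ (nbhs z) _ _ _ _ nf) => t /= ->; congr (_ + _).
rewrite mulr_suml; apply: eq_bigr => j _; have [_ _ /(_ t) ->] := Hp j.
by rewrite addrAC subrr add0r mulrA.
Qed.

(** The pointwise content of [holomorphic_on], stable under products and compositions without a
    domain to keep track of. *)
Definition holo_at f v := ccont f v /\ forall j, exists d, cder (fun t => f (upd v j t)) (v 0 j) d.

Lemma holoP D f : holomorphic_on D f <-> open D /\ forall v, D v -> holo_at f v.
Proof.
split=> [hf|[oD h]]; split; try exact: hf.1; try exact: oD.
  move=> v Dv; split; first exact: holo_cont hf Dv.
  by move=> j; eexists; apply: holo_cder hf _; rewrite upd_id.
move=> v /h[cf df]; split; first exact: cf.
by move=> j; have [d /derive_cder[]] := df j.
Qed.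

Lemma holo_at_cst (c : C) v : holo_at (fun=> c) v.
Proof. by split=> [|j]; [exact: ccont_cst|exists 0; exact: cder_cst]. Qed.

Lemma holo_at_coord k v : holo_at (fun w => w 0 k) v.
Proof.
split=> [|j]; first exact: ccont_coord.
have [->|kj] := eqVneq k j.
  exists 1; rewrite (_ : (fun t => _) = (fun t => t)); first exact: cder_id.
  by apply: funext => t; rewrite updE eqxx.
exists 0; rewrite (_ : (fun t => _) = (fun=> v 0 k)); first exact: cder_cst.
by apply: funext => t; rewrite updE (negbTE kj).
Qed.

Lemma holo_atM f g v : holo_at f v -> holo_at g v -> holo_at (fun w => f w * g w) v.
Proof.
move=> [cf df] [cg dg]; split=> [|j]; first exact: ccontM.
by have [d hd] := df j; have [e he] := dg j; eexists; exact: cderM hd he.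
Qed.

Lemma holo_at_compC f (h : C -> C) d v : holo_at f v -> cder h (f v) d -> holo_at (fun w => h (f w)) v.
Proof.
move=> [cf df] dh; split=> [|j]; first exact: ccont_compC cf (cder_cont dh).
have [e he] := df j; exists (d * e); apply: (@cder_comp R (fun t => f (upd v j t)) h _ _ _ he).
by rewrite upd_id.
Qed.

End SeveralVariables.

Section Composition.
Variables (R : realType) (N M : nat).
Local Notation C := (Cx R).

Lemma holo_at_comp (D : set 'rV[C]_N) (f : 'rV[C]_N -> C) (P : 'rV[C]_M -> 'rV[C]_N) v :
  holomorphic_on D f -> D (P v) -> (forall k, holo_at (fun w => P w 0 k) v) ->
  holo_at (fun w => f (P w)) v.
Proof.
move=> hf DP hP; split=> [|j].
  by apply: (@ccont_comp_rV R N _ P f); [move=> k; exact: (hP k).1|exact: holo_cont hf DP].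
have [d hd] := choice (fun k => (hP k).2 j).
eexists; apply: (@holo_chain R N D f (fun t => P (upd v j t)) (v 0 j) d hf); last exact: hd.
by rewrite upd_id.
Qed.

End Composition.

(** * Complex powers *)

Section ComplexPowers.
Variable R : realType.
Local Notation C := (Cx R).
Implicit Types (u v : C) (a b r : R).

Definition clog u : C := mkC (ln (cabs u)) (carg u).

Lemma cre_gt0_neq0 u : 0 < cre u -> u != 0.
Proof. by move=> u0; apply: contraTneq u0 => ->; rewrite cre0 ltxx. Qed.

(** [carg] doubles the arctangent of [t = y / (r + x)], the tangent of the half angle, and the
    double-angle formulas give back [x / r] and [y / r]. *)
Lemma cexp_clog u : 0 < cre u -> cexp (clog u) = u.
Proof.
move=> x0; have u0 := cre_gt0_neq0 x0; have r0 : 0 < cabs u by rewrite cabs_gt0.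
have r2 := sqr_cabs u; rewrite /cexp /clog /mkC !cE lnK ?posrE// /carg.
set x := cre u in x0 r2 *; set y := cim u in r2 *; set r := cabs u in r0 r2 *.
have d0 : 0 < r + x by lra.
set t := y / (r + x).
have t1 : 1 + t ^+ 2 = 2 * r / (r + x).
  by rewrite /t; rewrite expr_div_n (_ : y ^+ 2 = r ^+ 2 - x ^+ 2); [field; rewrite gt_eqF|rewrite r2; ring].
have cA : cos (atan t) ^+ 2 = (r + x) / (2 * r).
  rewrite cos_atan exprVn sqr_sqrtr; last by rewrite addr_ge0// sqr_ge0.
  by rewrite t1 invf_div.
have cA0 : cos (atan t) != 0.
  by rewrite -(sqrf_eq0 (cos _)) cA mulf_neq0 ?invr_eq0 ?mulf_neq0// gt_eqF.
have sA : sin (atan t) = t * cos (atan t) by have := atanK t; rewrite /tan => h; rewrite -{2}h divfK.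
have c2 : cos (2 * atan t) = x / r.
  by rewrite mulr_natl cos_mulr2n cA; field; rewrite gt_eqF.
have s2 : sin (2 * atan t) = y / r.
  rewrite mulr_natl sin_mulr2n sA mulrCA -expr2 cA /t; field.
  by rewrite !gt_eqF.
rewrite c2 s2; apply: complex_eqP; rewrite !cE -/x -/y; field; by rewrite gt_eqF.
Qed.

Lemma cpowE u a : u != 0 -> cpow u a = cexp (creal a * clog u).
Proof.
move=> u0; rewrite /cpow /powR cabs_eq0 (negbTE u0) /cexp /clog /mkC !cE.
by rewrite !mul0r subr0 addr0.
Qed.

Lemma cabs_cpow u a : cabs (cpow u a) = cabs u `^ a.
Proof.
rewrite /cpow cabsM cabs_creal ger0_norm ?powR_ge0// [cabs (_ +i* _)%C]/cabs !cE.
by rewrite cos2Dsin2 sqrtr1 mulr1.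
Qed.

Lemma cpow_neq0 u a : u != 0 -> cpow u a != 0.
Proof. by move=> u0; rewrite -cabs_gt0 cabs_cpow powR_gt0// cabs_gt0. Qed.

Lemma cpow0 a : a != 0 -> cpow (0 : C) a = 0.
Proof. by move=> a0; apply/eqP; rewrite -cabs_eq0 cabs_cpow cabs0 powR0. Qed.

Lemma carg_creal r : 0 < r -> carg (creal r) = 0.
Proof. by move=> r0; rewrite /carg !cE mul0r atan0 mulr0. Qed.

Lemma cpow1 a : cpow (1 : C) a = 1.
Proof.
rewrite -creal1 /cpow carg_creal// cabs_creal normr1 powR1 mulr0 cos0 sin0.
by apply: complex_eqP; rewrite !cE; ring.
Qed.

Lemma cpowD u a b : u != 0 -> cpow u (a + b) = cpow u a * cpow u b.
Proof. by move=> u0; rewrite !cpowE// -cexpD crealD mulrDl. Qed.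

Lemma cpow_1 u : 0 < cre u -> cpow u 1 = u.
Proof. by move=> u0; rewrite cpowE ?cre_gt0_neq0// creal1 mul1r cexp_clog. Qed.

Lemma cargZ r u : 0 < r -> carg (creal r * u) = carg u.
Proof.
move=> r0; rewrite /carg cabsM cabs_creal (gtr0_norm r0) !cE !mul0r addr0 subr0 -mulrDr invfM.
by congr (_ * atan _); rewrite mulrACA divff ?gt_eqF// mul1r.
Qed.

Lemma carg_conj u : carg (cconj u) = - carg u.
Proof. by rewrite /carg cabs_conj !cE mulNr atanN mulrN. Qed.

Lemma cpowZ r u a : 0 < r -> cpow (creal r * u) a = creal (r `^ a) * cpow u a.
Proof.
move=> r0; rewrite /cpow cargZ// cabsM cabs_creal gtr0_norm// powRM ?cabs_ge0 ?ltW//.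
by rewrite crealM mulrA.
Qed.

Lemma cpow_conj u a : cpow (cconj u) a = cconj (cpow u a).
Proof.
rewrite /cpow carg_conj cabs_conj mulrN cosN sinN cconjM cconj_creal.
by congr (_ * _); apply: complex_eqP; rewrite !cE.
Qed.

(** [u^-1] is a positive multiple of [cconj u], so the claim reduces to [cpowZ] and [cpow_conj]. *)
Lemma cpowV u a : u != 0 -> cpow u^-1 a = (cpow u a)^-1.
Proof.
move=> u0; have r0 : 0 < cabs u by rewrite cabs_gt0.
have E : u^-1 = creal (cabs u ^+ 2)^-1 * cconj u.
  apply: (@mulfI _ u) => //; rewrite mulfV// mulrCA mulCconj -crealM mulVf ?creal1//.
  by rewrite expf_neq0// gt_eqF.
rewrite E cpowZ ?invr_gt0 ?exprn_gt0// cpow_conj.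
apply: (@mulfI _ (cpow u a)); first exact: cpow_neq0.
rewrite mulfV ?cpow_neq0// mulrCA mulCconj -crealM cabs_cpow -powR_inv1 ?sqr_ge0//.
rewrite -[cabs u ^+ 2]powR_mulrn ?cabs_ge0// -!powRrM -[_ ^+ 2 in X in creal (_ * X)]powR_mulrn ?powR_ge0// -powRrM.
rewrite -powRD; last by apply/implyP => _; rewrite gt_eqF.
by rewrite (_ : _ + _ = 0) ?powRr0//; ring.
Qed.

Lemma ccont_clog u : 0 < cre u -> ccont clog u.
Proof.
move=> u0; have r0 : 0 < cabs u by rewrite cabs_gt0 cre_gt0_neq0.
have cu := @ccont_id R u.
apply: ccont_mk.
  apply: (@rcont_compR R C (@cabs R) (@ln R)); first exact: rcont_cabs.
  exact: continuous_ln.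
apply: rcontM; first exact: rcont_cst.
apply: (@rcont_compR R C (fun u => cim u / (cabs u + cre u)) (@atan R)); last exact: continuous_atan.
apply: rcontM; first exact: rcont_im.
apply: rcontV; first by rewrite gt_eqF// addr_gt0.
by apply: rcontD; [exact: rcont_cabs|exact: rcont_re].
Qed.

Lemma near_cre_gt0 u : 0 < cre u -> \forall v \near u, 0 < cre v.
Proof.
move=> u0; apply/nbhsCP; exists (cre u) => // v vu.
have := le_lt_trans (cre_le (v - u)) vu; rewrite creB ltr_norml => /andP[]; lra.
Qed.

(** The slope of an inverse function is the reciprocal of the slope of [cexp], evaluated at
    [clog v]; continuity of [clog] makes the reciprocal continuous at [u]. *)
Lemma cder_clog u : 0 < cre u -> cder clog u u^-1.
Proof.
move=> u0; have [phi [cphi phid fE]] := cder_cexp (clog u).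
rewrite cexp_clog// in phid fE.
have cpc : ccont (fun v => phi (clog v)) u by exact: ccont_compC (ccont_clog u0) cphi.
apply: (@cder_phi _ _ _ _ (fun v => (phi (clog v))^-1)).
- by apply: ccontV => //; rewrite phid cre_gt0_neq0.
- by rewrite phid.
have H1 := near_cre_gt0 u0.
have H2 : \forall v \near u, phi (clog v) != 0.
  have := proj1 (ccont_epsP _ _) cpc (cabs u) => /(_ _)[]; first by rewrite cabs_gt0 cre_gt0_neq0.
  move=> r r0 hr; apply/nbhsCP; exists r => // v /hr; apply: contraTneq => ->.
  by rewrite sub0r cabsN phid ltxx.
apply: filterS2 H1 H2 => v v0 pv0; apply: (@addIr _ (- clog u)); rewrite (addrC (clog u)) addrK.
apply: (@mulfI _ (phi (clog v))) => //; rewrite mulVKf//.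
have E := fE (clog v); rewrite cexp_clog// in E.
by rewrite [in RHS]E addrAC subrr add0r.
Qed.

Lemma cder_cpow u a : 0 < cre u -> cder (fun v => cpow v a) u (creal a * cpow u (a - 1)).
Proof.
move=> u0; have un0 := cre_gt0_neq0 u0.
have H : cder (fun v => cexp (creal a * clog v)) u (cexp (creal a * clog u) * (creal a * u^-1)).
  by apply: (@cder_comp R (fun v => creal a * clog v)); [apply: cderZ; exact: cder_clog|exact: cder_cexp].
have -> : creal a * cpow u (a - 1) = cexp (creal a * clog u) * (creal a * u^-1).
  have -> : cpow u (a - 1) = cpow u a / u.
    apply: (mulIf un0); rewrite (divfK un0) -[X in _ * X](cpow_1 u0) -(cpowD _ _ un0).
    by rewrite subrK.
  by rewrite -(cpowE _ un0); ring.
apply: cder_near H; have := near_cre_gt0 u0; apply: filterS => v v0.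
by rewrite cpowE// cre_gt0_neq0.
Qed.

Lemma ccont_cpow u a : 0 < cre u -> ccont (fun v => cpow v a) u.
Proof. by move=> u0; exact: cder_cont (cder_cpow a u0). Qed.

(** Used on the unit circle, where [lam] vanishes. Only the modulus matters at 0, so the cut of the
    argument does no harm. *)
Lemma ccont_cpow0 a : 0 < a -> ccont (fun v => cpow v a) 0.
Proof.
move=> a0; apply/ccont_epsP => e e0; exists (e `^ a^-1); first exact: powR_gt0.
move=> w; rewrite subr0 cpow0 ?gt_eqF// subr0 cabs_cpow => h.
rewrite -[e]powRr1 ?ltW// -(mulVf (lt0r_neq0 a0)) powRrM.
by apply: gt0_ltr_powR => //; rewrite nnegrE ?powR_ge0 ?cabs_ge0.
Qed.

End ComplexPowers.

(** * Bergman kernels and diagonal maps *)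

Section Kernels.
Variables (R : realType) (N : nat).
Local Notation C := (Cx R).
Implicit Types (v p q : 'rV[C]_N) (D : set 'rV[C]_N) (K : 'rV[C]_N -> 'rV[C]_N -> C) (f h : 'rV[C]_N -> C).

Lemma real_intN (u : 'rV[C]_N -> R) : real_int (fun v => - u v) = - real_int u.
Proof. by rewrite /real_int opprB; under [X in fine (vol_int X) - _]eq_fun do rewrite ?opprK; under [X in _ - fine (vol_int X)]eq_fun do rewrite opprK. Qed.

Lemma cint_conj D h : cint D (fun z => cconj (h z)) = cconj (cint D h).
Proof.
apply: complex_eqP; rewrite /cint !cE //.
by rewrite -real_intN; congr real_int; apply: funext => v; rewrite cim_conj mulrN.
Qed.

Lemma kernel_herm D K p q : is_bergman_kernel D K -> D p -> D q -> K p q = cconj (K q p).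
Proof.
move=> [hA hK] Dp Dq; rewrite (hK _ (hA q Dq) p Dp) (hK _ (hA p Dp) q Dq) -cint_conj.
by congr cint; apply: funext => z; rewrite cconjM cconjK mulrC.
Qed.

(** Pairing the two kernels with each other in both orders gives conjugate integrals. This
    identifies kernels obtained by different constructions on the same domain. *)
Lemma kernel_unique D K K' p q : is_bergman_kernel D K -> is_bergman_kernel D K' ->
  D p -> D q -> K p q = K' p q.
Proof.
move=> hK hK' Dp Dq; rewrite (kernel_herm hK' Dp Dq).
rewrite (hK'.2 _ (hK.1 q Dq) p Dp) (hK.2 _ (hK'.1 p Dp) q Dq) -cint_conj.
by congr cint; apply: funext => z; rewrite cconjM cconjK mulrC.
Qed.

Lemma kernel_open D K p : is_bergman_kernel D K -> D p -> open D.
Proof. by move=> [h _] /h[[]]. Qed.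

Lemma kernel_holo D K q : is_bergman_kernel D K -> D q -> holomorphic_on D (fun z => K z q).
Proof. by move=> [h _] /h[]. Qed.

Lemma lscge0_sqr D f : holomorphic_on D f -> lscge0 (fun v => (\1_D v * cabs (f v) ^+ 2)%:E).
Proof.
move=> hf; apply: lscge0_indic => [|v Dv|v]; [exact: hf.1| |exact: sqr_ge0].
by apply: rcontX; apply: rcont_cabs; exact: holo_cont hf Dv.
Qed.

Lemma indic_scl D D' (c : 'I_N -> C) v : (forall v, D v <-> D' (scl c v)) -> \1_D v = \1_D' (scl c v) :> R.
Proof.
move=> DD'; rewrite !indicE (_ : (v \in D) = (scl c v \in D'))//.
by apply/idP/idP; rewrite !inE => /DD'.
Qed.

Lemma open_scl D D' (c : 'I_N -> C) : (forall v, D v <-> D' (scl c v)) -> open D' -> open D.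
Proof.
move=> DD' oD'; have -> : D = scl c @^-1` D' by apply/seteqP; split=> v /DD'.
by apply: open_comp oD' => v _; exact: scl_continuous.
Qed.

Definition scl_jac (c : 'I_N -> C) : R := \prod_j cabs (c j) ^+ 2.

Lemma scl_jac_gt0 (c : 'I_N -> C) : (forall j, c j != 0) -> 0 < scl_jac c.
Proof. by move=> c0; apply: prodr_gt0 => j _; rewrite exprn_gt0// cabs_gt0. Qed.

Lemma A2_scl D D' (c : 'I_N -> C) (k : C) f : (forall j, c j != 0) -> (forall v, D v <-> D' (scl c v)) ->
  A2 D' f -> A2 D (fun v => k * f (scl c v)).
Proof.
move=> c0 DD' [hf sf]; have oD := open_scl DD' hf.1.
have hfc : holomorphic_on D (fun v => f (scl c v)).
  apply/holoP; split=> // v /DD' Dv; apply: (holo_at_comp hf Dv) => j.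
  have -> : (fun w : 'rV[C]_N => scl c w 0 j) = (fun w => c j * w 0 j) by apply: funext => w; rewrite sclE.
  by apply: holo_atM; [exact: holo_at_cst|exact: holo_at_coord].
split.
  apply/holoP; split=> // v Dv; apply: holo_atM; first exact: holo_at_cst.
  by move/holoP : hfc => [_]; apply.
have J0 := scl_jac_gt0 c0.
have gf := lscge0_sqr hf; have gfc := lscge0_sqr hfc.
have := vol_int_scl c0 gf; rewrite -/(scl_jac c) => E.
rewrite /square_integrable (_ : (fun v => _) = (fun v => ((cabs k ^+ 2 / scl_jac c)%:E *
    ((scl_jac c)%:E * (\1_D' (scl c v) * cabs (f (scl c v)) ^+ 2)%:E))%E)); last first.
  apply: funext => v; rewrite -!EFinM (indic_scl v DD') cabsM exprMn; congr EFin.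
  by field; rewrite gt_eqF.
rewrite vol_intZ; last 2 first.
- apply: lscge0Z; first exact: ltW.
  by move: gfc; congr lscge0; apply: funext => v; rewrite (indic_scl v DD').
- by rewrite divr_ge0 ?sqr_ge0// ltW.
rewrite E; apply: lte_mul_pinfty => //; first by rewrite lee_fin divr_ge0 ?sqr_ge0// ltW.
Qed.

Lemma cint_scl D D' (c : 'I_N -> C) h : (forall j, c j != 0) -> (forall v, D v <-> D' (scl c v)) ->
  open D' -> (forall v, D' v -> ccont h v) ->
  cint D' h = cint D (fun v => creal (scl_jac c) * h (scl c v)).
Proof.
move=> c0 DD' oD' ch; have J0 := scl_jac_gt0 c0.
have H (u : 'rV[C]_N -> R) : (forall v, D' v -> rcont u v) ->
    real_int (fun v => \1_D' v * u v) = real_int (fun v => \1_D v * (scl_jac c * u (scl c v))).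
  move=> cu.
  have P (g : 'rV[C]_N -> R) : (forall v, D' v -> rcont g v) ->
      vol_int (fun v => (Num.max (\1_D' v * g v) 0)%:E) =
      vol_int (fun v => (Num.max (\1_D v * (scl_jac c * g (scl c v))) 0)%:E).
    move=> cu'; rewrite -(vol_int_scl c0 (lscge0_pos oD' cu')) -/(scl_jac c).
    congr vol_int; apply: funext => v; rewrite -EFinM (indic_scl v DD') maxr_pMr ?ltW// mulr0.
    by rewrite mulrCA.
  rewrite /real_int P//; congr (_ - fine _).
  under eq_fun do rewrite -mulrN.
  rewrite (P (fun v => - u v)); last by move=> v /cu; exact: rcontN.
  by congr vol_int; apply: funext => v; rewrite !mulrN.
rewrite /cint; congr Complex.
  rewrite (H (fun v => cre (h v))); last by move=> v /ch; exact: rcont_re.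
  by congr real_int; apply: funext => v; rewrite creM cre_creal cim_creal mul0r subr0.
rewrite (H (fun v => cim (h v))); last by move=> v /ch; exact: rcont_im.
by congr real_int; apply: funext => v; rewrite cimM cre_creal cim_creal mul0r addr0.
Qed.

(** The transformation law of the Bergman kernel under a linear isomorphism; [scl_jac c] is
    [|det|^2], the real Jacobian of the substitution. *)
Lemma kernel_scl D D' (c : 'I_N -> C) K : (forall j, c j != 0) -> (forall v, D v <-> D' (scl c v)) ->
  is_bergman_kernel D' K ->
  is_bergman_kernel D (fun z p => creal (scl_jac c) * K (scl c z) (scl c p)).
Proof.
move=> c0 DD' hK; split=> [p /DD' Dp|f Af p Dp]; first exact: A2_scl (hK.1 _ Dp).
have D'p := proj1 (DD' p) Dp.
pose ci j := (c j)^-1.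
have ciK v : scl ci (scl c v) = v.
  by rewrite scl_scl (@eq_scl _ _ _ (fun=> 1)) ?scl1// => j; rewrite /ci mulVf.
have cK v : scl c (scl ci v) = v.
  by rewrite scl_scl (@eq_scl _ _ _ (fun=> 1)) ?scl1// => j; rewrite /ci mulfV.
have D'D v : D' v <-> D (scl ci v) by rewrite DD' cK.
have ci0 j : ci j != 0 by rewrite invr_eq0.
have Af' := A2_scl 1 ci0 D'D Af.
have := hK.2 _ Af' _ D'p; rewrite /= mul1r ciK => ->.
rewrite (cint_scl c0 DD').
- congr cint; apply: funext => v; rewrite mul1r ciK cconjM cconj_creal; ring.
- exact: Af'.1.1.
- move=> v D'v; apply: ccontM; first exact: holo_cont Af'.1 D'v.
  by apply: ccont_conj; exact: holo_cont (kernel_holo hK D'p) D'v.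
Qed.

(** [J] marks the coordinates that may be contracted. One notion serves the slices, where these are
    the first [n], and [U], where [w] is added. *)
Definition star_on (J : pred 'I_N) D := forall v (c : 'I_N -> C), D v ->
  (forall j, cabs (c j) <= 1) -> (forall j, ~~ J j -> c j = 1) -> D (scl c v).

Definition one_at (i : 'I_N) (l : C) (j : 'I_N) : C := if j == i then l else 1.

Lemma one_at_conj i l j : cconj (one_at i l j) = one_at i (cconj l) j.
Proof. by rewrite /one_at; case: eqP; rewrite ?cconj1. Qed.

Lemma star_one_at (J : pred 'I_N) D i l v : star_on J D -> J i -> cabs l <= 1 -> D v -> D (scl (one_at i l) v).
Proof.
move=> sD Ji l1 Dv; apply: sD => // j; rewrite /one_at; case: eqP => [ji|_]; rewrite ?cabs1//.
by rewrite ji Ji.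
Qed.

(* For [|l| = 1] this is the invariance of the kernel under a rotation of [D]; the difference of the
   two sides is holomorphic in [l] and therefore vanishes on the whole disc. *)
Lemma kernel_one_at (J : pred 'I_N) D K i l p q : star_on J D -> is_bergman_kernel D K -> J i ->
  cabs l <= 1 -> D p -> D q ->
  K (scl (one_at i l) p) q = K p (scl (one_at i (cconj l)) q).
Proof.
move=> sD hK Ji l1 Dp Dq; apply/eqP; rewrite -subr_eq0; apply/eqP.
pose F l := K (scl (one_at i l) p) q - K p (scl (one_at i (cconj l)) q).
have lmod (z : C) : cabs z <= 1 -> cabs (cconj z) <= 1 by rewrite cabs_conj.
have chain (a b : 'rV[C]_N) (z : C) : D a -> D b -> cabs z <= 1 ->
    exists d, cder (fun l => K (scl (one_at i l) a) b) z d.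
  move=> Da Db z1; eexists.
  apply: (@holo_chain R N D (fun z => K z b) (fun l => scl (one_at i l) a) z (fun j => if j == i then a 0 j else 0)).
  - exact: kernel_holo hK Db.
  - exact: star_one_at sD Ji z1 Da.
  move=> j; have -> : (fun l => scl (one_at i l) a 0 j) = (fun l => if j == i then l * a 0 j else a 0 j).
    by apply: funext => t; rewrite sclE /one_at; case: eqP; rewrite ?mul1r.
  case: (j == i); last exact: cder_cst.
  by have := cderM (@cder_id R z) (@cder_cst R (a 0 j) z); rewrite mul1r mulr0 addr0.
apply: (@eq0_on_disc R F) => [z z1|z z1|]; last exact: l1.
  have [d1 h1] := chain p q z Dp Dq z1.
  (* By hermitian symmetry the second term of [F] is the conjugate of a function holomorphic in
     [cconj l], hence holomorphic in [l]. *)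
  have [d2 h2] := chain q p (cconj z) Dq Dp (lmod z z1).
  have := cder_conj h2; rewrite cconjK => h3.
  exists (d1 - cconj d2); apply: cderB h1 _; apply: cder_near h3.
  have oD := kernel_open hK Dp.
  have cs : (fun w : C => scl (one_at i (cconj w)) q) @ z --> scl (one_at i (cconj z)) q.
    apply: (@ccont_rVP R N C (fun w : C => scl (one_at i (cconj w)) q) z) => j.
    apply: (@eq_ccont _ _ _ (fun w : C => one_at i (cconj w) j * q 0 j)); first by move=> w; exact: sclE.
    apply: ccontM; last exact: ccont_cst.
    rewrite /one_at; case: (j == i); last exact: ccont_cst.
    by apply: ccont_conj; exact: ccont_id.
  have nD : nbhs z [set w | D (scl (one_at i (cconj w)) q)].
    apply: cs; apply: open_nbhs_nbhs; split => //.
    exact: star_one_at sD Ji (lmod z z1) Dq.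
  apply: (@filterS _ (nbhs z) _ _ _ _ nD) => w Dw.
  by rewrite (kernel_herm hK Dp Dw).
have z0 : z != 0 by rewrite -cabs_gt0 z1.
have c0 j : one_at i z j != 0 by rewrite /one_at; case: (j == i); [exact: z0|exact: oner_neq0].
have conjz : cconj z * z = 1 by rewrite mulrC mulCconj z1 expr1n creal1.
have back v : scl (one_at i (cconj z)) (scl (one_at i z) v) = v.
  rewrite scl_scl (@eq_scl _ _ _ (fun=> 1)) ?scl1// => j; rewrite /one_at.
  by case: eqP => // _; rewrite mulr1.
have forth v : scl (one_at i z) (scl (one_at i (cconj z)) v) = v.
  rewrite scl_scl (@eq_scl _ _ _ (fun=> 1)) ?scl1// => j; rewrite /one_at.
  by case: eqP => // _; rewrite ?mulr1// mulrC.
have DD v : D v <-> D (scl (one_at i z) v).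
  split=> [Dv|/(star_one_at sD Ji (lmod z ltac:(by rewrite z1)))]; last by rewrite back.
  by apply: star_one_at sD Ji _ Dv; rewrite z1.
have J1 : scl_jac (one_at i z) = 1.
  by apply: big1 => j _; rewrite /one_at; case: eqP => _; rewrite ?z1 ?cabs1 expr1n.
have Dq' : D (scl (one_at i (cconj z)) q) by apply: star_one_at sD Ji _ Dq; rewrite cabs_conj z1.
have := kernel_unique (kernel_scl c0 DD hK) hK Dp Dq'; rewrite J1 creal1 mul1r forth => E.
by rewrite /F E subrr.
Qed.

Lemma kernel_contract (J : pred 'I_N) D K (c : 'I_N -> C) p q : star_on J D -> is_bergman_kernel D K ->
  (forall j, cabs (c j) <= 1) -> (forall j, ~~ J j -> c j = 1) -> D p -> D q ->
  K (scl c p) q = K p (scl (fun j => cconj (c j)) q).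
Proof.
move=> sD hK c1 cJ Dp Dq.
pose cs (s : seq 'I_N) j : C := if j \in s then c j else 1.
have cs1 s j : cabs (cs s j) <= 1 by rewrite /cs; case: (j \in s); [exact: c1|rewrite cabs1].
have csJ s j : ~~ J j -> cs s j = 1 by move=> /cJ Jj; rewrite /cs; case: (j \in s).
(* The second argument is kept general because each induction step moves one factor over to it. *)
have H s q' : uniq s -> D q' -> K (scl (cs s) p) q' = K p (scl (fun j => cconj (cs s j)) q').
  elim: s q' => [|i s IH] q' /=.
    move=> _ _; rewrite (@eq_scl _ _ _ (fun=> 1)) ?scl1// (@eq_scl _ _ (fun j => cconj _) (fun=> 1)) ?scl1// => j.
    by rewrite /cs cconj1.
  move=> /andP[is_ us] Dq'.
  have E : cs (i :: s) =1 (fun j => one_at i (c i) j * cs s j).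
    by move=> j; rewrite /cs /one_at inE; have [->|_] := eqVneq j i; rewrite ?(negbTE is_) ?mulr1 ?mul1r.
  rewrite (eq_scl _ E) -scl_scl (@eq_scl _ _ (fun j => cconj (cs (i :: s) j)) (fun j => cconj (cs s j) * one_at i (cconj (c i)) j)); last first.
    by move=> j; rewrite E cconjM one_at_conj mulrC.
  rewrite -scl_scl.
  have Dps : D (scl (cs s) p) by apply: (sD p _ Dp); [exact: cs1|exact: csJ].
  have Dqi : D (scl (one_at i (cconj (c i))) q').
    apply: (sD q' _ Dq') => [j|j Jj]; rewrite /one_at; case: eqP => [ji|_]; rewrite ?cabs1 ?cabs_conj//.
    by rewrite -ji (cJ j Jj) cconj1.
  rewrite -(IH _ us Dqi).
  have [Ji|/negbTE Ji] := boolP (J i); first exact: (kernel_one_at sD hK Ji (c1 i) Dps Dq').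
  have ci1 : c i = 1 by apply: cJ; rewrite Ji.
  have one1 v : scl (one_at i 1) v = v.
    by rewrite (@eq_scl _ _ _ (fun=> 1)) ?scl1// => j; rewrite /one_at; case: eqP.
  by rewrite ci1 cconj1 !one1.
have := H (enum 'I_N) q (enum_uniq _) Dq.
rewrite (@eq_scl _ _ (cs _) c); last by move=> j; rewrite /cs mem_enum.
by rewrite (@eq_scl _ _ (fun j => cconj (cs _ j)) (fun j => cconj (c j))) // => j; rewrite /cs mem_enum.
Qed.

End Kernels.

(** * Integration over the unit disc *)

Section DiscIntegral.
Variable R : realType.
Local Notation C := (Cx R).
Local Notation mu := (@lebesgue_measure R).
Local Notation mu2 := (mu \x mu)%E.
Local Notation T2 := (measurableTypeR R * measurableTypeR R)%type.
Implicit Types (g h : C -> C) (w : C).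

Definition disc : set (R * R) := [set p | cabs (mkC p.1 p.2) < 1].

Lemma ccont_mkC (p : R * R) : ccont (fun p : R * R => mkC p.1 p.2) p.
Proof. by apply: ccont_mk; [exact: cvg_fst|exact: cvg_snd]. Qed.

Lemma open_disc : open disc.
Proof.
have -> : disc = (fun p : R * R => cabs (mkC p.1 p.2)) @^-1` [set x | x < 1] by [].
apply: open_comp; last exact: open_lt.
move=> p _; have : rcont (fun p : R * R => cabs (mkC p.1 p.2)) p by apply: rcont_cabs; exact: ccont_mkC.
  by [].
Qed.

Lemma measurable_disc : measurable (disc : set T2).
Proof. apply: open_measurable_prod; exact: open_disc. Qed.

Let sq : set T2 := `[-1, 1] `*` `[-1, 1].

Lemma disc_sq : disc `<=` sq.
Proof.
move=> [x y] h; have {}h : cabs (mkC x y) < 1 := h.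
have := le_lt_trans (cre_le (mkC x y)) h; have := le_lt_trans (cim_le (mkC x y)) h.
rewrite /mkC !cE !ltr_norml => /andP[? ?] /andP[? ?].
split => /=; rewrite in_itv /=; apply/andP; split; lra.
Qed.

Lemma mu2_sq : mu2 sq = 4%:E.
Proof.
rewrite product_measure1E; [|exact: measurable_itv|exact: measurable_itv].
have E : @lebesgue_measure R [set` `[-1, 1]] = 2%:E.
  by rewrite lebesgue_measure_itv /= lte_fin ifT -?EFinB; [congr EFin; ring|lra].
transitivity ((2%:E : \bar R) * 2%:E)%E; first by congr (_ * _)%E; exact: E.
by rewrite -EFinM; congr EFin; ring.
Qed.

Lemma mu2_disc : (mu2 disc < +oo)%E.
Proof.
apply: (@le_lt_trans _ _ (mu2 sq)); last by rewrite mu2_sq ltry.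
by apply: le_measure; rewrite ?inE; [exact: measurable_disc|apply: measurableX; exact: measurable_itv|exact: disc_sq].
Qed.

(* Radial retraction onto the closed disc, used to extend functions on it continuously. *)
Definition ret w : C := w / creal (Num.max 1 (cabs w)).

Lemma max1_gt0 (x : R) : 0 < Num.max 1 x. Proof. by rewrite lt_max ltr01. Qed.

Lemma cabs_ret w : cabs (ret w) <= 1.
Proof.
rewrite /ret cabsM cabsV cabs_creal (gtr0_norm (max1_gt0 _)) ler_pdivrMr ?max1_gt0// mul1r.
by rewrite le_max lexx orbT.
Qed.

Lemma ret_id w : cabs w <= 1 -> ret w = w.
Proof. by move=> w1; rewrite /ret max_l// creal1 divr1. Qed.

Lemma ccont_ret w : ccont ret w.
Proof.
apply: ccontM; first exact: ccont_id.
apply: ccontV; first by rewrite creal_eq0 gt_eqF// max1_gt0.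
apply: ccont_creal; rewrite /rcont; apply: (@continuous_max _ _ (fun=> 1) (@cabs R)).
  exact (@rcont_cst R C 1 w).
by apply: rcont_cabs; exact: ccont_id.
Qed.

Lemma disc_bounded g : (forall w, cabs w <= 1 -> ccont g w) ->
  exists2 M : R, 0 < M & forall w, cabs w <= 1 -> cabs (g w) <= M.
Proof.
move=> cg.
pose u (p : R * R) := cabs (g (ret (mkC p.1 p.2))).
have cu : continuous u.
  move=> p; suff : rcont u p by [].
  apply: rcont_cabs; apply: (@ccont_compC R _ (fun p : R * R => ret (mkC p.1 p.2)) g); last exact: cg (cabs_ret _).
  by apply: (@ccont_compC R _ (fun p : R * R => mkC p.1 p.2) ret); [exact: ccont_mkC|exact: ccont_ret].
have cK : compact (`[(-1 : R), 1]%classic `*` `[(-1 : R), 1]%classic).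
  by apply: compact_setX; exact: segment_compact.
have := continuous_compact (continuous_subspaceT cu) cK => /compact_bounded[M [_ hM]].
exists (`|M| + 1) => [|w w1]; first by rewrite ltr_wpDl.
rewrite -[leLHS]ger0_norm ?cabs_ge0//; apply: (hM (`|M| + 1)); first by rewrite ltr_pwDr// ler_norm.
exists (cre w, cim w); last by rewrite /u /= mkC_eta ret_id.
have := le_trans (cre_le w) w1; have := le_trans (cim_le w) w1; rewrite !ler_norml => h1 h2.
by split => /=; rewrite in_itv.
Qed.

Lemma disc_integrable (u : C -> R) : (forall w, cabs w <= 1 -> rcont u w) ->
  mu2.-integrable disc (EFin \o (fun p => u (mkC p.1 p.2))).
Proof.
move=> cu; pose g w := creal (u w).
have cg w : cabs w <= 1 -> ccont g w by move=> /cu; exact: ccont_creal.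
have [M M0 hM] := disc_bounded cg.
have cv : continuous (fun p : R * R => u (ret (mkC p.1 p.2))).
  move=> p; apply: (@rcont_comp R _ _ (fun p : R * R => ret (mkC p.1 p.2)) u); last exact: cu (cabs_ret _).
  by apply: (@ccont_compC R _ (fun p : R * R => mkC p.1 p.2) ret); [exact: ccont_mkC|exact: ccont_ret].
apply: measurable_bounded_integrable; [exact: measurable_disc|exact: mu2_disc| |].
  apply: (@eq_measurable_fun _ _ _ _ _ (fun p : R * R => u (ret (mkC p.1 p.2)))).
    by move=> p; rewrite inE => /ltW /ret_id ->.
  by apply: measurable_funS (continuous_measurable_prod cv).
exists M; split; first exact: num_real.
move=> x Mx p /= /ltW /hM; rewrite /g cabs_creal => h.
by apply: le_trans h _; exact: ltW.
Qed.

Definition dint g : C :=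
  mkC (Rintegral mu2 disc (fun p => cre (g (mkC p.1 p.2)))) (Rintegral mu2 disc (fun p => cim (g (mkC p.1 p.2)))).

Lemma eq_dint g h : (forall w, cabs w < 1 -> g w = h w) -> dint g = dint h.
Proof.
by move=> gh; rewrite /dint; congr mkC; apply: eq_Rintegral => p; rewrite inE => /gh ->.
Qed.

Lemma dint_conj g : (forall w, cabs w <= 1 -> ccont g w) -> dint (fun w => cconj (g w)) = cconj (dint g).
Proof.
move=> cg; apply: complex_eqP; rewrite /dint /mkC !cE //.
have := RintegralZl (-1) measurable_disc (@disc_integrable (fun w => cim (g w)) (fun w hw => rcont_im (cg w hw))).
rewrite mulN1r => <-; apply: eq_Rintegral => p _; by rewrite cim_conj mulN1r.
Qed.

Lemma dintD g h : (forall w, cabs w <= 1 -> ccont g w) -> (forall w, cabs w <= 1 -> ccont h w) ->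
  dint (fun w => g w + h w) = dint g + dint h.
Proof.
move=> cg ch; apply: complex_eqP; rewrite /dint /mkC !cE.
  have := RintegralD measurable_disc (@disc_integrable (fun w => cre (g w)) (fun w hw => rcont_re (cg w hw))) (@disc_integrable (fun w => cre (h w)) (fun w hw => rcont_re (ch w hw))).
  by move=> <-; apply: eq_Rintegral => p _; rewrite creD.
have := RintegralD measurable_disc (@disc_integrable (fun w => cim (g w)) (fun w hw => rcont_im (cg w hw))) (@disc_integrable (fun w => cim (h w)) (fun w hw => rcont_im (ch w hw))).
by move=> <-; apply: eq_Rintegral => p _; rewrite cimD.
Qed.

Lemma dintZ (k : C) g : (forall w, cabs w <= 1 -> ccont g w) -> dint (fun w => k * g w) = k * dint g.
Proof.
move=> cg.
have ir := @disc_integrable (fun w => cre (g w)) (fun w hw => rcont_re (cg w hw)).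
have ii := @disc_integrable (fun w => cim (g w)) (fun w hw => rcont_im (cg w hw)).
have irZ r : mu2.-integrable disc (EFin \o (fun p => r * cre (g (mkC p.1 p.2)))).
  by apply: (@disc_integrable (fun w => r * cre (g w))) => w w1; apply: rcontM; [exact: rcont_cst|exact: rcont_re (cg w w1)].
have iiZ r : mu2.-integrable disc (EFin \o (fun p => r * cim (g (mkC p.1 p.2)))).
  by apply: (@disc_integrable (fun w => r * cim (g w))) => w w1; apply: rcontM; [exact: rcont_cst|exact: rcont_im (cg w w1)].
apply: complex_eqP; rewrite /dint /mkC !cE -!(RintegralZl _ measurable_disc)//.
  by rewrite -(RintegralB measurable_disc)//; apply: eq_Rintegral => p _; rewrite creM.
by rewrite -(RintegralD measurable_disc)//; apply: eq_Rintegral => p _; rewrite cimM.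
Qed.

End DiscIntegral.

Section SliceIntegral.
Variables (R : realType) (N : nat).
Local Notation C := (Cx R).
Local Notation mu := (@lebesgue_measure R).
Local Notation mu2 := (mu \x mu)%E.
Local Open Scope ereal_scope.

Lemma slice_integrable (k : 'rV[C]_(N + 1) -> \bar R) : lscge0 k -> vol_int k < +oo ->
  mu2.-integrable setT (fun p => slice_int k (mkC p.1 p.2)).
Proof.
move=> gk kfin; apply/integrableP; split.
  by apply: lsc_measurable_prod; exact: lsc_slice.
rewrite (_ : \int[_]_(x in _) _ = vol_int k)//.
rewrite vol_int_slice//; apply: eq_integral => p _.
by rewrite gee0_abs//; exact: slice_int_ge0.
Qed.

(** Fubini for the signed integral [real_int]. The majorant [k] makes both parts of [u] integrable,
    and the slice integrals need be known only over those [w] for which the slice of [k] is finite,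
    that is, almost all. *)
Lemma slice_real_int (U : set 'rV[C]_(N + 1)) (u : 'rV[C]_(N + 1) -> R) (k : 'rV[C]_(N + 1) -> \bar R) (rho : C -> R) :
  open U -> (forall v, U v -> rcont u v) -> (forall v w, U (app_last v w) -> (cabs w < 1)%R) ->
  lscge0 k -> vol_int k < +oo -> (forall v, (\1_U v * `|u v|)%R%:E <= k v) ->
  (forall w, (cabs w <= 1)%R -> rcont rho w) ->
  (forall w, (cabs w < 1)%R -> slice_int k w < +oo ->
     real_int (fun v => \1_U (app_last v w) * u (app_last v w))%R = rho w) ->
  real_int (fun v => \1_U v * u v)%R = Rintegral mu2 (@disc R) (fun p => rho (mkC p.1 p.2)).
Proof.
move=> oU cu Uw gk kfin uk crho hrho.
pose kp v := (Num.max (\1_U v * u v) 0)%R%:E; pose km v := (Num.max (- (\1_U v * u v)) 0)%R%:E.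
have gp : lscge0 kp by exact: lscge0_pos.
have gm : lscge0 km.
  have := lscge0_pos oU (fun v Uv => rcontN (cu v Uv)); congr lscge0; apply: funext => v.
  by rewrite /km mulrN.
have kpk v : kp v <= k v.
  apply: le_trans (uk v); rewrite /kp lee_fin ge_max; apply/andP; split.
    by rewrite ler_wpM2l ?ler_norm.
  by rewrite mulr_ge0.
have kmk v : km v <= k v.
  apply: le_trans (uk v); rewrite /km lee_fin ge_max -mulrN; apply/andP; split.
    by rewrite ler_wpM2l// -normrN ler_norm.
  by rewrite mulr_ge0.
have pfin : vol_int kp < +oo by apply: le_lt_trans kfin; exact: le_vol_int.
have mfin : vol_int km < +oo by apply: le_lt_trans kfin; exact: le_vol_int.
have ip := slice_integrable gp pfin; have im := slice_integrable gm mfin.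
have ik := slice_integrable gk kfin.
rewrite /real_int -/kp -/km.
have sfin k' w : lscge0 k' -> (forall v, k' v <= k v) -> slice_int k w < +oo -> slice_int k' w \is a fin_num.
  move=> gk' k'k kw; rewrite ge0_fin_numE ?slice_int_ge0//; apply: le_lt_trans kw.
  rewrite /slice_int /vol_int -!iter_int_lshift; exact: le_iter_int.
rewrite /Rintegral; apply: EFin_inj.
have f1 : vol_int kp \is a fin_num by rewrite ge0_fin_numE ?vol_int_ge0.
have f2 : vol_int km \is a fin_num by rewrite ge0_fin_numE ?vol_int_ge0.
have f3 := integrable_fin_num (@measurable_disc R) (disc_integrable crho).
rewrite EFinB (fineK f1) (fineK f2) (fineK f3).
rewrite (vol_int_slice gp) (vol_int_slice gm) -(integralB measurableT ip im).
rewrite [RHS]integral_mkcond.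
have mS k' : lscge0 k' -> measurable_fun (setT : set (measurableTypeR R * measurableTypeR R)) (fun p => slice_int k' (mkC p.1 p.2)).
  by move=> gk'; apply: lsc_measurable_prod; exact: lsc_slice.
apply: ae_eq_integral.
- exact: measurableT.
- by apply: emeasurable_funB; exact: mS.
- apply/(measurable_restrictT _ (@measurable_disc R)).
  exact: (measurable_int _ (disc_integrable crho)).
(* Almost every slice of [k] has finite integral; outside the disc the slices of [U] are empty and
   both sides are 0. *)
have := @integrable_ae _ _ R mu2 setT measurableT _ ik.
apply: filterS => p kfp _; have {}kfp := kfp Logic.I.
rewrite patchE; case: ifPn => [|]; rewrite ?inE ?notin_setE => Dp.
  have kfp' : slice_int k (mkC p.1 p.2) < +oo by rewrite -ge0_fin_numE// slice_int_ge0.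
  have fp := sfin kp _ gp kpk kfp'; have fm := sfin km _ gm kmk kfp'.
  rewrite /= -(fineK fp) -(fineK fm) -EFinB; congr EFin.
  by rewrite -(hrho _ Dp kfp').
have z v : \1_U (app_last v (mkC p.1 p.2)) = 0%R :> R.
  by rewrite indicE memNset// => /Uw.
have iter0 l : iter_int l (fun=> 0) = (fun=> 0 : \bar R) :> ('rV[C]_N -> _).
  elim: l => // i l IH; apply: funext => v /=; rewrite IH.
  by rewrite integral0_eq// => x _; rewrite integral0_eq.
rewrite /slice_int /kp /km; under eq_fun do rewrite z mul0r maxxx.
under [X in _ - vol_int X]eq_fun do rewrite z mul0r oppr0 maxxx.
by rewrite /vol_int iter0 subee.
Qed.

End SliceIntegral.

(** * Slices of the Hartogs domain *)

Section HartogsGeometry.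
Variables (R : realType) (n m : nat) (Omega : set 'rV[Cx R]_(n + m)) (alpha : 'I_n -> R).
Local Notation C := (Cx R).
Hypothesis starO : nstar_hartogs Omega.
Implicit Types (q : 'rV[C]_(n + m)) (w : C) (l : 'I_n -> C).

Local Notation U := (U_alpha alpha Omega).
Local Notation Us := (U_alpha_eta alpha Omega).

Definition cn l (j : 'I_(n + m)) : C := match fintype.split j with inl i => l i | inr _ => 1 end.

Lemma cnl l (i : 'I_n) : cn l (lshift m i) = l i.
Proof. by rewrite /cn (unsplitK (inl i : 'I_n + 'I_m)). Qed.
Lemma cnr l (i : 'I_m) : cn l (rshift n i) = 1.
Proof. by rewrite /cn (unsplitK (inr i : 'I_n + 'I_m)). Qed.

Lemma cnM l l' j : cn l j * cn l' j = cn (fun i => l i * l' i) j.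
Proof. rewrite /cn; by case: (fintype.split j) => [i|i]; rewrite ?mulr1. Qed.

Lemma scl_cnM l l' q : scl (cn l) (scl (cn l') q) = scl (cn (fun i => l i * l' i)) q.
Proof. by rewrite scl_scl; apply: eq_scl => j; exact: cnM. Qed.

Lemma eq_cn l l' : l =1 l' -> cn l =1 cn l'.
Proof. by move=> ll' j; rewrite /cn; case: (fintype.split j). Qed.

Lemma cn_neq0 l : (forall i, l i != 0) -> forall j, cn l j != 0.
Proof. by move=> l0 j; rewrite /cn; case: (fintype.split j) => // _; rewrite oner_neq0. Qed.

Lemma cn_conj l j : cconj (cn l j) = cn (fun i => cconj (l i)) j.
Proof. by rewrite /cn; case: (fintype.split j) => // _; rewrite cconj1. Qed.

Lemma scl_jac_cn l : scl_jac (cn l) = \prod_i cabs (l i) ^+ 2.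
Proof.
rewrite /scl_jac big_split_ord /= [X in _ * X]big1 ?mulr1.
  by apply: eq_bigr => i _; rewrite cnl.
by move=> i _; rewrite cnr cabs1 expr1n.
Qed.

Definition Jn (j : 'I_(n + m)) : bool := match fintype.split j with inl _ => true | inr _ => false end.

Lemma Jn_cn (c : 'I_(n + m) -> C) : (forall j, ~~ Jn j -> c j = 1) -> c =1 cn (fun i => c (lshift m i)).
Proof.
move=> h j; case: (split_ordP j) => i ->; first by rewrite cnl.
by rewrite cnr h// /Jn (unsplitK (inr i : 'I_n + 'I_m)).
Qed.

Lemma cn_Jn l j : ~~ Jn j -> cn l j = 1.
Proof. by rewrite /Jn /cn; case: (fintype.split j). Qed.

Lemma scl_cn_row l q : scl (cn l) q = row_mx (\row_i (l i * lsubmx q 0 i)) (rsubmx q).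
Proof.
apply/rowP => j; rewrite sclE; case: (split_ordP j) => i ->.
  by rewrite cnl row_mxEl !mxE.
by rewrite cnr row_mxEr !mxE mul1r.
Qed.

Lemma Omega_scl l q : (forall i, cabs (l i) <= 1) -> Omega q -> Omega (scl (cn l) q).
Proof.
move=> l1 Oq; have H := @starO (lsubmx q) (rsubmx q) (\row_i l i).
rewrite hsubmxK in H; have {}H := H Oq (fun j => ltac:(by rewrite mxE)).
move: H; rewrite scl_cn_row (_ : (\row_j ((\row_i l i) 0 j * lsubmx q 0 j)) = \row_i (l i * lsubmx q 0 i))//.
by apply/rowP => i; rewrite !mxE.
Qed.

(* The denominators of [f_alpha]. *)
Definition cr w (i : 'I_n) : R := (1 - cabs w ^+ 2) `^ (alpha i / 2).

Lemma disc_gt0 w : cabs w < 1 -> 0 < 1 - cabs w ^+ 2.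
Proof. by move=> w1; rewrite subr_gt0 expr_lt1 ?cabs_ge0. Qed.

Lemma cr_gt0 w i : cabs w < 1 -> 0 < cr w i.
Proof. by move=> /disc_gt0 w1; exact: powR_gt0. Qed.

Lemma wof_app q w : wof (app_last q w) = w.
Proof. by rewrite /wof /app_last row_mxKr mxE. Qed.
Lemma lsubmx_app q w : lsubmx (app_last q w) = q.
Proof. by rewrite /app_last row_mxKl. Qed.

Lemma U_app q w : U (app_last q w) <-> Omega (scl (cn (fun i => (creal (cr w i))^-1)) q) /\ cabs w < 1.
Proof.
rewrite /U_alpha wof_app /zof /z'of lsubmx_app scl_cn_row /f_alpha.
have -> : (\row_i ((creal (cr w i))^-1 * lsubmx q 0 i)) = (\row_j (lsubmx q 0 j / creal ((1 - cabs w ^+ 2) `^ (alpha j / 2)))).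
  by apply/rowP => i; rewrite !mxE mulrC.
by [].
Qed.

Lemma U_cabs q w : U (app_last q w) -> cabs w < 1.
Proof. by move=> /U_app[]. Qed.

Lemma UsE q w : Us w q = U (app_last q w). Proof. by []. Qed.

Lemma app_eta (p : 'rV[C]_(n + m + 1)) : app_last (lsubmx p) (wof p) = p.
Proof.
rewrite /app_last -[RHS]hsubmxK; congr row_mx; apply/rowP => i.
by rewrite (ord1 i) mxE /wof.
Qed.

(** After the normalisation by [f_alpha], the move from [w0] to [w] multiplies the [i]-th coordinate
    by [l i * cr w0 i / cr w i], of modulus at most 1, and the star-shape of [Omega] applies.
    Memberships in [U] and its slices below are derived from this lemma. *)
Lemma U_scale q0 w0 w l : U (app_last q0 w0) -> cabs w < 1 ->
  (forall i, cabs (l i) * cr w0 i <= cr w i) -> U (app_last (scl (cn l) q0) w).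
Proof.
move=> /U_app[Oq w01] w1 lw; apply/U_app; split => //.
have c0 i := cr_gt0 i w01; have c1 i := cr_gt0 i w1.
have -> : scl (cn (fun i => (creal (cr w i))^-1)) (scl (cn l) q0) =
    scl (cn (fun i => l i * creal (cr w0 i / cr w i))) (scl (cn (fun i => (creal (cr w0 i))^-1)) q0).
  transitivity (scl (cn (fun i => (creal (cr w i))^-1 * l i)) q0); first exact: scl_cnM.
  transitivity (scl (cn (fun i => l i * creal (cr w0 i / cr w i) * (creal (cr w0 i))^-1)) q0); last first.
    exact/esym/scl_cnM.
  apply: eq_scl; apply: eq_cn => i.
  rewrite -!crealV mulrC -mulrA -crealM; congr (_ * creal _).
  by rewrite mulrAC divff ?mul1r// gt_eqF.
apply: Omega_scl Oq => i; rewrite cabsM cabs_creal gtr0_norm ?divr_gt0//.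
by rewrite mulrA ler_pdivrMr// mul1r.
Qed.

Lemma star_Us w : star_on Jn (Us w).
Proof.
move=> v c; rewrite !UsE => Uv c1 cJ.
rewrite (eq_scl _ (Jn_cn cJ)); apply: (U_scale Uv (U_cabs Uv)) => i.
by rewrite ler_piMl// ltW// cr_gt0// (U_cabs Uv).
Qed.

Definition JU (j : 'I_(n + m + 1)) : bool := match fintype.split j with inl i => Jn i | inr _ => true end.

Definition cw (l : 'I_n -> C) (r : C) (j : 'I_(n + m + 1)) : C :=
  match fintype.split j with inl i => cn l i | inr _ => r end.

Lemma scl_app (c : 'I_(n + m + 1) -> C) q w :
  scl c (app_last q w) = app_last (scl (fun j => c (lshift 1 j)) q) (c (rshift (n + m) ord0) * w).
Proof.
apply/rowP => j; rewrite sclE; case: (split_ordP j) => i ->; first by rewrite !app_lastE sclE.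
by rewrite !app_last_last (ord1 i).
Qed.

Lemma scl_cw l r q w : scl (cw l r) (app_last q w) = app_last (scl (cn l) q) (r * w).
Proof.
rewrite scl_app /cw (unsplitK (inr ord0 : 'I_(n+m) + 'I_1)); congr app_last.
by apply: eq_scl => j; rewrite (unsplitK (inl j : 'I_(n+m) + 'I_1)).
Qed.

Lemma cw_JU l r j : ~~ JU j -> cw l r j = 1.
Proof. by rewrite /JU /cw; case: (fintype.split j) => // i; exact: cn_Jn. Qed.

Hypothesis alpha0 : forall i, 0 < alpha i.

Lemma cr_mono w w' i : cabs w <= cabs w' -> cabs w' < 1 -> cr w' i <= cr w i.
Proof.
move=> ww w1; have w'1 := le_lt_trans ww w1.
rewrite /cr; apply: ge0_ler_powR.
- by rewrite divr_ge0// ltW.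
- by rewrite nnegrE ltW// disc_gt0.
- by rewrite nnegrE ltW// disc_gt0.
- by rewrite lerD2l lerN2 ler_pXn2r// nnegrE cabs_ge0.
Qed.

Lemma star_U : star_on JU U.
Proof.
move=> p c; rewrite -(app_eta p) => Uv c1 cJ; rewrite scl_app.
have w1 := U_cabs Uv.
have cwle : cabs (c (rshift (n + m) ord0) * wof p) <= cabs (wof p).
  by rewrite cabsM ler_piMl ?cabs_ge0.
have cJ' j : ~~ Jn j -> c (lshift 1 j) = 1.
  by move=> Jj; apply: cJ; rewrite /JU (unsplitK (inl j : 'I_(n+m) + 'I_1)).
rewrite (eq_scl _ (Jn_cn cJ')); apply: (U_scale Uv (le_lt_trans cwle w1)) => i.
by apply: le_trans (cr_mono i cwle w1); rewrite ler_piMl// ltW// cr_gt0.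
Qed.

Lemma Us_scl w eta q : cabs w < 1 -> cabs eta < 1 ->
  Us w q <-> Us eta (scl (cn (fun i => creal (cr eta i / cr w i))) q).
Proof.
move=> w1 e1; rewrite !UsE; have c0 i := cr_gt0 i w1; have c1 i := cr_gt0 i e1.
split=> [Uq|].
  apply: (U_scale Uq e1) => i.
  by rewrite cabs_creal gtr0_norm ?divr_gt0// divfK// gt_eqF.
have E : q = scl (cn (fun i => creal (cr w i / cr eta i))) (scl (cn (fun i => creal (cr eta i / cr w i))) q).
  rewrite scl_cnM -[LHS]scl1; apply: eq_scl => j.
  rewrite -[1](_ : cn (fun=> 1) j = 1); last by rewrite /cn; case: (fintype.split j).
  apply: eq_cn => i; rewrite -crealM -creal1; congr creal; field; by rewrite !gt_eqF.
move=> Uq; rewrite E; apply: (U_scale Uq w1) => i.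
by rewrite cabs_creal gtr0_norm ?divr_gt0// divfK// gt_eqF.
Qed.

(** The map [cn kappa] is the isomorphism [s] of the slice over [w] onto the slice over [eta],
    followed by a contraction [t] of the latter. [kernel_contract] moves [t] to the second argument,
    [kernel_scl] replaces [Ke] by [Kw] at the cost of the Jacobian of [s], and [P] is the preimage
    under [s] of the point [q] moved by the conjugate of [t]. *)
Lemma slice_kernel w eta (Ke Kw : 'rV[C]_(n + m) -> 'rV[C]_(n + m) -> C) (kappa : 'I_n -> C) z q :
  cabs w < 1 -> cabs eta < 1 -> is_bergman_kernel (Us eta) Ke -> is_bergman_kernel (Us w) Kw ->
  (forall i, cabs (kappa i) * cr w i <= cr eta i) -> Us w z -> Us eta q ->
  let P := scl (cn (fun i => cconj (kappa i) * creal ((cr w i / cr eta i) ^+ 2))) q in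
  Us w P /\ Ke (scl (cn kappa) z) q = creal (\prod_i (cr w i / cr eta i) ^+ 2) * Kw z P.
Proof.
move=> w1 e1 hKe hKw kw Uz Uq P.
have c0 i := cr_gt0 i w1; have c1 i := cr_gt0 i e1.
pose s := cn (fun i => creal (cr eta i / cr w i)).
have s0 : forall j, s j != 0.
  by apply: cn_neq0 => i; rewrite creal_eq0 gt_eqF// divr_gt0.
have UU v := Us_scl v w1 e1.
pose t := cn (fun i => kappa i * creal (cr w i / cr eta i)).
have t1 j : cabs (t j) <= 1.
  rewrite /t /cn; case: (fintype.split j) => [i|_]; last by rewrite cabs1.
  by rewrite cabsM cabs_creal gtr0_norm ?divr_gt0// mulrA ler_pdivrMr// mul1r.
have zE : scl (cn kappa) z = scl t (scl s z).
  rewrite scl_cnM; apply: eq_scl => j; apply: eq_cn => i.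
  rewrite -[RHS]mulrA -crealM -[LHS]mulr1 -creal1; congr (_ * creal _).
  by move: (c0 i) (c1 i); move: (cr w i) (cr eta i) => a b a0 b0; field; rewrite !gt_eqF.
have PE : scl s P = scl (fun j => cconj (t j)) q.
  rewrite /P scl_cnM; apply: eq_scl => j; rewrite cn_conj; apply: eq_cn => i.
  rewrite cconjM cconj_creal [LHS]mulrCA -crealM; congr (_ * creal _).
  by move: (c0 i) (c1 i); move: (cr w i) (cr eta i) => a b a0 b0; field; rewrite !gt_eqF.
have Utq : Us eta (scl (fun j => cconj (t j)) q).
  apply: (star_Us Uq) => j; first by rewrite cabs_conj.
  by move=> Jj; rewrite /t cn_Jn// cconj1.
have UP : Us w P by apply/UU; rewrite -/s PE.
split => //.
have Us1 : Us eta (scl s z) by exact: (proj1 (UU z)).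
rewrite zE (kernel_contract (@star_Us eta) hKe t1 (fun j Jj => @cn_Jn _ j Jj) Us1 Uq).
rewrite -PE -(kernel_unique (kernel_scl s0 UU hKe) hKw Uz UP) mulrA -crealM.
rewrite scl_jac_cn -big_split /= big1 ?creal1 ?mul1r// => i _.
rewrite cabs_creal gtr0_norm ?divr_gt0// -exprMn -[RHS](expr1n _ 2); congr (_ ^+ 2).
by move: (c0 i) (c1 i); move: (cr w i) (cr eta i) => a b a0 b0; field; rewrite !gt_eqF.
Qed.

End HartogsGeometry.

Lemma app_last_continuous (R : realType) N (w : Cx R) : continuous (fun v : 'rV[Cx R]_N => app_last v w).
Proof.
move=> v; apply: ccont_rVP => k; case: (split_ordP k) => j ->.
  by apply: (@eq_ccont _ _ _ (fun u : 'rV[Cx R]_N => u 0 j)); [move=> u; exact: app_lastE|exact: ccont_coord].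
by apply: (@eq_ccont _ _ _ (fun=> w)); [move=> u; exact: app_last_last|exact: ccont_cst].
Qed.

(** * The reproducing property applied slice by slice *)

Section SlicePairing.
Variables (R : realType) (n m : nat) (Omega : set 'rV[Cx R]_(n + m)) (alpha : 'I_n -> R).
Local Notation C := (Cx R).
Hypothesis starO : nstar_hartogs Omega.
Hypothesis alpha0 : forall i, 0 < alpha i.
Implicit Types (q : 'rV[C]_(n + m)) (v p : 'rV[C]_(n + m + 1)).
Local Notation U := (U_alpha alpha Omega).
Local Notation Us := (U_alpha_eta alpha Omega).
Local Notation mu := (@lebesgue_measure R).
Local Notation mu2 := (mu \x mu)%E.
Variables (KU : 'rV[C]_(n + m + 1) -> 'rV[C]_(n + m + 1) -> C) (Keta : C -> 'rV[C]_(n + m) -> 'rV[C]_(n + m) -> C).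
Hypothesis hKU : is_bergman_kernel U KU.
Hypothesis hKeta : forall eta : C, cabs eta < 1 -> is_bergman_kernel (Us eta) (Keta eta).
Variables (eta : C) (qz : 'rV[C]_(n + m)) (kappa : C -> 'I_n -> C) (c : C -> C).
Hypothesis Uq : Us eta qz.
Hypothesis kappa_der : forall w i, cabs w <= 1 -> exists d, cder (fun t => kappa t i) w d.
Hypothesis c_der : forall w, cabs w <= 1 -> exists d, cder c w d.
Hypothesis kappa0 : forall w i, cabs w <= 1 -> kappa w i != 0.
Hypothesis kappa_le : forall w i, cabs w < 1 -> cabs (kappa w i) * cr alpha w i <= cr alpha eta i.

(** With [c] the coefficient of [D_op] and [kappa] the powers of
    [s (1 - |eta|^2) / (1 - w conj eta)] this is the function [Phi_s] of the overview. *)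
Definition slice_fun v : C := c (wof v) * Keta eta (scl (cn (kappa (wof v))) (lsubmx v)) qz.

Let e1 : cabs eta < 1 := U_cabs Uq.

Lemma slice_funE q w : slice_fun (app_last q w) = c w * Keta eta (scl (cn (kappa w)) q) qz.
Proof. by rewrite /slice_fun wof_app lsubmx_app. Qed.

Lemma Us_kappa q w : U (app_last q w) -> Us eta (scl (cn (kappa w)) q).
Proof. move=> Uqw; apply: (U_scale starO Uqw e1) => i; exact: kappa_le (U_cabs Uqw). Qed.

Lemma holo_at_wof v : holo_at (fun u : 'rV[C]_(n + m + 1) => wof u) v.
Proof.
rewrite (_ : (fun u : 'rV[C]_(n + m + 1) => wof u) = (fun u => u 0 (rshift (n + m) ord0))); first exact: holo_at_coord.
by apply/funext => u; rewrite /wof mxE.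
Qed.

Lemma slice_fun_holo : open U -> holomorphic_on U slice_fun.
Proof.
move=> oU; apply/holoP; split=> // v Uv.
have Uv' := Uv; rewrite -(app_eta v) in Uv'.
have w1 := ltW (U_cabs Uv').
apply: holo_atM.
  have [d cd] := c_der w1.
  exact: (@holo_at_compC _ _ (fun u : 'rV[C]_(n + m + 1) => wof u) c d v (holo_at_wof v) cd).
have hG := kernel_holo (hKeta e1) Uq.
apply: (@holo_at_comp R (n + m) (n + m + 1) (Us eta) (fun z => Keta eta z qz)
  (fun u => scl (cn (kappa (wof u))) (lsubmx u)) v hG (Us_kappa Uv')) => k.
rewrite (_ : (fun u : 'rV[C]_(n + m + 1) => _) = fun u => cn (kappa (wof u)) k * u 0 (lshift 1 k)); last first.
  by apply/funext => u; rewrite sclE mxE.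
apply: holo_atM; last exact: holo_at_coord.
rewrite /cn; case: (fintype.split k) => [i|_]; last exact: holo_at_cst.
have [d kd] := kappa_der i w1.
exact: (@holo_at_compC _ _ (fun u : 'rV[C]_(n + m + 1) => wof u) (kappa^~ i) d v (holo_at_wof v) kd).
Qed.

Local Notation kG := (fun z => (\1_(Us eta) z * cabs (Keta eta z qz) ^+ 2)%:E).
Local Notation kP := (fun v => (\1_U v * cabs (slice_fun v) ^+ 2)%:E).

(** The substitution by [kappa w] compares each slice with the square norm of the kernel of
    [Us eta]. The bound is uniform because [kappa] has no zero on the closed disc, so that the
    inverse Jacobian is bounded; as the disc has finite area, [slice_fun] is square integrable. *)
Lemma slice_fun_slice : open U -> exists B : R, 0 <= B /\
  forall w, (slice_int kP w <= (B * \1_[set w : C | cabs w < 1] w)%:E)%E.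
Proof.
move=> oU.
have lG : lscge0 kG by apply: lscge0_sqr; exact: (kernel_holo (hKeta e1) Uq).
have lP : lscge0 kP by apply: lscge0_sqr; exact: slice_fun_holo.
have [M M0 cM] : exists2 M : R, 0 < M & forall w, cabs w <= 1 -> cabs (c w) <= M.
  by apply: disc_bounded => w w1; have [d /cder_cont] := c_der w1.
have /choice[m1 m1P] : forall i, exists M : R, 0 < M /\ forall w, cabs w <= 1 -> cabs (kappa w i)^-1 <= M.
  move=> i; have [w w1|M' M'0 H] := @disc_bounded R (fun w => (kappa w i)^-1); last by exists M'.
  have [d /cder_cont kc] := kappa_der i w1.
  exact: (@ccontV R C (fun w => kappa w i) w (kappa0 i w1) kc).
have V0 := vol_int_ge0 lG.
have Vfin : vol_int kG \is a fin_num.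
  by rewrite ge0_fin_numE//; have [_] := (proj1 (hKeta e1)) _ Uq.
pose J := \prod_i m1 i ^+ 2.
exists (M ^+ 2 * J * fine (vol_int kG)); split.
  apply: mulr_ge0; last by rewrite fine_ge0.
  by apply: mulr_ge0; [exact: sqr_ge0|apply: prodr_ge0 => i _; exact: sqr_ge0].
move=> w; have [w1|w1] := ltP (cabs w) 1; last first.
  rewrite indicE memNset ?mulr0; last by rewrite /= ltNge w1.
  rewrite /slice_int (_ : (fun u => _) = (fun u => 0%:E * kG u)%E); last first.
    apply/funext => v; rewrite mul0e indicE memNset ?mul0r//.
    by move=> /U_cabs; rewrite ltNge w1.
  by rewrite vol_intZ// mul0e.
rewrite indicE mem_set// mulr1.
pose kw : 'I_(n + m) -> C := cn (kappa w).
have k0 j : kw j != 0 by apply: cn_neq0 => i; exact: kappa0 (ltW w1).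
pose k1 := (fun u => (scl_jac kw)%:E * kG (scl kw u))%E.
have j0 := scl_jac_gt0 k0.
have lk1 : lscge0 k1.
  apply: (lscge0Z (ltW j0)); exact: (lscge0_comp (@scl_continuous _ _ _) lG).
have E1 : vol_int k1 = vol_int kG by exact: vol_int_scl.
have jJ : (scl_jac kw)^-1 <= J.
  rewrite scl_jac_cn -prodfV; apply: ler_prod => i _; rewrite invr_ge0 sqr_ge0 /=.
  have [m0 H] := m1P i; rewrite -exprVn -cabsV ler_pXn2r ?nnegrE ?cabs_ge0 ?(ltW m0)//.
  exact: H (ltW w1).
pose a := M ^+ 2 * (scl_jac kw)^-1.
have a0 : 0 <= a by rewrite mulr_ge0 ?sqr_ge0// invr_ge0 ltW.
apply: (@le_trans _ _ (vol_int (fun u => a%:E * k1 u)%E)).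
  rewrite /slice_int; apply: le_vol_int.
  - split; first by move=> v; exact: (proj1 lP).
    exact: (@lsc_comp R _ _ kP (fun u => app_last u w) (proj2 lP) (@app_last_continuous R (n + m) w)).
  - exact: lscge0Z.
  move=> v; rewrite /k1 /= muleA -!EFinM lee_fin /a -(mulrA (M ^+ 2) _ (scl_jac kw)) mulVf ?gt_eqF// mulr1.
  rewrite !indicE; have [Uv|Uv] := boolP (app_last v w \in U); last first.
    by rewrite mul0r mulr_ge0 ?sqr_ge0// mulr_ge0 ?sqr_ge0// ler0n.
  rewrite mem_set; last by apply: Us_kappa; rewrite inE in Uv.
  rewrite !mul1r slice_funE cabsM exprMn ler_wpM2r ?sqr_ge0// ler_pXn2r ?nnegrE ?cabs_ge0 ?(ltW M0)//.
  exact: cM (ltW w1).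
rewrite vol_intZ// E1 -{1}(fineK Vfin) -EFinM lee_fin ler_wpM2r ?fine_ge0//.
by rewrite ler_wpM2l ?sqr_ge0.
Qed.

Lemma slice_fun_A2 : open U -> A2 U slice_fun.
Proof.
move=> oU; have hP := slice_fun_holo oU; split=> //.
have lP := lscge0_sqr hP.
have [B [B0 HB]] := slice_fun_slice oU.
rewrite /square_integrable vol_int_slice//.
have mD := @measurable_disc R.
apply: (@le_lt_trans _ _ (\int[mu2]_p (B%:E * (\1_(@disc R) p)%:E))%E).
    apply: (@ge0_le_integral _ _ _ mu2 setT).
  - exact: measurableT.
  - move=> p _; exact: (slice_int_ge0 _ lP).
  - exact: (lsc_measurable_prod (lsc_slice lP)).
  - apply: measurable_funeM; apply/measurable_EFinP; exact: measurable_indic.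
  - by move=> p _; apply: le_trans (HB _) _; rewrite EFinM.
rewrite ge0_integralZl_EFin//; last by apply/measurable_EFinP; exact: measurable_indic.
rewrite integral_indic// setIT lte_mul_pinfty ?lee_fin//; exact: mu2_disc.
Qed.

Lemma slice_A2 (F : 'rV[C]_(n + m + 1) -> C) w (k : C) q0 : holomorphic_on U F -> Us w q0 -> open (Us w) ->
  (slice_int (fun v => (\1_U v * cabs (F v) ^+ 2)%:E) w < +oo)%E ->
  A2 (Us w) (fun z => k * F (app_last z w)).
Proof.
move=> hF U0 oUs fin.
have H : A2 (Us w) (fun z => F (app_last z w)).
  split.
    apply/holoP; split=> // z Uz.
    apply: (@holo_at_comp R (n + m + 1) (n + m) U F (fun z => app_last z w) z hF Uz) => j.
    case: (split_ordP j) => i ->.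
      rewrite (_ : (fun _ => _) = fun z : 'rV[C]_(n + m) => z 0 i); first exact: holo_at_coord.
      by apply/funext => u; rewrite app_lastE.
    rewrite (_ : (fun _ => _) = fun _ : 'rV[C]_(n + m) => w); first exact: holo_at_cst.
    by apply/funext => u; rewrite app_last_last.
  exact: fin.
have := @A2_scl R (n + m) (Us w) (Us w) (fun=> 1) k _ (fun=> oner_neq0 _) (fun z => ltac:(by rewrite scl1)) H.
by congr A2; apply/funext => z; rewrite scl1.
Qed.

Lemma eq_cint N (D : set 'rV[C]_N) (h h' : 'rV[C]_N -> C) : (forall z, D z -> h z = h' z) -> cint D h = cint D h'.
Proof.
move=> hh.
have E (f : C -> R) : (fun z => \1_D z * f (h z)) = (fun z => \1_D z * f (h' z)).
  by apply/funext => z; rewrite indicE; have [/set_mem/hh ->|] := boolP (z \in D); rewrite ?mul0r.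
by rewrite /cint !E.
Qed.

(** [slice_fun p] is the pairing of [slice_fun] with [KU z p]. On the slice over [w], [slice_kernel]
    turns [slice_fun] into a multiple of the kernel of that slice, which reproduces the restriction
    of [KU z p] at one point; [g] is the resulting function of [w], continued to the closed disc. *)
Lemma slice_pairing p (g : C -> C) : U p -> (forall w, cabs w <= 1 -> ccont g w) ->
  (forall w, cabs w < 1 -> g w = c w * creal (\prod_i (cr alpha w i / cr alpha eta i) ^+ 2) *
     cconj (KU (app_last (scl (cn (fun i => cconj (kappa w i) * creal ((cr alpha w i / cr alpha eta i) ^+ 2))) qz) w) p)) ->
  slice_fun p = dint g.
Proof.
move=> Up cg gE.
have oU := kernel_open hKU Up; have hF := kernel_holo hKU Up; have AF := (proj1 hKU) p Up.
have AP := slice_fun_A2 oU.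
pose F z := KU z p; pose H z := slice_fun z * cconj (F z).
(* The product is bounded by the sum of the squares. Keeping the whole sum as majorant also controls
   the norm of [F] on every slice where it is finite. *)
pose kF v := (\1_U v * cabs (F v) ^+ 2)%:E; pose k v := (kF v + kP v)%E.
have lF : lscge0 kF by exact: lscge0_sqr.
have lP : lscge0 kP by exact: (lscge0_sqr (proj1 AP)).
have lk : lscge0 k by exact: lscge0D.
have kfin : (vol_int k < +oo)%E by rewrite vol_intD// lte_add_pinfty//; [exact: (proj2 AF)|exact: (proj2 AP)].
have cH v : U v -> ccont H v.
  move=> Uv; apply: ccontM; first exact: (holo_cont (proj1 AP) Uv).
  apply: ccont_conj; exact: (holo_cont hF Uv).
have Hk (f : C -> R) v : (forall z, `|f z| <= cabs z) -> ((\1_U v * `|f (H v)|)%:E <= k v)%E.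
  move=> fle; rewrite /k /kF -EFinD lee_fin -mulrDr ler_wpM2l//.
  apply: le_trans (fle _) _; rewrite /H cabsM cabs_conj.
  by have := cabs_ge0 (slice_fun v); have := cabs_ge0 (F v); nra.
(* Finiteness on the slice is what puts the restriction of [F] in [A2 (Us w)], so that the kernel of
   the slice reproduces it. *)
have key w : cabs w < 1 -> (slice_int k w < +oo)%E -> cint (Us w) (fun z => H (app_last z w)) = g w.
  move=> w1 kw.
  have kFw : (slice_int kF w < +oo)%E.
    apply: le_lt_trans kw; rewrite /slice_int /vol_int -!iter_int_lshift.
    apply: le_iter_int => // v; rewrite leeDl//; exact: (proj1 lP).
  pose P := scl (cn (fun i => cconj (kappa w i) * creal ((cr alpha w i / cr alpha eta i) ^+ 2))) qz.
  have SK z : Us w z -> Us w P /\ _ := fun Uz =>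
    slice_kernel starO w1 e1 (hKeta e1) (hKeta w1) (fun i => kappa_le i w1) Uz Uq.
  have UP : Us w P.
    (* [slice_kernel] has to be fed a point of the slice over [w]; the rescaled [qz] is one. *)
    have e2 : Us w (scl (cn (fun i => creal (cr alpha w i / cr alpha eta i))) qz).
      apply: (U_scale starO Uq w1) => i; have := cr_gt0 alpha i w1; have := cr_gt0 alpha i e1 => a0 b0.
      rewrite cabs_creal gtr0_norm; last exact: divr_gt0.
      by rewrite divfK ?gt_eqF.
    exact: (proj1 (SK _ e2)).
  pose a := cconj (c w) * creal (\prod_i (cr alpha w i / cr alpha eta i) ^+ 2).
  have oUs := kernel_open (hKeta w1) UP.
  have Af : A2 (Us w) (fun z => a * F (app_last z w)) by exact: (slice_A2 a hF UP oUs kFw).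
  have E1 : cint (Us w) (fun z => H (app_last z w)) =
     cint (Us w) (fun z => cconj (a * F (app_last z w) * cconj (Keta w z P))).
    apply: eq_cint => z Uz; have [_ Ez] := SK z Uz.
    rewrite /H slice_funE Ez !cconjM !cconjK cconj_creal -/P.
    by ring.
  rewrite E1 cint_conj -(proj2 (hKeta w1) _ Af P UP) gE// /a !cconjM cconjK cconj_creal -/P.
  by ring.
rewrite [slice_fun p](proj2 hKU _ AP p Up) /cint /dint /mkC; congr (_ +i* _)%C.
- apply: (@slice_real_int R (n + m) U (fun v => cre (H v)) k (fun w => cre (g w))) => //.
  + by move=> v Uv; apply: rcont_re; exact: cH.
  + by move=> v w; exact: U_cabs.
  + by move=> v; apply: Hk => z; exact: cre_le.
  + by move=> w w1; apply: rcont_re; exact: cg.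
  + by move=> w w1 kw; rewrite -(key w w1 kw).
- apply: (@slice_real_int R (n + m) U (fun v => cim (H v)) k (fun w => cim (g w))) => //.
  + by move=> v Uv; apply: rcont_im; exact: cH.
  + by move=> v w; exact: U_cabs.
  + by move=> v; apply: Hk => z; exact: cim_le.
  + by move=> w w1; apply: rcont_im; exact: cg.
  + by move=> w w1 kw; rewrite -(key w w1 kw).
Qed.

End SlicePairing.

(** * The Cauchy-Pompeiu formula *)

Section DiscFubini.
Variable R : realType.
Local Notation C := (Cx R).
Local Notation mu := (@lebesgue_measure R).
Local Notation mu2 := (mu \x mu)%E.
Implicit Types (u U : R -> R).

Lemma integral_FTC_oo (a b : R) u U : a < b -> (forall x, a <= x <= b -> rcont u x) ->
  (forall x, a <= x <= b -> rcont U x) -> (forall x, a < x < b -> is_derive x 1 U (u x)) ->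
  (\int[mu]_(x in `[a, b]) (u x)%:E = (U b - U a)%:E)%E.
Proof.
move=> ab cu cU dU; rewrite (@continuous_FTC2 _ u U)//.
- exact: cont_within.
- split.
  + by move=> x; rewrite in_itv /= => xab; exact: (@ex_derive _ _ _ _ _ _ _ (dU x xab)).
  + by apply: cvg_at_right_filter; apply: cU; rewrite lexx ltW.
  + by apply: cvg_at_left_filter; apply: cU; rewrite lexx ltW.
- by move=> x; rewrite in_itv /= => xab; rewrite derive1E; apply: derive_val; exact: dU.
Qed.

Definition half_chord (c : R) : R := Num.sqrt (1 - c ^+ 2).

Lemma cabs_mkC x y : cabs (mkC x y : C) = Num.sqrt (x ^+ 2 + y ^+ 2).
Proof. by []. Qed.

Lemma cabs_mkC_swap x y : cabs (mkC x y : C) = cabs (mkC y x : C).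
Proof. by rewrite !cabs_mkC addrC. Qed.

Lemma cabs_mkC_le1 x y : (cabs (mkC x y : C) <= 1) = (x ^+ 2 + y ^+ 2 <= 1).
Proof. by rewrite cabs_mkC -{1}sqrtr1 ler_sqrt// ltr01. Qed.

Lemma cabs_mkC_lt1 x y : (cabs (mkC x y : C) < 1) = (x ^+ 2 + y ^+ 2 < 1).
Proof. by rewrite cabs_mkC -{1}sqrtr1 ltr_sqrt// ltr01. Qed.

Lemma half_chord_lt c t : c ^+ 2 < 1 -> (cabs (mkC c t : C) < 1) = (- half_chord c < t < half_chord c).
Proof.
move=> c1; rewrite cabs_mkC_lt1 -ltr_norml /half_chord -sqrtr_sqr ltr_sqrt ?subr_gt0//.
by rewrite ltrBrDl.
Qed.

Lemma half_chord_le c t : c ^+ 2 < 1 -> (cabs (mkC c t : C) <= 1) = (- half_chord c <= t <= half_chord c).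
Proof.
move=> c1; rewrite cabs_mkC_le1 -ler_norml /half_chord -sqrtr_sqr ler_sqrt ?subr_ge0 ?(ltW c1)//.
by rewrite lerBrDl.
Qed.

Lemma chord_int c u U : (forall t, cabs (mkC c t : C) <= 1 -> rcont u t) ->
  (forall t, cabs (mkC c t : C) <= 1 -> rcont U t) ->
  (forall t, cabs (mkC c t : C) < 1 -> is_derive t 1 U (u t)) ->
  (\int[mu]_t ((EFin \o u) \_ [set t | (cabs (mkC c t : C) < 1)%R]) t =
   (if (c ^+ 2 < 1)%R then U (half_chord c) - U (- half_chord c) else 0)%:E)%E.
Proof.
move=> cu cU dU; rewrite -integral_mkcond; case: ifPn => c1; last first.
  rewrite (_ : [set t | _] = set0) ?integral_set0//; apply/seteqP; split=> // t /=.
  rewrite cabs_mkC_lt1 => h; apply: (negP c1); apply: le_lt_trans h.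
  by rewrite lerDl sqr_ge0.
have b0 : 0 < half_chord c by rewrite sqrtr_gt0 subr_gt0.
rewrite (_ : [set t | _] = `]- half_chord c, half_chord c[%classic); last first.
  by apply/seteqP; split => t /=; rewrite in_itv /= half_chord_lt.
have mu' : measurable_fun `]- half_chord c, half_chord c[ (EFin \o u).
  have := @cont_integrable R (- half_chord c) (half_chord c) u (fun x h => cu x ltac:(by rewrite half_chord_le)).
  move=> /measurable_int mI; apply: measurable_funS mI => //.
  exact: subset_itv_oo_cc.
rewrite -(@integral_itv_bndoo R _ _ _ true false mu').
apply: integral_FTC_oo.
- by rewrite -subr_gt0 opprK addr_gt0.
- by move=> x xb; apply: cu; rewrite half_chord_le.
- by move=> x xb; apply: cU; rewrite half_chord_le.
- by move=> x xb; apply: dU; rewrite half_chord_lt.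
Qed.

Lemma disc_integrableT (u : C -> R) : (forall w, cabs w <= 1 -> rcont u w) ->
  mu2.-integrable setT ((fun p => (u (mkC p.1 p.2))%:E) \_ (@disc R)).
Proof.
move=> cu; have := disc_integrable cu.
by rewrite integrable_mkcond//; exact: measurable_disc.
Qed.

Lemma rcont_mkC (u : C -> R) x y : rcont u (mkC x y) ->
  rcont (fun t => u (mkC x t)) y /\ rcont (fun t => u (mkC t y)) x.
Proof.
move=> cu; split.
  apply: (@rcont_comp R _ _ (fun t : R => mkC x t) u) => //.
  apply: (@ccont_mk R _ (fun=> x) id); [exact: rcont_cst|exact: rcont_id].
apply: (@rcont_comp R _ _ (fun t : R => mkC t y) u) => //.
apply: (@ccont_mk R _ id (fun=> y)); [exact: rcont_id|exact: rcont_cst].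
Qed.

Lemma disc_vertical (u U : C -> R) : (forall w, cabs w <= 1 -> rcont u w) ->
  (forall w, cabs w <= 1 -> rcont U w) ->
  (forall x y : R, cabs (mkC x y : C) < 1 -> is_derive y 1 (fun t => U (mkC x t)) (u (mkC x y))) ->
  Rintegral mu2 (@disc R) (fun p => u (mkC p.1 p.2)) =
  (fine (\int[mu]_x (if (x ^+ 2 < 1)%R then U (mkC x (half_chord x)) - U (mkC x (- half_chord x)) else 0)%:E))%E.
Proof.
move=> cu cU dU; rewrite /Rintegral integral_mkcond -(integral12_prod_meas1 (disc_integrableT cu)).
congr fine; apply: eq_integral => x _; rewrite /fubini_F.
rewrite -(@chord_int x (fun t => u (mkC x t)) (fun t => U (mkC x t))).
- by apply: eq_integral => y _; rewrite !patchE.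
- by move=> t /cu /rcont_mkC[].
- by move=> t /cU /rcont_mkC[].
Qed.

Lemma disc_horizontal (u U : C -> R) : (forall w, cabs w <= 1 -> rcont u w) ->
  (forall w, cabs w <= 1 -> rcont U w) ->
  (forall x y : R, cabs (mkC x y : C) < 1 -> is_derive x 1 (fun t => U (mkC t y)) (u (mkC x y))) ->
  Rintegral mu2 (@disc R) (fun p => u (mkC p.1 p.2)) =
  (fine (\int[mu]_y (if (y ^+ 2 < 1)%R then U (mkC (half_chord y) y) - U (mkC (- half_chord y) y) else 0)%:E))%E.
Proof.
move=> cu cU dU; rewrite /Rintegral integral_mkcond -(integral21_prod_meas1 (disc_integrableT cu)).
congr fine; apply: eq_integral => y _; rewrite /fubini_G.
have dU' t : cabs (mkC y t : C) < 1 -> is_derive t 1 (fun t => U (mkC t y)) (u (mkC t y)).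
  by rewrite cabs_mkC_swap; exact: dU.
rewrite -(@chord_int y (fun t => u (mkC t y)) (fun t => U (mkC t y)) _ _ dU').
- apply: eq_integral => x _; rewrite !patchE /disc.
  by congr (if _ then _ else _); apply/idP/idP; rewrite !inE /= cabs_mkC_swap.
- by move=> t; rewrite cabs_mkC_swap => /cu /rcont_mkC[].
- by move=> t; rewrite cabs_mkC_swap => /cU /rcont_mkC[].
Qed.

Lemma half_chord_on x : x ^+ 2 < 1 -> cabs (mkC x (half_chord x) : C) = 1 /\ cabs (mkC x (- half_chord x) : C) = 1.
Proof.
move=> x1; rewrite !cabs_mkC sqrrN /half_chord sqr_sqrtr ?subr_ge0 ?ltW//.
by rewrite addrC subrK sqrtr1.
Qed.

(** Every vertical chord has its ends on the circle, where [f] vanishes, so each inner integral is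
    0. *)
Lemma dint_dy (f fy : C -> C) : (forall w, cabs w <= 1 -> ccont f w) -> (forall w, cabs w <= 1 -> ccont fy w) ->
  (forall w, cabs w = 1 -> f w = 0) ->
  (forall x y : R, cabs (mkC x y : C) < 1 -> is_derive y 1 (fun t => cre (f (mkC x t))) (cre (fy (mkC x y))) /\
     is_derive y 1 (fun t => cim (f (mkC x t))) (cim (fy (mkC x y)))) -> dint fy = 0.
Proof.
move=> cf cfy f0 df; apply: complex_eqP; rewrite /dint !cE.
- rewrite (@disc_vertical (fun w => cre (fy w)) (fun w => cre (f w)) _ _ (fun x y h => proj1 (df x y h))).
  + rewrite integral0_eq// => x _; case: ifPn => // /half_chord_on[h1 h2].
    by rewrite (f0 _ h1) (f0 _ h2) subrr.
  + by move=> w /cfy; exact: rcont_re.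
  + by move=> w /cf; exact: rcont_re.
- rewrite (@disc_vertical (fun w => cim (fy w)) (fun w => cim (f w)) _ _ (fun x y h => proj2 (df x y h))).
  + rewrite integral0_eq// => x _; case: ifPn => // /half_chord_on[h1 h2].
    by rewrite (f0 _ h1) (f0 _ h2) subrr.
  + by move=> w /cfy; exact: rcont_im.
  + by move=> w /cf; exact: rcont_im.
Qed.

Lemma dint_dx (f fx : C -> C) : (forall w, cabs w <= 1 -> ccont f w) -> (forall w, cabs w <= 1 -> ccont fx w) ->
  (forall w, cabs w = 1 -> f w = 0) ->
  (forall x y : R, cabs (mkC x y : C) < 1 -> is_derive x 1 (fun t => cre (f (mkC t y))) (cre (fx (mkC x y))) /\
     is_derive x 1 (fun t => cim (f (mkC t y))) (cim (fx (mkC x y)))) -> dint fx = 0.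
Proof.
move=> cf cfx f0 df; apply: complex_eqP; rewrite /dint !cE.
- rewrite (@disc_horizontal (fun w => cre (fx w)) (fun w => cre (f w)) _ _ (fun x y h => proj1 (df x y h))).
  + rewrite integral0_eq// => y _; case: ifPn => // /half_chord_on[h1 h2].
    by rewrite (f0 (mkC (half_chord y) y)) 1?cabs_mkC_swap// (f0 (mkC (- half_chord y) y)) 1?cabs_mkC_swap// subrr.
  + by move=> w /cfx; exact: rcont_re.
  + by move=> w /cf; exact: rcont_re.
- rewrite (@disc_horizontal (fun w => cim (fx w)) (fun w => cim (f w)) _ _ (fun x y h => proj2 (df x y h))).
  + rewrite integral0_eq// => y _; case: ifPn => // /half_chord_on[h1 h2].
    by rewrite (f0 (mkC (half_chord y) y)) 1?cabs_mkC_swap// (f0 (mkC (- half_chord y) y)) 1?cabs_mkC_swap// subrr.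
  + by move=> w /cfx; exact: rcont_im.
  + by move=> w /cf; exact: rcont_im.
Qed.

Lemma rcont_half_chord x : rcont half_chord x.
Proof.
apply: (@rcont_compR R R (fun x => 1 - x ^+ 2) Num.sqrt); last exact: sqrt_continuous.
by apply: rcontB; [exact: rcont_cst|apply: rcontX; exact: rcont_id].
Qed.

(* [2 atan (x / (1 + sqrt (1 - x^2)))] is [asin x], in a form continuous up to [x = 1]. *)
Lemma area_primitive (x : R) : x ^+ 2 < 1 ->
  is_derive x 1 (fun t : R => t * half_chord t + 2 * atan (t / (1 + half_chord t))) (2 * half_chord x).
Proof.
move=> x1; have s0 : 0 < half_chord x by rewrite sqrtr_gt0 subr_gt0.
have x1' : 0 < 1 - x ^+ 2 by rewrite subr_gt0.
have sE : half_chord x ^+ 2 = 1 - x ^+ 2 by rewrite sqr_sqrtr// ltW.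
have d1 : is_derive x 1 (fun t : R => 1 - t ^+ 2 : R) (- (2 * x)).
  by apply: is_derive_eq; rewrite /GRing.scale /=; ring.
have d2 : is_derive x 1 half_chord (- (2 * x) * (2 * half_chord x)^-1).
  by have := @is_derive1_comp _ Num.sqrt (fun t : R => 1 - t ^+ 2) x _ _ (is_derive1_sqrt x1') d1; rewrite mulrC.
have s10 : 1 + half_chord x != 0 by rewrite gt_eqF// addr_gt0.
have dD (f g : R -> R) (a b : R) : is_derive x 1 f a -> is_derive x 1 g b ->
  is_derive x 1 (fun t : R => f t + g t) (a + b) by exact: is_deriveD.
have dM (f g : R -> R) (a b : R) : is_derive x 1 f a -> is_derive x 1 g b ->
  is_derive x 1 (fun t : R => f t * g t) (f x * b + g x * a) by exact: is_deriveM.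
have dc (a : R) : is_derive x (1 : R) (fun=> a) (0 : R) by exact: is_derive_cst.
have di : is_derive x (1 : R) (fun t : R => t) (1 : R) by exact: is_derive_id.
have d3 := @is_deriveV R (fun t : R => 1 + half_chord t) x _ 1 s10 (dD _ _ _ _ (dc 1) d2).
have d4 := dM _ _ _ _ di d3.
have d5 := @is_derive1_comp _ atan (fun t : R => t / (1 + half_chord t)) x _ _ (is_derive1_atan _) d4.
have d6 := dD _ _ _ _ (dM _ _ _ _ di d2) (dM _ _ _ _ (dc 2) d5).
apply: (@is_derive_eq _ _ _ _ _ _ _ _ d6); rewrite /GRing.scale /= /GRing.scale /=.
clear -s0 sE s10; move: (half_chord x) s0 sE s10 => s s0 sE s10.
have xE : x ^+ 2 = 1 - s ^+ 2 by rewrite sE; ring.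
have s0' : s != 0 by rewrite gt_eqF.
have -> : (1 + (x / (1 + s)) ^+ 2)^-1 = (1 + s) / 2.
  rewrite expr_div_n xE (_ : 1 + _ = 2 / (1 + s)); first by rewrite invf_div.
  by field; rewrite s10.
rewrite (_ : _ + _ = - (x ^+ 2) / s + s + (1 + s) * (x ^+ 2 / ((1 + s) ^+ 2 * s) + (1 + s)^-1)).
  by rewrite xE; field; rewrite s10.
by field; rewrite s10.
Qed.

Lemma sqr_lt1 (x : R) : (x ^+ 2 < 1) = (-1 < x < 1).
Proof. by rewrite -(@real_normK _ x) ?num_real// expr_lt1// ltr_norml. Qed.

(** The area of the disc: chord lengths are integrated with [area_primitive], whose values at [1]
    and [-1] are [2 atan 1] and its negative. *)
Lemma dint1 : dint (fun=> 1) = creal pi :> C.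
Proof.
apply: complex_eqP; rewrite /dint !cE; last by rewrite Rintegral_cst ?mul0r//; exact: measurable_disc.
rewrite (@disc_vertical (fun=> 1) (@cim R) _ _ (fun x y _ => is_derive_id y 1)); last 2 first.
- by move=> w _; exact: rcont_cst.
- by move=> w _; apply: (@rcont_im R _ id); exact: ccont_id.
pose I1 : set R := `]-1, 1[%classic.
transitivity (fine (\int[mu]_x ((EFin \o (fun x : R => 2 * half_chord x)%R) \_ I1) x)%E).
  congr fine; apply: eq_integral => x _; rewrite patchE !cE.
  have -> : (x \in I1) = (x ^+ 2 < 1).
    by rewrite sqr_lt1; apply/idP/idP; rewrite inE /I1 /= in_itv.
  by case: ifP => // _; rewrite /= opprK mulrDl mul1r.
rewrite -integral_mkcond /I1.
have cu (x : R) : rcont (fun x : R => 2 * half_chord x) x.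
  by apply: rcontM; [exact: rcont_cst|exact: rcont_half_chord].
have mu' : measurable_fun `](-1 : R), 1[ (EFin \o (fun x : R => 2 * half_chord x)).
  have /measurable_int mI := @cont_integrable R (-1) 1 (fun x : R => 2 * half_chord x) (fun x _ => cu x).
  by apply: measurable_funS mI => //; exact: subset_itv_oo_cc.
rewrite -(@integral_itv_bndoo R _ _ _ true false mu').
pose F (t : R) := t * half_chord t + 2 * atan (t / (1 + half_chord t)).
have cF (x : R) : rcont F x.
  apply: rcontD; first by apply: rcontM; [exact: rcont_id|exact: rcont_half_chord].
  apply: rcontM; first exact: rcont_cst.
  apply: (@rcont_compR R R (fun t => t / (1 + half_chord t)) atan); last exact: continuous_atan.
  apply: rcontM; first exact: rcont_id.
  apply: rcontV; last by apply: rcontD; [exact: rcont_cst|exact: rcont_half_chord].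
  by rewrite gt_eqF// ltr_pwDl// sqrtr_ge0.
have dF (x : R) : -1 < x < 1 -> is_derive x 1 F (2 * half_chord x).
  by rewrite -sqr_lt1; exact: area_primitive.
have n11 : -1 < 1 :> R by rewrite gtrN.
transitivity (fine (F 1 - F (-1))%:E).
  congr fine; exact: (integral_FTC_oo n11 (fun x _ => cu x) (fun x _ => cF x) dF).
by rewrite /F /half_chord sqrrN expr1n subrr sqrtr0 !mulr0 !addr0 !divr1 !add0r atanN atan1 /=; lra.
Qed.

Lemma dint_bound (g h : C -> C) : (forall w, cabs w <= 1 -> ccont g w) -> (forall w, cabs w <= 1 -> ccont h w) ->
  (forall w, cabs w < 1 -> cabs (g w) <= cre (h w)) -> cabs (dint g) <= 2 * cre (dint h).
Proof.
move=> cg ch gh.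
have ih := @disc_integrable R (fun w => cre (h w)) (fun w hw => rcont_re (ch w hw)).
have H (f : C -> R) : (forall w, cabs w <= 1 -> rcont (fun z => f (g z)) w) -> (forall z, `|f z| <= cabs z) ->
    `|Rintegral mu2 (@disc R) (fun p => f (g (mkC p.1 p.2)))| <= cre (dint h).
  move=> cf fle; have ii := disc_integrable cf.
  apply: le_trans (le_normr_Rintegral (@measurable_disc R) ii) _.
  apply: le_Rintegral => //; first exact: measurable_disc.
    exact: (integrable_norm ii).
  by move=> p Dp; apply: le_trans (fle _) (gh _ Dp).
apply: le_trans (cabs_le _) _; rewrite mulrDl mul1r {1 2}/dint.
apply: lerD.
  by apply: (H (@cre R)); [move=> w /cg; exact: rcont_re|exact: cre_le].
by apply: (H (@cim R)); [move=> w /cg; exact: rcont_im|exact: cim_le].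
Qed.

End DiscFubini.

(** * Wirtinger calculus, Green's formula and the Cauchy-Pompeiu formula *)

Section CauchyPompeiu.
Variable R : realType.
Local Notation C := (Cx R).
Implicit Types (V W : C -> C -> C) (w a b : C).

(* [V] is a function of [w] and [conj w] treated as independent variables; [va] and [vb] are its
   Wirtinger derivatives at [w]. *)
Definition pder V w va vb := forall (a b : C -> C) (t da db : C),
  cder a t da -> cder b t db -> a t = w -> b t = cconj w -> cder (fun s => V (a s) (b s)) t (va * da + vb * db).

Lemma cder_eq (f : C -> C) z d d' : cder f z d -> d = d' -> cder f z d'.
Proof. by move=> ? <-. Qed.

Lemma pder_fst w : pder (fun a _ => a) w 1 0.
Proof. by move=> a b t da db ha hb _ _; apply: (cder_eq ha); ring. Qed.

Lemma pder_snd w : pder (fun _ b => b) w 0 1.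
Proof. by move=> a b t da db ha hb _ _; apply: (cder_eq hb); ring. Qed.

Lemma pder_cst k w : pder (fun _ _ => k) w 0 0.
Proof. by move=> a b t da db ha hb _ _; apply: (cder_eq (cder_cst k t)); ring. Qed.

Lemma pderB V W w va vb va' vb' : pder V w va vb -> pder W w va' vb' ->
  pder (fun a b => V a b - W a b) w (va - va') (vb - vb').
Proof.
move=> hV hW a b t da db ha hb ea eb.
have h1 := hV _ _ _ _ _ ha hb ea eb; have h2 := hW _ _ _ _ _ ha hb ea eb.
by apply: (cder_eq (cderB h1 h2)); ring.
Qed.

Lemma pderD V W w va vb va' vb' : pder V w va vb -> pder W w va' vb' ->
  pder (fun a b => V a b + W a b) w (va + va') (vb + vb').
Proof.
move=> hV hW a b t da db ha hb ea eb.
have h1 := hV _ _ _ _ _ ha hb ea eb; have h2 := hW _ _ _ _ _ ha hb ea eb.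
by apply: (cder_eq (cderD h1 h2)); ring.
Qed.

Lemma pderM V W w va vb va' vb' : pder V w va vb -> pder W w va' vb' ->
  pder (fun a b => V a b * W a b) w
    (va * W w (cconj w) + V w (cconj w) * va') (vb * W w (cconj w) + V w (cconj w) * vb').
Proof.
move=> hV hW a b t da db ha hb ea eb.
have h1 := hV _ _ _ _ _ ha hb ea eb; have h2 := hW _ _ _ _ _ ha hb ea eb.
by apply: (cder_eq (cderM h1 h2)); rewrite ea eb; ring.
Qed.

Lemma pderV V w va vb : V w (cconj w) != 0 -> pder V w va vb ->
  pder (fun a b => (V a b)^-1) w (- (V w (cconj w)) ^- 2 * va) (- (V w (cconj w)) ^- 2 * vb).
Proof.
move=> V0 hV a b t da db ha hb ea eb.
have h1 := hV _ _ _ _ _ ha hb ea eb.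
have V0' : V (a t) (b t) != 0 by rewrite ea eb.
by apply: (cder_eq (@cderV R (fun s => V (a s) (b s)) t _ V0' h1)); rewrite ea eb; ring.
Qed.

Lemma pder_eq V w va vb va' vb' : pder V w va vb -> va = va' -> vb = vb' -> pder V w va' vb'.
Proof. by move=> ? <- <-. Qed.

Lemma ciK : ci R * ci R = -1.
Proof. by apply: complex_eqP; rewrite /ci /mkC !cE; ring. Qed.

(** On the real plane [d/dx = va + vb] and [d/dy = i (va - vb)]. Both integrate to 0 by [dint_dx]
    and [dint_dy], and the two relations are solved for [va] and [vb]. *)
Lemma dint_wirtinger V (va vb : C -> C) : (forall w, cabs w <= 1 -> ccont (fun w => V w (cconj w)) w) ->
  (forall w, cabs w <= 1 -> ccont va w) -> (forall w, cabs w <= 1 -> ccont vb w) ->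
  (forall w, cabs w = 1 -> V w (cconj w) = 0) ->
  (forall w, cabs w < 1 -> pder V w (va w) (vb w)) -> dint va = 0 /\ dint vb = 0.
Proof.
move=> cV ca cb V0 hV; pose f w := V w (cconj w).
have dx : dint (fun w => va w + vb w) = 0.
  apply: (@dint_dx R f _ cV _ V0).
    by move=> w w1; apply: ccontD; [exact: ca|exact: cb].
  move=> x y xy1.
  have h1 : cder (fun t : C => t + ci R * creal y) (creal x) 1.
    by apply: (cder_eq (cderD (cder_id _) (cder_cst _ _))); ring.
  have h2 : cder (fun t : C => t - ci R * creal y) (creal x) 1.
    by apply: (cder_eq (cderB (cder_id _) (cder_cst _ _))); ring.
  have conjE (t : R) : cconj (mkC t y : C) = creal t - ci R * creal y.
    by apply: complex_eqP; rewrite /ci /mkC !cE; ring.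
  have := hV _ xy1 _ _ _ _ _ h1 h2 (esym (mkCE _ _)) (esym (conjE _)).
  rewrite !mulr1 => /cder_real; rewrite /f => -[r1 r2]; split.
    by under eq_fun do rewrite conjE mkCE.
  by under eq_fun do rewrite conjE mkCE.
have dy : dint (fun w => ci R * (va w - vb w)) = 0.
  apply: (@dint_dy R f _ cV _ V0).
    by move=> w w1; apply: ccontM; [exact: ccont_cst|apply: ccontB; [exact: ca|exact: cb]].
  move=> x y xy1.
  have h1 : cder (fun t : C => creal x + ci R * t) (creal y) (ci R).
    by apply: (cder_eq (cderD (cder_cst _ _) (cderZ (ci R) (cder_id _)))); ring.
  have h2 : cder (fun t : C => creal x - ci R * t) (creal y) (- ci R).
    by apply: (cder_eq (cderB (cder_cst _ _) (cderZ (ci R) (cder_id _)))); ring.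
  have conjE (t : R) : cconj (mkC x t : C) = creal x - ci R * creal t.
    by apply: complex_eqP; rewrite /ci /mkC !cE; ring.
  have := hV _ xy1 _ _ _ _ _ h1 h2 (esym (mkCE _ _)) (esym (conjE _)).
  rewrite mulrN -mulrBl mulrC => /cder_real; rewrite /f => -[r1 r2]; split.
    by under eq_fun do rewrite conjE mkCE.
  by under eq_fun do rewrite conjE mkCE.
have s0 : dint va + dint vb = 0 by rewrite -(dintD ca cb).
have d0 : dint va - dint vb = 0.
  move: dy; rewrite dintZ; last by move=> w w1; apply: ccontB; [exact: ca|exact: cb].
  move/eqP; rewrite mulf_eq0 (negPf (ci_neq0 R)) /= => /eqP.
  rewrite (dintD ca); last by move=> w w1; apply: ccontN; exact: cb.
  have -> : dint (fun w => - vb w) = - dint vb.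
    by rewrite -mulN1r -(dintZ _ cb); apply: eq_dint => w _; rewrite mulN1r.
  by [].
move/eqP: d0; rewrite subr_eq0 => /eqP E; move: s0; rewrite E => /eqP.
by rewrite -mulr2n mulrn_eq0 /= => /eqP ->.
Qed.

Section Pompeiu.
Variable eta : C.
Hypothesis eta1 : cabs eta < 1.
Local Notation den w := (1 - cconj w * eta).
Local Notation rho w := (cabs (eta - w) ^+ 2).

Lemma rho_ge0 w : 0 <= rho w. Proof. exact: sqr_ge0. Qed.

Lemma cre_den w : cabs w <= 1 -> 0 < cre (den w).
Proof.
move=> w1; rewrite creB cre1 subr_gt0; apply: le_lt_trans (ler_norm _) _.
apply: le_lt_trans (cre_le _) _; rewrite cabsM cabs_conj.
by apply: le_lt_trans eta1; rewrite ler_piMl ?cabs_ge0.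
Qed.

Lemma den_neq0 w : cabs w <= 1 -> den w != 0.
Proof. by move=> /cre_den; exact: cre_gt0_neq0. Qed.

Definition lam w : C := creal (1 - cabs w ^+ 2) / den w.

Lemma lamE w : lam w = (1 - w * cconj w) / den w.
Proof. by rewrite /lam mulCconj crealB creal1. Qed.

(** Keeps [lam] in the half plane where the principal powers are holomorphic. *)
Lemma cre_lam_gt0 w : cabs w < 1 -> 0 < cre (lam w).
Proof.
move=> w1; have := cre_den (ltW w1) => h.
have -> : lam w = creal ((1 - cabs w ^+ 2) / cabs (den w) ^+ 2) * cconj (den w).
  have d0 := den_neq0 (ltW w1).
  rewrite /lam crealM crealV -mulCconj -mulrA; congr (_ * _).
  by rewrite invfM -mulrA mulVf ?mulr1// -cabs_eq0 cabs_conj cabs_eq0.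
rewrite creM cre_creal cim_creal mul0r subr0 cre_conj mulr_gt0// divr_gt0//.
  by rewrite subr_gt0 expr_lt1 ?cabs_ge0.
by rewrite exprn_gt0// cabs_gt0 (den_neq0 (ltW w1)).
Qed.

Lemma lam_eta : lam eta = 1.
Proof.
rewrite lamE (mulrC eta) divff//; exact: den_neq0 (ltW eta1).
Qed.

Lemma ccont_den w : ccont (fun w => den w) w.
Proof.
apply: ccontB; first exact: ccont_cst.
by apply: ccontM; [apply: ccont_conj; exact: ccont_id|exact: ccont_cst].
Qed.

Lemma ccont_denV w : cabs w <= 1 -> ccont (fun w => (den w)^-1) w.
Proof. by move=> w1; apply: (@ccontV R C (fun w => den w) w (den_neq0 w1)); exact: ccont_den. Qed.

Lemma ccont_lam w : cabs w <= 1 -> ccont lam w.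
Proof.
move=> w1; apply: ccontM; last exact: ccont_denV.
apply: ccont_creal; apply: rcontB; first exact: rcont_cst.
by apply: rcontX; apply: (@rcont_cabs R C id); exact: ccont_id.
Qed.

Lemma ccont_rho w : rcont (fun w => rho w) w.
Proof.
apply: rcontX; apply: (@rcont_cabs R C (fun w => eta - w)).
by apply: ccontB; [exact: ccont_cst|exact: ccont_id].
Qed.

(** Near [eta] the function is negative, and at distance at least [r] the right-hand side is at
    least the bound [M] of [psi]. The power [rho^2] is chosen because [delta eps * rho^2 <= eps]: a
    strict sign at [eta] becomes a global inequality with an error that disappears against
    [delta]. *)
Lemma rho_dominates (psi : C -> R) : (forall w, cabs w <= 1 -> rcont psi w) -> psi eta < 0 ->
  exists2 M : R, 0 <= M & forall w, cabs w <= 1 -> psi w <= M * rho w ^+ 2.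
Proof.
move=> cp p0.
have [M M0 hM] := @disc_bounded R (fun w => creal (psi w)) (fun w h => ccont_creal (cp w h)).
have /ccont_epsP/(_ (- psi eta) ltac:(by rewrite oppr_gt0))[r r0 hr] := ccont_creal (cp eta (ltW eta1)).
exists (M / r ^+ 4); first by rewrite divr_ge0 ?(ltW M0)// exprn_ge0// ltW.
move=> w w1; have [wr|wr] := ltP (cabs (w - eta)) r.
  have := hr w wr; rewrite -crealB cabs_creal => h; apply: (@le_trans _ _ 0).
    by have := le_lt_trans (ler_norm _) h; lra.
  by rewrite mulr_ge0 ?sqr_ge0// divr_ge0 ?(ltW M0)// exprn_ge0// ltW.
have := hM w w1; rewrite cabs_creal => h; apply: le_trans (le_trans (ler_norm _) h) _.
rewrite cabs_distC in wr; rewrite -exprM mulrAC -mulrA ler_peMr ?(ltW M0)//.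
by rewrite ler_pdivlMr ?exprn_gt0// mul1r lerXn2r// nnegrE ?(ltW r0)// cabs_ge0.
Qed.

Lemma dint_le1 (g : C -> C) (M : R) : (forall w, cabs w <= 1 -> ccont g w) ->
  (forall w, cabs w < 1 -> cabs (g w) <= M) -> cabs (dint g) <= 2 * (M * pi).
Proof.
move=> cg gM.
have c1 (w : C) : cabs w <= 1 -> ccont (fun _ : C => 1 : C) w by move=> _; exact: ccont_cst.
have cM (w : C) : cabs w <= 1 -> ccont (fun _ : C => creal M * 1 : C) w by move=> _; exact: ccont_cst.
have := dint_bound cg cM; rewrite (dintZ _ c1) dint1 -crealM cre_creal; apply => w w1.
by rewrite mulr1 cre_creal; exact: gM.
Qed.

Definition lamV a b : C := (1 - a * b) / (1 - b * eta).

Lemma lamVE w : lamV w (cconj w) = lam w.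
Proof. by rewrite lamE. Qed.

Lemma pder_den w : pder (fun _ b => 1 - b * eta) w 0 (- eta).
Proof.
by refine (pder_eq (pderB (@pder_cst 1 w) (pderM (@pder_snd w) (@pder_cst eta w))) _ _); ring.
Qed.

Lemma pder_lam w : cabs w <= 1 -> pder lamV w (- cconj w / den w) ((eta - w) * den w ^- 2).
Proof.
move=> w1; have d0 := den_neq0 w1.
have h1 := pderB (@pder_cst 1 w) (pderM (@pder_fst w) (@pder_snd w)).
have h2 := @pderV (fun _ b => 1 - b * eta) w _ _ d0 (@pder_den w).
by refine (pder_eq (pderM h1 h2) _ _); field.
Qed.

(** An approximate identity at [eta] as [eps] tends to 0; its integral over the whole plane is [pi]
    for every [eps]. *)
Definition delta (eps : R) w : R := eps / (rho w + eps) ^+ 2.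

Section Step.
Variables (V : C -> C -> C) (va g : C -> C).
Local Notation f := (fun w => V w (cconj w)).
Hypothesis cf : forall w, cabs w <= 1 -> ccont f w.
Hypothesis ca : forall w, cabs w <= 1 -> ccont va w.
Hypothesis cg : forall w, cabs w <= 1 -> ccont g w.
Hypothesis f0 : forall w, cabs w = 1 -> f w = 0.
Hypothesis dV : forall w, cabs w < 1 -> pder V w (va w) ((eta - w) * g w).

Lemma rho_eps_gt0 eps w : 0 < eps -> 0 < rho w + eps.
Proof. by move=> e0; rewrite ltr_wpDl ?rho_ge0. Qed.

Lemma rcont_rho_epsV eps w : 0 < eps -> rcont (fun w => (rho w + eps)^-1) w.
Proof.
move=> e0; apply: (@rcontV R C (fun w => rho w + eps)); first by rewrite gt_eqF// rho_eps_gt0.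
by apply: rcontD; [exact: ccont_rho|exact: rcont_cst].
Qed.

Lemma rcont_delta eps w : 0 < eps -> rcont (delta eps) w.
Proof.
move=> e0; apply: rcontM; first exact: rcont_cst.
apply: (@rcontV R C (fun w => (rho w + eps) ^+ 2)); first by rewrite expf_neq0// gt_eqF// rho_eps_gt0.
by apply: rcontX; apply: rcontD; [exact: ccont_rho|exact: rcont_cst].
Qed.

(* Green's formula for [V] times the kernel [(conj eta - b) / (rho + eps)], a rational regularisation
   of [1 / (eta - w)] whose [b]-derivative is [- delta eps]. *)
Lemma kernel_step eps : 0 < eps ->
  dint (fun w => g w * creal (rho w * (rho w + eps)^-1)) = dint (fun w => f w * creal (delta eps w)).
Proof.
move=> e0; pose D w : C := creal (rho w + eps).
have D0 w : D w != 0 by rewrite creal_eq0 gt_eqF// rho_eps_gt0.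
have DE w : (eta - w) * (cconj eta - cconj w) + creal eps = D w.
  by rewrite /D -cconjB mulCconj crealD.
pose K a b : C := (cconj eta - b) / ((eta - a) * (cconj eta - b) + creal eps).
have dK w : pder K w ((cconj eta - cconj w) ^+ 2 / D w ^+ 2) (- creal eps / D w ^+ 2).
  have h1 := pderB (@pder_cst (cconj eta) w) (@pder_snd w).
  have h2 := pderB (@pder_cst eta w) (@pder_fst w).
  have h3 := pderD (pderM h2 h1) (@pder_cst (creal eps) w).
  have D0' : (eta - w) * (cconj eta - cconj w) + creal eps != 0 by rewrite DE.
  have h4 := @pderV (fun a b => (eta - a) * (cconj eta - b) + creal eps) w _ _ D0' h3.
  by refine (pder_eq (pderM h1 h4) _ _); rewrite -(DE w); field.
have cKc w : ccont (fun w => cconj eta - cconj w) w.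
  by apply: ccontB; [exact: ccont_cst|apply: ccont_conj; exact: ccont_id].
have cDV w : ccont (fun w => (D w)^-1) w.
  apply: (@ccontV R C D w (D0 w)); apply: ccont_creal.
  by apply: rcontD; [exact: ccont_rho|exact: rcont_cst].
have cK w : ccont (fun w => (cconj eta - cconj w) / D w) w by apply: ccontM; [exact: cKc|exact: cDV].
have cS (h : C -> C) w : ccont h w -> ccont (fun w => h w ^+ 2) w.
  by move=> hc; apply: (eq_ccont (fun s => expr2 (h s))); exact: ccontM.
have KE w : K w (cconj w) = (cconj eta - cconj w) / D w by rewrite /K DE.
have crho w : ccont (fun w => creal (rho w * (rho w + eps)^-1)) w.
  by apply: ccont_creal; apply: rcontM; [exact: ccont_rho|exact: rcont_rho_epsV].
have cdel w : ccont (fun w => creal (delta eps w)) w by apply: ccont_creal; exact: rcont_delta.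
pose ga w := va w * ((cconj eta - cconj w) / D w) + f w * ((cconj eta - cconj w) / D w) ^+ 2.
pose g1 w := g w * creal (rho w * (rho w + eps)^-1).
pose g2 w := f w * creal (delta eps w).
have c1 w : cabs w <= 1 -> ccont g1 w by move=> w1; apply: ccontM; [exact: cg|exact: crho].
have c2 w : cabs w <= 1 -> ccont g2 w by move=> w1; apply: ccontM; [exact: cf|exact: cdel].
have c2' w : cabs w <= 1 -> ccont (fun w => (-1) * g2 w) w.
  by move=> w1; apply: ccontM; [exact: ccont_cst|exact: c2].
have cVK w : cabs w <= 1 -> ccont (fun w => V w (cconj w) * K w (cconj w)) w.
  move=> w1; apply: (@eq_ccont _ _ _ (fun w => f w * ((cconj eta - cconj w) / D w))).
    by move=> s; rewrite KE.
  by apply: ccontM; [exact: cf|exact: cK].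
have cga w : cabs w <= 1 -> ccont ga w.
  move=> w1; apply: ccontD; apply: ccontM; [exact: ca|exact: cK|exact: cf|].
  by apply: cS; exact: cK.
have cgb w : cabs w <= 1 -> ccont (fun w => g1 w + (-1) * g2 w) w.
  by move=> w1; apply: ccontD; [exact: c1|exact: c2'].
have VK0 w : cabs w = 1 -> V w (cconj w) * K w (cconj w) = 0.
  by move=> /f0 ->; rewrite mul0r.
have dVK w : cabs w < 1 -> pder (fun a b => V a b * K a b) w (ga w) (g1 w + (-1) * g2 w).
  move=> w1; refine (pder_eq (pderM (dV w1) (dK w)) _ _); rewrite KE /ga /g1 /g2.
    by rewrite expr_div_n.
  have -> : creal (rho w * (rho w + eps)^-1) = (eta - w) * ((cconj eta - cconj w) / D w).
    by rewrite mulrA -cconjB mulCconj crealM crealV.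
  rewrite /delta !crealM crealV crealX -/(D w); by ring.
have [_ E] := dint_wirtinger cVK cga cgb VK0 dVK.
move: E; rewrite (dintD c1 c2') (dintZ _ c2) mulN1r => /eqP; rewrite subr_eq0 => /eqP.
by [].
Qed.

End Step.

Lemma ccont_denV2 w : cabs w <= 1 -> ccont (fun w => den w ^- 2) w.
Proof.
move=> w1; apply: (@eq_ccont _ _ _ (fun w => (den w)^-1 * (den w)^-1)).
  by move=> s; rewrite -exprVn expr2.
by apply: ccontM; exact: ccont_denV.
Qed.

Lemma lam_circle w : cabs w = 1 -> lam w = 0.
Proof. by move=> w1; rewrite /lam w1 expr1n subrr creal0 mul0r. Qed.

(* Applied to [lam], whose real part is nonnegative, the identity bounds the mass of [delta]. *)
Lemma delta_mass : exists2 M : R, 0 <= M & forall eps, 0 < eps ->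
  cabs (dint (fun w => lam w * creal (delta eps w))) <= M.
Proof.
have [M M0 hM] := @disc_bounded R (fun w => den w ^- 2) ccont_denV2.
exists (2 * (M * pi)); first by rewrite !mulr_ge0 ?(ltW M0)// pi_ge0.
move=> eps e0.
have cl w : cabs w <= 1 -> ccont (fun w => lamV w (cconj w)) w.
  by move=> w1; apply: (@eq_ccont _ _ _ lam); [exact: lamVE|exact: ccont_lam].
have ca w : cabs w <= 1 -> ccont (fun w => - cconj w / den w) w.
  move=> w1; apply: ccontM; last exact: ccont_denV.
  by apply: ccontN; apply: ccont_conj; exact: ccont_id.
have f0 w : cabs w = 1 -> lamV w (cconj w) = 0 by rewrite lamVE; exact: lam_circle.
rewrite -(eq_dint (g := fun w => lamV w (cconj w) * creal (delta eps w))); last by move=> w _; rewrite lamVE.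
rewrite -(kernel_step cl ca ccont_denV2 f0 (fun w h => pder_lam (ltW h)) e0).
have r1 w : 0 <= rho w * (rho w + eps)^-1 <= 1.
  have D0 := rho_eps_gt0 w e0; have := rho_ge0 w => r0.
  by rewrite mulr_ge0 ?invr_ge0 ?(ltW D0)//= ler_pdivrMr// mul1r lerDl ltW.
apply: dint_le1.
  move=> w w1; apply: ccontM; first exact: ccont_denV2.
  by apply: ccont_creal; apply: rcontM; [exact: ccont_rho|exact: rcont_rho_epsV].
move=> w w1; have /andP[r0 r2] := r1 w.
rewrite cabsM cabs_creal ger0_norm//.
by apply: le_trans (hM w (ltW w1)); rewrite ler_piMr ?cabs_ge0.
Qed.

Section Zero.
Variables (V : C -> C -> C) (va g : C -> C).
Local Notation f := (fun w => V w (cconj w)).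
Hypothesis cf : forall w, cabs w <= 1 -> ccont f w.
Hypothesis ca : forall w, cabs w <= 1 -> ccont va w.
Hypothesis cg : forall w, cabs w <= 1 -> ccont g w.
Hypothesis f0 : forall w, cabs w = 1 -> f w = 0.
Hypothesis dV : forall w, cabs w < 1 -> pder V w (va w) ((eta - w) * g w).
Hypothesis Veta : V eta (cconj eta) = 0.

(** Split [g] by the weights [rho / (rho + eps)] and [eps / (rho + eps)]. By [kernel_step] the first
    part integrates to that of [f * delta], small because [f] vanishes at [eta]; the second weight
    is [delta * (rho + eps)]. Both are dominated by [delta] times a small multiple of the real part
    of [lam], controlled by [delta_mass], plus a multiple of [delta * rho^2 <= eps]. Polar
    coordinates are avoided in this way. *)
Lemma pompeiu_zero : dint g = 0.
Proof.
have [M M0 hM] := disc_bounded cg.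
have [B B0 hB] := delta_mass.
have cl w : cabs w <= 1 -> rcont (fun w => cre (lam w)) w by move=> /ccont_lam; exact: rcont_re.
have [K K0 hK] : exists2 K : R, 0 <= K & forall w, cabs w <= 1 -> 1 - 2 * cre (lam w) <= K * rho w ^+ 2.
  apply: rho_dominates; last by rewrite lam_eta cre1; lra.
  move=> w w1; apply: rcontB; first exact: rcont_cst.
  by apply: rcontM; [exact: rcont_cst|exact: cl].
suff H e : 0 < e -> cabs (dint g) <= e * (2 * B + 1).
  have B1 : 0 < 2 * B + 1 by lra.
  apply/eqP; rewrite -cabs_eq0 eq_le cabs_ge0 andbT; apply/ler_addgt0Pl => e e0.
  by rewrite addr0; have := H (e / (2 * B + 1)) (divr_gt0 e0 B1); rewrite divfK// gt_eqF.
move=> e0.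
have [N N0 hN] : exists2 N : R, 0 <= N & forall w, cabs w <= 1 ->
    M * rho w + cabs (f w) - e * cre (lam w) <= N * rho w ^+ 2.
  apply: rho_dominates; last by rewrite Veta subrr cabs0 expr0n /= mulr0 addr0 lam_eta cre1 sub0r mulr1 oppr_lt0.
  move=> w w1; apply: rcontB; last by apply: rcontM; [exact: rcont_cst|exact: cl].
  apply: rcontD; last by apply: rcont_cabs; exact: cf.
  by apply: rcontM; [exact: rcont_cst|exact: ccont_rho].
(* [Q] gathers the terms with a factor [eps] in the final estimate:
   [2 (a1 B + 2 pi eps a2) <= 2 e B + eps Q]. The summand 1 keeps it positive. *)
pose Q := 4 * M * B + 4 * pi * (N + M * K) + 1.
have pi0 := pi_ge0 R.
have Q0 : 0 < Q.
  have q1 : 0 <= M * B by rewrite mulr_ge0// ltW.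
  have q2 : 0 <= pi * (N + M * K) by rewrite mulr_ge0// addr_ge0// mulr_ge0// ltW.
  by rewrite /Q -!mulrA; move: q1 q2; move: (M * B) (pi * _) => x y; lra.
pose eps := Num.min 1 (e / Q).
have eps0 : 0 < eps by rewrite /eps lt_min ltr01 divr_gt0.
have eps1 : eps <= 1 by rewrite /eps ge_min lexx.
have epsQ : eps * Q <= e by rewrite -ler_pdivlMr// /eps ge_min lexx orbT.
clearbody eps.
have cdel w : ccont (fun w => creal (delta eps w)) w by apply: ccont_creal; exact: rcont_delta.
have d0 w : 0 <= delta eps w by rewrite divr_ge0 ?sqr_ge0// ltW.
pose s w : C := creal (eps * (rho w + eps)^-1).
have cs w : ccont s w.
  by apply: ccont_creal; apply: rcontM; [exact: rcont_cst|exact: rcont_rho_epsV].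
pose g1 w := g w * creal (rho w * (rho w + eps)^-1).
pose g2 w := f w * creal (delta eps w).
have c1 w : cabs w <= 1 -> ccont g1 w.
  move=> w1; apply: ccontM; first exact: cg.
  by apply: ccont_creal; apply: rcontM; [exact: ccont_rho|exact: rcont_rho_epsV].
have cgs w : cabs w <= 1 -> ccont (fun w => g w * s w) w by move=> w1; apply: ccontM; [exact: cg|exact: cs].
have c2 w : cabs w <= 1 -> ccont g2 w by move=> w1; apply: ccontM; [exact: cf|exact: cdel].
have E : dint g = dint (fun w => g2 w + g w * s w).
  rewrite (dintD c2 cgs) -(kernel_step cf ca cg f0 dV eps0) -(dintD c1 cgs).
  apply: eq_dint => w _; rewrite /g1 /s -mulrDr -crealD -mulrDl divff ?creal1 ?mulr1//.
  by rewrite gt_eqF// rho_eps_gt0.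
pose a1 := e + 2 * M * eps; pose a2 := N + M * eps * K.
pose h1 w := lam w * creal (delta eps w); pose h2 w : C := creal (delta eps w * rho w ^+ 2).
have ch1 w : cabs w <= 1 -> ccont h1 w by move=> w1; apply: ccontM; [exact: ccont_lam|exact: cdel].
have ch2 w : cabs w <= 1 -> ccont h2 w.
  move=> w1; apply: ccont_creal; apply: rcontM; first exact: rcont_delta.
  by apply: rcontX; exact: ccont_rho.
have ch1' w : cabs w <= 1 -> ccont (fun w => creal a1 * h1 w) w.
  by move=> w1; apply: ccontM; [exact: ccont_cst|exact: ch1].
have ch2' w : cabs w <= 1 -> ccont (fun w => creal a2 * h2 w) w.
  by move=> w1; apply: ccontM; [exact: ccont_cst|exact: ch2].
have bound w : cabs w < 1 -> cabs (g2 w + g w * s w) <= cre (creal a1 * h1 w + creal a2 * h2 w).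
  move=> /ltW w1; have D0 := rho_eps_gt0 w eps0.
  have -> : s w = creal (delta eps w) * creal (rho w + eps).
    rewrite -crealM; congr creal; rewrite /delta expr2 invfM -!mulrA mulVf ?mulr1//; by rewrite gt_eqF.
  rewrite /g2 mulrCA [X in X + _]mulrC -mulrDr cabsM cabs_creal ger0_norm//.
  have reE (l : C) (d r : R) : cre (creal a1 * (l * creal d) + creal a2 * creal (d * r)) = d * (a1 * cre l + a2 * r).
    by rewrite !cE; ring.
  rewrite /h1 /h2 reE ler_wpM2l//.
  apply: le_trans (cabsD _ _) _; rewrite cabsM cabs_creal (ger0_norm (ltW D0)).
  have := hM w w1; have := hN w w1; have := hK w w1; have := rho_ge0 w.
  rewrite /a1 /a2; move: (cre (lam w)) (cabs (f w)) (cabs (g w)) (rho w) (cabs_ge0 (g w)) => l F G r G0 r0 k1 k2 k3.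
  have t1 : G * (r + eps) <= M * (r + eps) by rewrite ler_wpM2r// addr_ge0// ltW.
  have t2 : M * eps * (1 - 2 * l) <= M * eps * (K * r ^+ 2) by rewrite ler_wpM2l// mulr_ge0// ltW.
  lra.
rewrite E; apply: le_trans (dint_bound _ _ bound) _.
- by move=> w w1; apply: ccontD; [exact: c2|exact: cgs].
- by move=> w w1; apply: ccontD; [exact: ch1'|exact: ch2'].
have reZ (a : R) (z : C) : cre (creal a * z) = a * cre z by rewrite !cE; ring.
rewrite (dintD ch1' ch2') (dintZ _ ch1) (dintZ _ ch2) creD !reZ.
have b1 : cre (dint h1) <= B by apply: le_trans (ler_norm _) (le_trans (cre_le _) (hB _ eps0)).
have b2 : cre (dint h2) <= 2 * (eps * pi).
  apply: le_trans (ler_norm _) (le_trans (cre_le _) _); apply: dint_le1; first exact: ch2.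
  move=> w _; rewrite cabs_creal ger0_norm; last by rewrite mulr_ge0 ?sqr_ge0.
  rewrite /delta -mulrA (mulrC _^-1).
  rewrite ler_piMr ?(ltW eps0)// ler_pdivrMr ?exprn_gt0 ?rho_eps_gt0// mul1r.
  by rewrite lerXn2r ?nnegrE ?rho_ge0 ?(ltW (rho_eps_gt0 _ _))// lerDl ltW.
have a10 : 0 <= a1 by rewrite addr_ge0 ?(ltW e0)// !mulr_ge0 ?(ltW M0) ?(ltW eps0).
have a20 : 0 <= a2 by rewrite addr_ge0// !mulr_ge0 ?(ltW M0) ?(ltW eps0).
have t1 : a1 * cre (dint h1) <= a1 * B by rewrite ler_wpM2l.
have t2 : a2 * cre (dint h2) <= a2 * (2 * (eps * pi)) by rewrite ler_wpM2l.
have t3 : a2 <= N + M * K.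
  by rewrite lerD2l -mulrA ler_wpM2l ?(ltW M0)// ler_piMl.
have t4 : a2 * (2 * (eps * pi)) <= (N + M * K) * (2 * (eps * pi)).
  by rewrite ler_wpM2r// !mulr_ge0// ltW.
move: epsQ t1 t2 t4; rewrite /Q /a1; move: (cre (dint h1)) (cre (dint h2)) => x y.
move: (N + M * K) (pi : R) => P p h1' h2' h3' h4'.
clearbody a2; clear -eps0 h1' h2' h3' h4'; lra.
Qed.

End Zero.

(* [(1 - b eta)^-2 - 1] is the [a]-derivative of a function that vanishes where [a b = 1]. *)
Lemma dint_denV2 : dint (fun w => den w ^- 2) = creal pi.
Proof.
pose h w : C := (2 * eta - cconj w * eta ^+ 2) / den w ^+ 2.
pose V a b := (a * b - 1) * ((2 * eta - b * eta ^+ 2) * ((1 - b * eta)^-1 * (1 - b * eta)^-1)).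
have VE w : V w (cconj w) = (w * cconj w - 1) * h w by rewrite /V /h -invfM -expr2.
have ch w : cabs w <= 1 -> ccont h w.
  move=> w1; apply: ccontM; last by apply: (eq_ccont _ (ccont_denV2 w1)) => s.
  apply: ccontB; first exact: ccont_cst.
  by apply: ccontM; [apply: ccont_conj; exact: ccont_id|exact: ccont_cst].
have cV w : cabs w <= 1 -> ccont (fun w => V w (cconj w)) w.
  move=> w1; apply: (eq_ccont VE); apply: ccontM; last exact: ch.
  apply: ccontB; last exact: ccont_cst.
  by apply: ccontM; [exact: ccont_id|apply: ccont_conj; exact: ccont_id].
pose h1 w : C := (2 * eta - cconj w * eta ^+ 2) * (den w)^-1.
pose va w := den w ^- 2 + (-1).
have cva w : cabs w <= 1 -> ccont va w.
  by move=> w1; apply: ccontD; [exact: ccont_denV2|exact: ccont_cst].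
pose vb w := w * h w + (w * cconj w - 1) * ((- eta ^+ 2) * den w ^- 2 +
  (2 * eta - cconj w * eta ^+ 2) * (2 * eta * den w ^- 2 * (den w)^-1)).
have cvb w : cabs w <= 1 -> ccont vb w.
  move=> w1; have cc : ccont (fun w => cconj w) w by apply: ccont_conj; exact: ccont_id.
  have c2 := ccont_denV2 w1; have cd := ccont_denV w1.
  have ck (k : C) : ccont (fun _ : C => k) w by exact: ccont_cst.
  apply: ccontD; first by apply: ccontM; [exact: ccont_id|exact: ch].
  apply: ccontM; first by apply: ccontB; [apply: ccontM; [exact: ccont_id|exact: cc]|exact: ck].
  apply: ccontD; first by apply: ccontM; [exact: ck|exact: c2].
  apply: ccontM; first by apply: ccontB; [exact: ck|apply: ccontM; [exact: cc|exact: ck]].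
  apply: ccontM; last exact: cd.
  by apply: ccontM; [exact: ck|exact: c2].
have V0 w : cabs w = 1 -> V w (cconj w) = 0.
  by move=> w1; rewrite VE mulCconj w1 expr1n creal1 subrr mul0r.
have dV w : cabs w < 1 -> pder V w (va w) (vb w).
  move=> /ltW w1; have d0 := den_neq0 w1.
  have p1 := pderB (pderM (@pder_fst w) (@pder_snd w)) (@pder_cst 1 w).
  have p2 := pderB (@pder_cst (2 * eta) w) (pderM (@pder_snd w) (@pder_cst (eta ^+ 2) w)).
  have p3 := @pderV (fun _ b => 1 - b * eta) w _ _ d0 (@pder_den w).
  refine (pder_eq (pderM p1 (pderM p2 (pderM p3 p3))) _ _).
    rewrite /va; by field.
  rewrite /vb /h; by field.
have [E _] := dint_wirtinger cV cva cvb V0 dV.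
have c1 (w : C) : cabs w <= 1 -> ccont (fun _ : C => 1 : C) w by move=> _; exact: ccont_cst.
have c1' (w : C) : cabs w <= 1 -> ccont (fun _ : C => -1 * 1 : C) w by move=> _; exact: ccont_cst.
have E2 : dint va = dint (fun w => den w ^- 2) - dint (fun _ : C => 1).
  rewrite -[X in _ = _ + X]mulN1r -(dintZ _ c1) -(dintD ccont_denV2 c1').
  by apply: eq_dint => w _; rewrite mulr1.
by move: E2; rewrite E dint1 => /esym/eqP; rewrite subr_eq0 => /eqP.
Qed.

Section Formula.
Variables (V : C -> C -> C) (va g : C -> C).
Local Notation f := (fun w => V w (cconj w)).
Hypothesis cf : forall w, cabs w <= 1 -> ccont f w.
Hypothesis ca : forall w, cabs w <= 1 -> ccont va w.
Hypothesis cg : forall w, cabs w <= 1 -> ccont g w.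
Hypothesis f0 : forall w, cabs w = 1 -> f w = 0.
Hypothesis dV : forall w, cabs w < 1 -> pder V w (va w) ((eta - w) * g w).

(** Subtract [V(eta) * lam]: it equals [V(eta)] at [eta], vanishes on the circle, and its
    [conj w]-derivative is [(eta - w)] times [V(eta) * den^-2], whose integral is [pi V(eta)] by
    [dint_denV2]. The difference falls under [pompeiu_zero]. *)
Lemma pompeiu : dint g = creal pi * V eta (cconj eta).
Proof.
pose v0 := V eta (cconj eta).
have ck (k : C) (w : C) : ccont (fun _ : C => k) w by exact: ccont_cst.
have cgl w : cabs w <= 1 -> ccont (fun w => (- v0) * den w ^- 2) w.
  by move=> w1; apply: ccontM; [exact: ck|exact: ccont_denV2].
have : dint (fun w => g w + (- v0) * den w ^- 2) = 0.
  apply: (@pompeiu_zero (fun a b => V a b + (- v0) * lamV a b) (fun w => va w + (- v0) * (- cconj w / den w))).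
  - move=> w w1; apply: ccontD; first exact: cf.
    apply: ccontM; first exact: ck.
    by apply: (@eq_ccont _ _ _ lam); [exact: lamVE|exact: ccont_lam].
  - move=> w w1; apply: ccontD; first exact: ca.
    apply: ccontM; first exact: ck.
    by apply: ccontM; [apply: ccontN; apply: ccont_conj; exact: ccont_id|exact: ccont_denV].
  - by move=> w w1; apply: ccontD; [exact: cg|exact: cgl].
  - by move=> w w1; rewrite f0// lamVE lam_circle// mulr0 addr0.
  - move=> w w1; refine (pder_eq (pderD (dV w1) (pderM (@pder_cst (- v0) w) (pder_lam (ltW w1)))) _ _); by ring.
  - by rewrite lamVE lam_eta mulr1 subrr.
rewrite (dintD cg cgl) (dintZ _ ccont_denV2) dint_denV2 mulNr => /eqP; rewrite subr_eq0 => /eqP ->.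
exact: mulrC.
Qed.

End Formula.

End Pompeiu.

End CauchyPompeiu.

(** * The kernel of the Hartogs domain *)

Section ScaledCurve.
Variables (R : realType) (n m : nat) (Omega : set 'rV[Cx R]_(n + m)) (alpha : 'I_n -> R).
Local Notation C := (Cx R).
Hypothesis starO : nstar_hartogs Omega.
Hypothesis alpha0 : forall i, 0 < alpha i.
Local Notation U := (U_alpha alpha Omega).
Local Notation Us := (U_alpha_eta alpha Omega).
Local Notation A := (alpha_sum alpha).
Implicit Types (w x : C) (v : 'rV[C]_(n + m + 1)).

Definition cpa x (i : 'I_n) : C := cpow x (alpha i).

Lemma cabs_cpa_cr x w i : cabs (cpa x i) * cr alpha w i = (cabs x ^+ 2) `^ (alpha i / 2) * (1 - cabs w ^+ 2) `^ (alpha i / 2).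
Proof.
congr (_ * _); rewrite cabs_cpow -powR_mulrn ?cabs_ge0// -powRrM.
by congr (_ `^ _); rewrite mulrC divfK.
Qed.

(** Reduces the hypothesis of [U_scale] for the scaling [T_x] to one inequality that is the same for
    all coordinates and all exponents. *)
Lemma cpa_cr_le x w w' i : cabs w < 1 -> cabs w' < 1 -> cabs x ^+ 2 * (1 - cabs w ^+ 2) <= 1 - cabs w' ^+ 2 ->
  cabs (cpa x i) * cr alpha w i <= cr alpha w' i.
Proof.
move=> w1 w1' h; have d0 := disc_gt0 w1; have d0' := disc_gt0 w1'.
rewrite cabs_cpa_cr -powRM ?sqr_ge0 ?(ltW d0)// /cr.
apply: ge0_ler_powR => //; first by rewrite divr_ge0 ?ltW.
  by rewrite nnegrE mulr_ge0 ?sqr_ge0 ?ltW.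
by rewrite nnegrE ltW.
Qed.

Lemma ccont_cpow_ge0 (T : topologicalType) (l : T -> C) t a : 0 < a -> ccont l t ->
  0 < cre (l t) \/ l t = 0 -> ccont (fun s => cpow (l s) a) t.
Proof.
move=> a0 cl hl; apply: (@ccont_compC R T l (fun u => cpow u a) t cl).
by case: hl => [h|->]; [exact: ccont_cpow|exact: ccont_cpow0].
Qed.

Lemma cder_cpow_log (l : C -> C) t dl (a : R) : cder l t dl -> 0 < cre (l t) ->
  cder (fun s => cpow (l s) a) t (creal a * cpow (l t) a * (dl / l t)).
Proof.
move=> hl l0; have n0 := cre_gt0_neq0 l0.
apply: (cder_eq (@cder_comp R l (fun u => cpow u a) _ _ _ hl (cder_cpow a l0))).
have -> : cpow (l t) a = cpow (l t) (a - 1) * l t.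
  by rewrite -[X in _ = _ * X](cpow_1 l0) -cpowD// subrK.
by field.
Qed.

Section Curve.
Variables (f : 'rV[C]_(n + m + 1) -> C) (zeta : 'rV[C]_(n + m)) (r : R).
Hypothesis hf : holomorphic_on U f.

(** The point [(T_x zeta, r w)]: with the continuation [f] and the radius [r] of [kernel_extension],
    [F(T_x zeta, w)] is [f (curve x w)] as long as the argument of [F] lies in [U]. *)
Definition curve x w : 'rV[C]_(n + m + 1) := app_last (scl (cn (cpa x)) zeta) (creal r * w).

(** The weighted Euler operator generating [x^(1 + A) f (T_x)]; it is the operator in the brackets
    of [D_op], with the multiples of the identity collected. *)
Definition euler_op v : C := creal (1 + A) * f v + \sum_i creal (alpha i) *
  (v 0 (lshift 1 (lshift m i)) * 'D_(evec R (lshift 1 (lshift m i))) f v).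

Local Notation dlast v := ('D_(evec R (rshift (n + m) ord0)) f v).

Lemma curveE x w : [/\ forall i, curve x w 0 (lshift 1 (lshift m i)) = cpow x (alpha i) * zeta 0 (lshift m i),
  forall k, curve x w 0 (lshift 1 (rshift n k)) = zeta 0 (rshift n k) &
  curve x w 0 (rshift (n + m) ord0) = creal r * w].
Proof.
split=> [i|k|]; rewrite /curve ?app_last_last// app_lastE sclE ?cnl//.
by rewrite cnr mul1r.
Qed.

(** Both arguments of [curve] move, so that one computation serves the Wirtinger derivatives, with
    [l = lam], and the radial derivative, with [a] constant. One factor of [x^(1 + A)] is consumed
    by the logarithmic derivative of the powers, leaving [x^A]. *)
Lemma cder_curve (l a : C -> C) t dl da : cder l t dl -> cder a t da -> 0 < cre (l t) ->
  U (curve (l t) (a t)) ->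
  cder (fun s => cpow (l s) (1 + A) * f (curve (l s) (a s))) t
    (cpow (l t) A * dl * euler_op (curve (l t) (a t)) +
     cpow (l t) (1 + A) * (dlast (curve (l t) (a t)) * (creal r * da))).
Proof.
move=> hl ha l0 UZ; have n0 := cre_gt0_neq0 l0.
pose dP (j : 'I_(n + m + 1)) : C := match fintype.split j with
  | inl k => match fintype.split k with
     | inl i => creal (alpha i) * cpow (l t) (alpha i) * (dl / l t) * zeta 0 k | inr _ => 0 end
  | inr _ => creal r * da end.
have dPl i : dP (lshift 1 (lshift m i)) = creal (alpha i) * cpow (l t) (alpha i) * (dl / l t) * zeta 0 (lshift m i).
  by rewrite /dP (unsplitK (inl (lshift m i) : 'I_(n+m) + 'I_1)) (unsplitK (inl i : 'I_n + 'I_m)).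
have dPr k : dP (lshift 1 (rshift n k)) = 0.
  by rewrite /dP (unsplitK (inl (rshift n k) : 'I_(n+m) + 'I_1)) (unsplitK (inr k : 'I_n + 'I_m)).
have dPw : dP (rshift (n + m) ord0) = creal r * da.
  by rewrite /dP (unsplitK (inr ord0 : 'I_(n+m) + 'I_1)).
have hc : forall j, cder (fun s => curve (l s) (a s) 0 j) t (dP j).
  move=> j; case: (split_ordP j) => [k ->|k ->]; last first.
    rewrite (ord1 k) dPw (_ : (fun s => _) = fun s => creal r * a s); first exact: cderZ.
    by apply/funext => s; have [_ _ ->] := curveE (l s) (a s).
  case: (split_ordP k) => [i ->|i ->].
    rewrite dPl (_ : (fun s => _) = fun s => cpow (l s) (alpha i) * zeta 0 (lshift m i)).
      by apply: (cder_eq (cderM (cder_cpow_log (alpha i) hl l0) (cder_cst _ _))); ring.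
    by apply/funext => s; have [-> _ _] := curveE (l s) (a s).
  rewrite dPr (_ : (fun s => _) = fun=> zeta 0 (rshift n i)); first exact: cder_cst.
  by apply/funext => s; have [_ -> _] := curveE (l s) (a s).
have h1 := @holo_chain R (n + m + 1) U f (fun s => curve (l s) (a s)) t dP hf UZ hc.
have h2 := cder_cpow_log (1 + A) hl l0.
apply: (cder_eq (cderM h2 h1)).
rewrite big_split_ord /= big_ord1 dPw big_split_ord /= [X in _ + X + _]big1 ?addr0; last first.
  by move=> i _; rewrite dPr mulr0.
rewrite /euler_op; set v := curve _ _.
have -> : cpow (l t) (1 + A) = cpow (l t) A * l t.
  by rewrite addrC cpowD// cpow_1.
rewrite mulrDr [in RHS]mulrDr addrA; congr (_ + _).
congr (_ + _); first by field.
rewrite !mulr_sumr; apply: eq_bigr => i _; rewrite dPl.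
have [-> _ _] := curveE (l t) (a t); by field.
Qed.

Lemma ccont_curve (T : topologicalType) (l a : T -> C) (h : 'rV[C]_(n + m + 1) -> C) t :
  ccont l t -> ccont a t -> 0 < cre (l t) \/ l t = 0 -> ccont h (curve (l t) (a t)) ->
  ccont (fun s => h (curve (l s) (a s))) t.
Proof.
move=> cl ca hl ch; apply: (@ccont_comp_rV R _ T (fun s => curve (l s) (a s)) h t _ ch) => j.
case: (split_ordP j) => [k ->|k ->]; last first.
  apply: (@eq_ccont _ _ _ (fun s => creal r * a s)).
    by move=> s; rewrite (ord1 k); have [_ _ ->] := curveE (l s) (a s).
  by apply: ccontM; [exact: ccont_cst|exact: ca].
case: (split_ordP k) => [i ->|i ->].
  apply: (@eq_ccont _ _ _ (fun s => cpow (l s) (alpha i) * zeta 0 (lshift m i))).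
    by move=> s; have [-> _ _] := curveE (l s) (a s).
  by apply: ccontM; [exact: ccont_cpow_ge0|exact: ccont_cst].
apply: (@eq_ccont _ _ _ (fun=> zeta 0 (rshift n i))); last exact: ccont_cst.
by move=> s; have [_ -> _] := curveE (l s) (a s).
Qed.

Lemma ccont_euler_op v : U v -> ccont euler_op v.
Proof.
move=> Uv; apply: ccontD; first by apply: ccontM; [exact: ccont_cst|exact: (holo_cont hf Uv)].
apply: ccont_sum => i _; apply: ccontM; first exact: ccont_cst.
by apply: ccontM; [exact: ccont_coord|exact: (@ccont_partial R (n + m + 1) U f (lshift 1 (lshift m i)) v hf Uv)].
Qed.

End Curve.
End ScaledCurve.

(** * The integral representation of the kernel and its radial derivative *)

Section KernelIntegral.
Variables (R : realType) (n m : nat) (Omega : set 'rV[Cx R]_(n + m)) (alpha : 'I_n -> R).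
Local Notation C := (Cx R).
Hypothesis n1 : (1 <= n)%N.
Hypothesis starO : nstar_hartogs Omega.
Hypothesis alpha0 : forall i, 0 < alpha i.
Local Notation U := (U_alpha alpha Omega).
Local Notation Us := (U_alpha_eta alpha Omega).
Local Notation A := (alpha_sum alpha).
Implicit Types (w x : C) (v : 'rV[C]_(n + m + 1)).

Lemma alpha_sum_gt0 : 0 < A.
Proof.
have i0 : 'I_n := Ordinal n1.
rewrite /alpha_sum (bigD1 i0)//= ltr_pwDl// sumr_ge0// => i _; exact: ltW.
Qed.

(** The identity behind the pseudo-hyperbolic distance. Through [den_ge] it yields both contraction
    estimates, [lam_le] and [mobius_le]. *)
Lemma cabs_den (w e : C) : cabs (1 - cconj w * e) ^+ 2 = (1 - cabs w ^+ 2) * (1 - cabs e ^+ 2) + cabs (w - e) ^+ 2.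
Proof. by rewrite !sqr_cabs !cE; ring. Qed.

Lemma den_ge (w e : C) : (1 - cabs w ^+ 2) * (1 - cabs e ^+ 2) <= cabs (1 - cconj w * e) ^+ 2.
Proof. by rewrite cabs_den lerDl sqr_ge0. Qed.

Lemma wof_le1 w : cabs w <= 1 -> 0 <= 1 - cabs w ^+ 2.
Proof. by move=> w1; rewrite subr_ge0 expr_le1 ?cabs_ge0. Qed.

Lemma lam_le (e w : C) : cabs e < 1 -> cabs w <= 1 -> cabs (lam e w) ^+ 2 * (1 - cabs e ^+ 2) <= 1 - cabs w ^+ 2.
Proof.
move=> e1 w1; have d0 := wof_le1 w1; have n0 := den_neq0 e1 w1.
rewrite /lam cabsM cabs_creal (ger0_norm d0) cabsV exprMn exprVn -mulrA [X in _ * X]mulrC.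
have p0 : 0 < cabs (1 - cconj w * e) ^+ 2 by rewrite exprn_gt0// cabs_gt0.
rewrite mulrA ler_pdivrMr// expr2 -mulrA ler_wpM2l//; exact: den_ge.
Qed.

(* Since [U] is stable under [w |-> r w], the kernel continues holomorphically across [|w| = 1]. *)
Lemma kernel_extension (KU : 'rV[C]_(n + m + 1) -> 'rV[C]_(n + m + 1) -> C) p :
  is_bergman_kernel U KU -> U p ->
  exists (r : R) (f : 'rV[C]_(n + m + 1) -> C), [/\ 0 < r, r < 1, holomorphic_on U f &
    forall v, U v -> KU v p = f (app_last (lsubmx v) (creal r * wof v))].
Proof.
move=> hKU Up; have oU := kernel_open hKU Up.
have /nbhs_rVP[e e0 he] : nbhs p U by exact: open_nbhs_nbhs.
(* Openness of [U] at [p] leaves room to enlarge the last coordinate by the factor [1 + e / 2],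
   giving [t]. Then [p] is a contraction of [t], and [kernel_contract] shifts the factor [r] to the
   other argument of the kernel. *)
pose r := (1 + e / 2)^-1; have s0 : 1 < 1 + e / 2 by rewrite ltrDl divr_gt0.
have s1 : 0 < 1 + e / 2 by apply: lt_trans s0.
have r0 : 0 < r by rewrite invr_gt0.
have r1 : r < 1 by rewrite invf_lt1.
pose t := app_last (lsubmx p) (creal (1 + e / 2) * wof p).
have p1 : cabs (wof p) < 1 by rewrite -(app_eta p) in Up; rewrite (U_cabs Up).
have Ut : U t.
  apply: he => k; have -> : p 0 k = app_last (lsubmx p) (wof p) 0 k by rewrite app_eta.
  rewrite /t; case: (split_ordP k) => j ->.
    by rewrite !app_lastE subrr cabs0.
  rewrite !app_last_last crealD creal1 mulrDl mul1r addrC addKr cabsM cabs_creal gtr0_norm ?divr_gt0//.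
  apply: (@le_lt_trans _ _ (e / 2)); last by lra.
  by rewrite ler_piMr ?divr_ge0 ?ltW.
exists r, (fun v => KU v t); split=> //; first exact: (kernel_holo hKU Ut).
move=> v Uv.
pose c : 'I_(n + m + 1) -> C := cw (fun=> 1) (creal r).
have cn1 (z : 'rV[C]_(n + m)) : scl (cn (fun=> 1)) z = z.
  by rewrite -[RHS]scl1; apply: eq_scl => j; rewrite /cn; case: (fintype.split j).
have pE : p = scl c t.
  rewrite /t /c scl_cw cn1 mulrA -crealM mulVf ?gt_eqF// creal1 mul1r; exact/esym/app_eta.
have vE : app_last (lsubmx v) (creal r * wof v) = scl c v.
  by rewrite -[in RHS](app_eta v) /c scl_cw cn1.
have cc j : cconj (c j) = c j.
  rewrite /c /cw; case: (fintype.split j) => [k|_]; last exact: cconj_creal.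
  by rewrite /cn; case: (fintype.split k) => _; exact: cconj1.
have c1 j : cabs (c j) <= 1.
  rewrite /c /cw; case: (fintype.split j) => [k|_]; last by rewrite cabs_creal gtr0_norm// ltW.
  by rewrite /cn; case: (fintype.split k) => _; rewrite cabs1.
rewrite vE (kernel_contract (star_U starO alpha0) hKU c1 (cw_JU _ _) Uv Ut) (eq_scl _ cc) -pE.
by [].
Qed.

Section Integral.
Variables (F f : 'rV[C]_(n + m + 1) -> C) (r : R) (q : 'rV[C]_(n + m + 1)).
Hypothesis r0 : 0 < r.
Hypothesis r1 : r < 1.
Hypothesis hf : holomorphic_on U f.
Hypothesis Ff : forall v, U v -> F v = f (app_last (lsubmx v) (creal r * wof v)).
Hypothesis Uq : U q.
Local Notation eta := (wof q).
Local Notation zeta := (lsubmx q).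
Local Notation den w := (1 - cconj w * eta).

Lemma Uq_app : U (app_last zeta eta). Proof. by rewrite app_eta. Qed.
Let e1 : cabs eta < 1 := U_cabs Uq_app.

(** As [r < 1], the last coordinate [r w] is strictly inside the disc even for [|w| = 1], so that
    [curve] does not leave [U] on the closed disc. *)
Lemma U_curve x w : cabs w <= 1 -> cabs x ^+ 2 * (1 - cabs eta ^+ 2) <= 1 - cabs w ^+ 2 ->
  U (curve alpha zeta r x w).
Proof.
move=> w1 h; have rw : cabs (creal r * w) <= r.
  by rewrite cabsM cabs_creal gtr0_norm// ler_piMr// ltW.
have rw1 := le_lt_trans rw r1.
apply: (U_scale starO Uq_app rw1) => i; apply: (cpa_cr_le alpha0 i e1 rw1).
apply: le_trans h _; rewrite lerD2l lerN2 ler_pXn2r ?nnegrE ?cabs_ge0//.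
by rewrite cabsM cabs_creal gtr0_norm// ler_piMl ?cabs_ge0// ltW.
Qed.

Lemma U_curve_lam w : cabs w <= 1 -> U (curve alpha zeta r (lam eta w) w).
Proof. by move=> w1; apply: U_curve => //; exact: lam_le. Qed.

Lemma lam_cases w : cabs w <= 1 -> 0 < cre (lam eta w) \/ lam eta w = 0.
Proof.
rewrite le_eqVlt => /predU1P[w1|w1]; first by right; exact: lam_circle.
by left; exact: cre_lam_gt0.
Qed.

Lemma curve_q : F q = f (curve alpha zeta r 1 eta).
Proof.
rewrite (Ff Uq) /curve; congr (f (app_last _ _)); rewrite -[LHS]scl1.
by apply: eq_scl => j; rewrite /cn; case: (fintype.split j) => // i; rewrite /cpa cpow1.
Qed.

(** The quotient of the [conj w]-derivative of [v] by [eta - w], in a form where the factor supplied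
    by the derivative of [lam] has been cancelled. *)
Definition wirtinger_density w : C := den w ^- 2 * (cpow (lam eta w) A * euler_op alpha f (curve alpha zeta r (lam eta w) w)).

Let cld w : cabs w <= 1 -> ccont (lam eta) w. Proof. exact: ccont_lam e1 _. Qed.

Lemma ccont_along (h : 'rV[C]_(n + m + 1) -> C) w : cabs w <= 1 -> ccont h (curve alpha zeta r (lam eta w) w) ->
  ccont (fun w => h (curve alpha zeta r (lam eta w) w)) w.
Proof.
move=> w1; exact: (@ccont_curve R n m alpha alpha0 zeta r C (lam eta) id h w (cld w1) (@ccont_id R w) (lam_cases w1)).
Qed.

Lemma ccont_density w : cabs w <= 1 -> ccont wirtinger_density w.
Proof.
move=> w1; apply: ccontM; first exact: (ccont_denV2 e1 w1).
apply: ccontM; first exact: (ccont_cpow_ge0 alpha_sum_gt0 (cld w1) (lam_cases w1)).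
exact: (@ccont_along (euler_op alpha f) w w1 (ccont_euler_op hf (U_curve_lam w1))).
Qed.

Lemma dint_density : dint wirtinger_density = creal pi * F q.
Proof.
have A1 : 0 < 1 + A by rewrite addr_gt0// alpha_sum_gt0.
(* [b] enters only through [lamV], because the last coordinate of [curve] is the holomorphic [r a];
   the [b]-derivative is therefore that of [lamV] times the Euler term. *)
pose V a b := cpow (lamV eta a b) (1 + A) * f (curve alpha zeta r (lamV eta a b) a).
pose dw v := 'D_(evec R (rshift (n + m) ord0)) f v.
pose va w := cpow (lam eta w) A * (- cconj w / den w) * euler_op alpha f (curve alpha zeta r (lam eta w) w) +
  cpow (lam eta w) (1 + A) * (dw (curve alpha zeta r (lam eta w) w) * (creal r * 1)).
have VE w : V w (cconj w) = cpow (lam eta w) (1 + A) * f (curve alpha zeta r (lam eta w) w) by rewrite /V lamVE.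
have cf w : cabs w <= 1 -> ccont (fun w => V w (cconj w)) w.
  move=> w1; apply: (eq_ccont VE); apply: ccontM.
    exact: (ccont_cpow_ge0 A1 (cld w1) (lam_cases w1)).
  exact: (@ccont_along f w w1 (holo_cont hf (U_curve_lam w1))).
have ca w : cabs w <= 1 -> ccont va w.
  move=> w1; apply: ccontD.
    apply: ccontM; last exact: (@ccont_along (euler_op alpha f) w w1 (ccont_euler_op hf (U_curve_lam w1))).
    apply: ccontM; first exact: (ccont_cpow_ge0 alpha_sum_gt0 (cld w1) (lam_cases w1)).
    by apply: ccontM; [apply: ccontN; apply: ccont_conj; exact: ccont_id|exact: (ccont_denV e1 w1)].
  apply: ccontM; first exact: (ccont_cpow_ge0 A1 (cld w1) (lam_cases w1)).
  apply: ccontM; last exact: ccont_cst.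
  apply: (@ccont_along dw w w1).
  exact: (@ccont_partial R (n + m + 1) U f (rshift (n + m) ord0) _ hf (U_curve_lam w1)).
have f0 w : cabs w = 1 -> V w (cconj w) = 0.
  by move=> w1; rewrite VE (lam_circle _ w1) cpow0 ?mul0r// gt_eqF.
have dV w : cabs w < 1 -> pder V w (va w) ((eta - w) * wirtinger_density w).
  move=> w1 a b t da db ha hb ea eb; have w1' := ltW w1.
  have hl := pder_lam e1 w1' ha hb ea eb.
  have lt : lamV eta (a t) (b t) = lam eta w by rewrite ea eb lamVE.
  have l0 : 0 < cre (lamV eta (a t) (b t)) by rewrite lt; exact: cre_lam_gt0.
  have UZ : U (curve alpha zeta r (lamV eta (a t) (b t)) (a t)) by rewrite lt ea; exact: U_curve_lam.
  apply: (cder_eq (cder_curve hf hl ha l0 UZ)); rewrite lt ea /va /wirtinger_density /dw.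
  by ring.
by rewrite (pompeiu e1 cf ca ccont_density f0 dV) /V lamVE lam_eta// cpow1 mul1r curve_q.
Qed.

Section Slices.
Variables (KU : 'rV[C]_(n + m + 1) -> 'rV[C]_(n + m + 1) -> C) (Keta : C -> 'rV[C]_(n + m) -> 'rV[C]_(n + m) -> C).
Hypothesis hKU : is_bergman_kernel U KU.
Hypothesis hKeta : forall eta : C, cabs eta < 1 -> is_bergman_kernel (Us eta) (Keta eta).
Variable p : 'rV[C]_(n + m + 1).
Hypothesis Up : U p.
Hypothesis FE : forall v, F v = KU v p.
Local Notation cden w := (1 - w * cconj eta).

Definition mobius w : C := creal (1 - cabs eta ^+ 2) / cden w.

Definition slice_coef w : C := creal ((1 - cabs eta ^+ 2) `^ A) / (creal pi * cpow (cden w) (2 + A)).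

Lemma conj_den w : cconj (den w) = cden w.
Proof. by rewrite cconjB cconj1 cconjM cconjK. Qed.

Lemma cre_cden w : cabs w <= 1 -> 0 < cre (cden w).
Proof. by move=> w1; rewrite -conj_den cre_conj cre_den. Qed.

Lemma cre_invE (z : C) : cre z^-1 = cre z / cabs z ^+ 2.
Proof.
have [->|z0] := eqVneq z 0; first by rewrite invr0 cre0 mul0r.
have -> : z^-1 = creal (cabs z ^+ 2)^-1 * cconj z.
  by rewrite crealV -mulCconj invfM -mulrA mulVf ?mulr1// -cabs_eq0 cabs_conj cabs_eq0.
by rewrite !cE mul0r subr0 mulrC.
Qed.

Lemma cre_mobius w s : 0 < s -> cabs w <= 1 -> 0 < cre (creal s * mobius w).
Proof.
move=> s0 w1; have h := cre_cden w1.
rewrite /mobius mulrA -crealM; have : 0 < s * (1 - cabs eta ^+ 2) by rewrite mulr_gt0 ?disc_gt0.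
move: (_ * _ : R) => a a0; have -> : cre (creal a / cden w) = a * cre (cden w)^-1.
  by move: (_^-1) => z; rewrite !cE mul0r subr0.
by rewrite mulr_gt0// cre_invE divr_gt0// exprn_gt0// cabs_gt0; exact: cre_gt0_neq0.
Qed.

Lemma cder_mobius w : cabs w <= 1 -> exists d, cder mobius w d.
Proof.
move=> w1; have z0 := cre_gt0_neq0 (cre_cden w1).
have h1 : cder (fun w => cden w) w _ := cderB (cder_cst 1 w) (cderM (cder_id w) (cder_cst (cconj eta) w)).
by eexists; exact: (cderZ (creal (1 - cabs eta ^+ 2)) (@cderV R (fun w => cden w) w _ z0 h1)).
Qed.

Lemma cder_coef w : cabs w <= 1 -> exists d, cder slice_coef w d.
Proof.
move=> w1; have z0 := cre_cden w1.
have h1 : cder (fun w => cden w) w _ := cderB (cder_cst 1 w) (cderM (cder_id w) (cder_cst (cconj eta) w)).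
have h2 := @cder_comp R (fun w => cden w) (fun u => cpow u (2 + A)) _ _ _ h1 (cder_cpow (2 + A) z0).
have n0 : creal pi * cpow (cden w) (2 + A) != 0.
  apply: mulf_neq0; first by rewrite creal_eq0 gt_eqF// pi_gt0.
  by apply: cpow_neq0; exact: cre_gt0_neq0.
by eexists; exact: (cderZ (creal ((1 - cabs eta ^+ 2) `^ A))
  (@cderV R (fun w => creal pi * cpow (cden w) (2 + A)) w _ n0 (cderZ (creal pi) h2))).
Qed.

Lemma mobius_le w s : 0 <= s -> s <= 1 -> cabs w < 1 ->
  cabs (creal s * mobius w) ^+ 2 * (1 - cabs w ^+ 2) <= 1 - cabs eta ^+ 2.
Proof.
move=> s0 s1 w1; have d0 := disc_gt0 e1; have dw := disc_gt0 w1.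
have z0 : 0 < cabs (den w) ^+ 2 by rewrite exprn_gt0// cabs_gt0 (den_neq0 e1 (ltW w1)).
rewrite /mobius !cabsM !cabs_creal (ger0_norm s0) (gtr0_norm d0) cabsV -conj_den cabs_conj exprMn.
apply: (@le_trans _ _ (((1 - cabs eta ^+ 2) / cabs (den w)) ^+ 2 * (1 - cabs w ^+ 2))).
  rewrite -mulrA; apply: ler_piMl; last exact: exprn_ile1.
  by apply: mulr_ge0; [exact: sqr_ge0|exact: ltW].
rewrite exprMn exprVn -mulrA [X in _ * X]mulrC mulrA ler_pdivrMr//.
by rewrite expr2 -mulrA ler_wpM2l ?(ltW d0)// mulrC den_ge.
Qed.

(* The integrand of [conj Phi_s(p)]. *)
Definition radial_density (s : R) w : C :=
  creal pi^-1 * (den w ^- 2 * (cpow (lam eta w) A * f (curve alpha zeta r (creal s * lam eta w) w))).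

Lemma scaled_lam_le (s : R) w : 0 <= s -> s <= 1 -> cabs w <= 1 ->
  cabs (creal s * lam eta w) ^+ 2 * (1 - cabs eta ^+ 2) <= 1 - cabs w ^+ 2.
Proof.
move=> s0 s1 w1; have d0 := disc_gt0 e1.
apply: le_trans (lam_le e1 w1); rewrite cabsM cabs_creal (ger0_norm s0) exprMn -mulrA.
apply: ler_piMl; last exact: exprn_ile1.
by apply: mulr_ge0; [exact: sqr_ge0|exact: ltW].
Qed.

Lemma cre_crealM (a : R) (z : C) : cre (creal a * z) = a * cre z.
Proof. by rewrite !cE mul0r subr0. Qed.

Lemma scaled_lam_cases (s : R) w : 0 < s -> cabs w <= 1 ->
  0 < cre (creal s * lam eta w) \/ creal s * lam eta w = 0.
Proof.
move=> s0 /lam_cases[h|->]; last by right; rewrite mulr0.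
by left; rewrite cre_crealM mulr_gt0.
Qed.

Lemma ccont_radial (s : R) w : 0 < s -> s <= 1 -> cabs w <= 1 -> ccont (radial_density s) w.
Proof.
move=> s0 s1 w1; apply: ccontM; first exact: ccont_cst.
apply: ccontM; first exact: (ccont_denV2 e1 w1).
apply: ccontM; first exact: (ccont_cpow_ge0 alpha_sum_gt0 (cld w1) (lam_cases w1)).
have cl : ccont (fun w => creal s * lam eta w) w by apply: ccontM; [exact: ccont_cst|exact: cld].
have Uc := U_curve w1 (scaled_lam_le (ltW s0) s1 w1).
exact: (@ccont_curve R n m alpha alpha0 zeta r C (fun w => creal s * lam eta w) id f w cl (@ccont_id R w)
  (scaled_lam_cases s0 w1) (holo_cont hf Uc)).
Qed.

(** The powers of [tau] are the squared ratios of the denominators of [f_alpha], and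
    [tau w * cconj (mobius w)] is [lam eta w]: this is how the powers in [h_map] become powers of
    [lam]. *)
Definition tau w : R := (1 - cabs w ^+ 2) / (1 - cabs eta ^+ 2).

Lemma tau_gt0 w : cabs w < 1 -> 0 < tau w.
Proof. by move=> /disc_gt0 w1; rewrite divr_gt0// disc_gt0. Qed.

Lemma tauM w a : cabs w < 1 -> (1 - cabs w ^+ 2) `^ a = tau w `^ a * (1 - cabs eta ^+ 2) `^ a.
Proof.
move=> w1; rewrite -powRM ?(ltW (tau_gt0 w1)) ?(ltW (disc_gt0 e1))//.
by rewrite /tau divfK// gt_eqF// disc_gt0.
Qed.

Lemma cr_ratio w i : cabs w < 1 -> (cr alpha w i / cr alpha eta i) ^+ 2 = tau w `^ alpha i.
Proof.
move=> w1; rewrite /cr (tauM _ w1) mulfK; last by rewrite gt_eqF// powR_gt0// disc_gt0.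
by rewrite -powR_mulrn ?powR_ge0// -powRrM divfK.
Qed.

Lemma prod_powR (x : R) (I : Type) (l : seq I) (P : pred I) (a : I -> R) : 0 < x ->
  \prod_(i <- l | P i) x `^ a i = x `^ (\sum_(i <- l | P i) a i).
Proof.
move=> x0; elim/big_rec2: _ => [|i y z _ ->]; first by rewrite powRr0.
by rewrite -powRD//; apply/implyP => _; rewrite gt_eqF.
Qed.

Lemma conj_kappa (s : R) w i : cabs w < 1 ->
  cconj (cpow (creal s * mobius w) (alpha i)) * creal (tau w `^ alpha i) = cpow (creal s * lam eta w) (alpha i).
Proof.
move=> w1; rewrite -cpow_conj mulrC -cpowZ ?tau_gt0//; congr cpow.
rewrite cconjM cconj_creal /mobius cconjM cconj_creal cconjV cconjB cconj1 cconjM cconjK mulrCA; congr (_ * _).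
by rewrite mulrA -crealM /tau divfK// gt_eqF// disc_gt0.
Qed.

(** Explains the coefficient of [D_op]: the Jacobian [tau^A] of the slices turns its part of
    exponent [A] into [lam^A], and the remaining exponent 2 and factor [1 / pi] form the density
    [den^-2 / pi] of total mass 1. *)
Lemma slice_coef_tau w : cabs w < 1 ->
  slice_coef w * creal (tau w `^ A) = cconj (creal pi^-1 * (den w ^- 2 * cpow (lam eta w) A)).
Proof.
move=> w1; have z0 := cre_cden (ltW w1); have n0 := cre_gt0_neq0 z0.
have E1 : cconj (cpow (lam eta w) A) = creal ((1 - cabs w ^+ 2) `^ A) * (cpow (cden w) A)^-1.
  rewrite -cpow_conj -cpowV// -cpowZ ?disc_gt0//; congr cpow.
  by rewrite /lam cconjM cconj_creal cconjV conj_den.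
have E2 : cpow (cden w) (2 + A) = cden w ^+ 2 * cpow (cden w) A.
  by rewrite cpowD// -[2%:R]/(1 + 1 : R) cpowD// cpow_1.
have c0 := cpow_neq0 A n0.
have p0 : creal pi != 0 :> C by rewrite creal_eq0 gt_eqF// pi_gt0.
have E3 : cconj (den w ^- 2) = cden w ^- 2.
  by rewrite -!exprVn expr2 cconjM cconjV conj_den -expr2.
rewrite cconjM (cconjM (den w ^- 2)) E1 E3 cconj_creal /slice_coef E2 (tauM A w1) crealV.
rewrite crealM; move: (cpow (cden w) A) c0 => c c0; move: (cden w) n0 => z n0.
move: (creal pi) p0 (creal (tau w `^ A)) (creal ((1 - cabs eta ^+ 2) `^ A)) => P P0 a b.
by field; rewrite P0 c0 n0.
Qed.

Lemma slice_value (s : R) : 0 < s -> s <= 1 ->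
  slice_coef (wof p) * Keta eta (scl (cn (fun i => cpow (creal s * mobius (wof p)) (alpha i))) (lsubmx p)) zeta =
  cconj (dint (radial_density s)).
Proof.
move=> s0 s1.
have cG w : cabs w <= 1 -> ccont (radial_density s) w by exact: ccont_radial.
rewrite -(dint_conj cG).
apply: (@slice_pairing R n m Omega alpha starO KU Keta hKU hKeta eta zeta
  (fun w i => cpow (creal s * mobius w) (alpha i)) slice_coef Uq_app _ cder_coef _ _ p _ Up).
- move=> w i w1; have [d hd] := cder_mobius w1; eexists.
  exact: (cder_cpow_log (alpha i) (cderZ (creal s) hd) (cre_mobius s0 w1)).
- by move=> w i w1; apply: cpow_neq0; apply: cre_gt0_neq0; exact: cre_mobius.
- by move=> w i w1; apply: (cpa_cr_le alpha0 i w1 e1); exact: mobius_le (ltW s0) s1 w1.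
- by move=> w w1; apply: ccont_conj; exact: cG.
- move=> w w1.
  have Es : scl (cn (fun i => cconj (cpow (creal s * mobius w) (alpha i)) *
      creal ((cr alpha w i / cr alpha eta i) ^+ 2))) zeta = scl (cn (cpa alpha (creal s * lam eta w))) zeta.
    by apply: eq_scl => j; apply: eq_cn => i; rewrite (cr_ratio _ w1) conj_kappa.
  have Ut : U (app_last (scl (cn (cpa alpha (creal s * lam eta w))) zeta) w).
    apply: (U_scale starO Uq_app w1) => i; apply: (cpa_cr_le alpha0 i e1 w1).
    exact: (scaled_lam_le (ltW s0) s1 (ltW w1)).
  rewrite Es -FE (Ff Ut) lsubmx_app wof_app.
  rewrite (eq_bigr (fun i => tau w `^ alpha i)); last by move=> i _; exact: cr_ratio.
  rewrite (prod_powR _ _ _ (tau_gt0 w1)) (slice_coef_tau w1) -cconjM /radial_density.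
  by rewrite -!mulrA.
Qed.

(* The derivative in [x] of [x^(1+A) f(curve x w)]. *)
Definition slope (x w : C) : C := cpow x A * euler_op alpha f (curve alpha zeta r x w).

Lemma ccont_slope (T : topologicalType) (l a : T -> C) t : ccont l t -> ccont a t ->
  0 < cre (l t) \/ l t = 0 -> U (curve alpha zeta r (l t) (a t)) -> ccont (fun s => slope (l s) (a s)) t.
Proof.
move=> cl ca hl Uc; apply: ccontM; first exact: (ccont_cpow_ge0 alpha_sum_gt0 cl hl).
exact: (@ccont_curve R n m alpha alpha0 zeta r T l a (euler_op alpha f) t cl ca hl (ccont_euler_op hf Uc)).
Qed.

(** [slope] is continuous in [(t, w)] up to the circle, where [lam] is 0 and [cpow_0]-type
    continuity is all there is; compactness makes the closeness uniform in [w]. *)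
Lemma slope_unif (e : R) : 0 < e -> exists2 d : R, 0 < d & forall t w, 1 - d < t -> t <= 1 -> cabs w <= 1 ->
  cabs (slope (creal t * lam eta w) w - slope (lam eta w) w) < e.
Proof.
move=> e0.
(* [ret] maps the square [[-1, 1]^2] onto the closed disc, so compactness of the square suffices. *)
pose G (x : R * (R * R)) := slope (creal x.1 * lam eta (ret (mkC x.2.1 x.2.2))) (ret (mkC x.2.1 x.2.2)).
have cG y : ccont G (1, y).
  have cr2 : ccont (fun x : R * (R * R) => ret (mkC x.2.1 x.2.2)) (1, y).
    apply: (@ccont_compC R _ (fun x : R * (R * R) => mkC x.2.1 x.2.2) (@ret R) (1, y)); last exact: ccont_ret.
    apply: (@ccont_comp R _ _ (fun x : R * (R * R) => x.2) (fun z => mkC z.1 z.2) (1, y)); last exact: ccont_mkC.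
    exact: cvg_snd.
  have w1 := cabs_ret (mkC y.1 y.2).
  have cl2 : ccont (fun x : R * (R * R) => creal x.1 * lam eta (ret (mkC x.2.1 x.2.2))) (1, y).
    apply: ccontM; last exact: (@ccont_compC R _ (fun x : R * (R * R) => ret (mkC x.2.1 x.2.2)) (lam eta) (1, y) cr2 (cld w1)).
    by apply: ccont_creal; exact: cvg_fst.
  have h := (@ccont_slope _ (fun x : R * (R * R) => creal x.1 * lam eta (ret (mkC x.2.1 x.2.2)))
    (fun x : R * (R * R) => ret (mkC x.2.1 x.2.2)) (1, y) cl2 cr2).
  rewrite /= creal1 mul1r in h.
  exact: (h (lam_cases w1) (U_curve_lam w1)).
have cK : compact (`[(-1 : R), 1]%classic `*` `[(-1 : R), 1]%classic).
  by apply: compact_setX; exact: segment_compact.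
have /compact_near_coveringP cK' := cK.
have H : forall y, (`[(-1 : R), 1]%classic `*` `[(-1 : R), 1]%classic) y ->
    \forall y' \near y & t \near (1 : R), cabs (G (t, y') - G (1, y')) < e.
  move=> y _; have /ccontP/(_ (e / 2) ltac:(lra)) := cG y.
  move=> [[P Q] /= [nP nQ] PQ]; exists (Q, P); first by split.
  move=> [y' t] [/= Qy Pt].
  have h1 := PQ (t, y') (conj Pt Qy); have h2 := PQ (1, y') (conj (nbhs_singleton nP) Qy).
  have E (a b c : C) : a - b = (a - c) - (b - c) by ring.
  rewrite (E _ _ (G (1, y))) [e]splitr; apply: le_lt_trans (cabsB _ _) _.
  exact: ltrD h1 h2.
have N := cK' R (nbhs (1 : R)) (fun t y => cabs (G (t, y) - G (1, y)) < e).
have [d /= d0 hd] := proj1 (nbhs_ballP (1 : R) _) (N _ H).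
exists d; first exact: d0.
move=> t w td t1 w1.
have := hd t _ (cre w, cim w) _; rewrite /G /= mkC_eta (ret_id w1) creal1 mul1r; apply.
  by rewrite /ball /= ger0_norm ?subr_ge0//; lra.
have := le_trans (cre_le w) w1; have := le_trans (cim_le w) w1; rewrite !ler_norml => h1 h2.
by split => /=; rewrite in_itv.
Qed.

(** Differentiation under the integral at [s = 1] from below, in quantitative form. The candidate
    derivative of the integrand is [wirtinger_density / pi], whose integral is [F q] by
    [dint_density]. *)
Lemma radial_diff (e : R) : 0 < e -> exists2 d : R, 0 < d & forall s, 0 < s -> 1 - d < s -> s < 1 ->
  cabs (creal (s `^ (1 + A)) * dint (radial_density s) - dint (radial_density 1) - creal (s - 1) * F q) <= e * (1 - s).
Proof.
move=> e0.
have [M M0 hM] := @disc_bounded R (fun w => den w ^- 2) (ccont_denV2 e1).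
(* One factor 2 comes from [mvt_bound], another from [dint_le1], and [M] bounds [den^-2]. *)
have e'0 : 0 < e / (4 * M) by rewrite divr_gt0// mulr_gt0.
have [d d0 hd] := slope_unif e'0; move: e'0 hd; set e' := e / _ => e'0 hd.
exists d => // s s0 sd s1.
have pi0 := pi_gt0 R; have pn0 : creal pi != 0 :> C by rewrite creal_eq0 gt_eqF.
have cs w : cabs w <= 1 -> ccont (radial_density s) w by move=> w1; apply: ccont_radial => //; exact: ltW.
have c1 w : cabs w <= 1 -> ccont (radial_density 1) w by move=> w1; exact: ccont_radial.
have cd := ccont_density.
pose Delta w := creal (s `^ (1 + A)) * radial_density s w + (-1) * radial_density 1 w +
  (- (creal (s - 1) * creal pi^-1)) * wirtinger_density w.
have ck (k : C) (w : C) : ccont (fun _ : C => k) w by exact: ccont_cst.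
have cs' w : cabs w <= 1 -> ccont (fun w => creal (s `^ (1 + A)) * radial_density s w) w.
  by move=> w1; apply: ccontM; [exact: ck|exact: cs].
have c1' w : cabs w <= 1 -> ccont (fun w => (-1) * radial_density 1 w) w.
  by move=> w1; apply: ccontM; [exact: ck|exact: c1].
have cd' w : cabs w <= 1 -> ccont (fun w => (- (creal (s - 1) * creal pi^-1)) * wirtinger_density w) w.
  by move=> w1; apply: ccontM; [exact: ck|exact: cd].
have csc w : cabs w <= 1 -> ccont (fun w => creal (s `^ (1 + A)) * radial_density s w + (-1) * radial_density 1 w) w.
  by move=> w1; apply: ccontD; [exact: cs'|exact: c1'].
have cD w : cabs w <= 1 -> ccont Delta w by move=> w1; apply: ccontD; [exact: csc|exact: cd'].
rewrite (_ : _ - _ = dint Delta); last first.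
  rewrite (dintD csc cd') (dintD cs' c1') (dintZ _ cs) (dintZ _ c1) (dintZ _ cd) dint_density.
  have pn : pi != 0 :> R by rewrite gt_eqF.
  by rewrite (mulNr (creal (s - 1) * _)) -(mulrA (creal (s - 1))) (mulrA (creal pi^-1)) -crealM (mulVf pn) creal1 mul1r mulN1r.
have B w : cabs w < 1 -> cabs (Delta w) <= pi^-1 * (M * (2 * (e' * (1 - s)))).
  move=> w1; have l0 := cre_lam_gt0 e1 w1; have n0 := cre_gt0_neq0 l0.
  pose l := lam eta w; pose u x := cpow x (1 + A) * f (curve alpha zeta r x w).
  (* Since [lam^A = lam^(1 + A) / lam], the difference is a Taylor remainder of [u] between [lam]
     and [s lam]. The division by [lam] is harmless because the increment [(s - 1) lam] contains the
     same factor. *)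
  have -> : Delta w = creal pi^-1 * (den w ^- 2 * (l^-1 * (u (creal s * l) - u l - slope l w * (creal s * l - l)))).
    have dn := den_neq0 e1 (ltW w1).
    rewrite /Delta /radial_density /wirtinger_density /u /slope /l.
    rewrite (cpowZ _ _ s0) creal1 mul1r crealB creal1.
    have -> : cpow (lam eta w) (1 + A) = cpow (lam eta w) A * lam eta w by rewrite addrC cpowD// cpow_1.
    move: (cpow _ A) (creal pi^-1) (creal (s `^ _)) (creal s) (f _) (f _) (euler_op _ _ _) => *.
    by field; rewrite dn n0.
  have step (t : R) : s <= t <= 1 -> cabs (slope (creal t * l) w - slope l w) <= e'.
    by move=> /andP[st t1]; apply/ltW/hd => //; [exact: lt_le_trans sd st|exact: ltW].
  have seg (t : R) : l + creal t * (creal s * l - l) = creal (1 - t * (1 - s)) * l.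
    by rewrite crealB creal1 crealM crealB creal1; ring.
  have tr (t : R) : 0 <= t <= 1 -> s <= 1 - t * (1 - s) <= 1.
    move=> /andP[t0 t1]; have := mulr_ge0 t0 (ltW (ltac:(lra) : 0 < 1 - s)).
    by have := mulr_ge0 (ltac:(lra) : 0 <= 1 - t) (ltW (ltac:(lra) : 0 < 1 - s)); lra.
  have mv := @mvt_bound R u l (creal s * l) (slope l w) (fun x => slope x w) e' _ _.
  have {}mv : cabs (u (creal s * l) - u l - slope l w * (creal s * l - l)) <= 2 * (e' * cabs (creal s * l - l)).
    apply: mv => t /tr/andP[t2 t1]; rewrite seg; last by apply: step; rewrite t2 t1.
    set t' := 1 - _ in t1 t2 *; have t0 : 0 < t' by exact: lt_le_trans s0 t2.
    have lt0 : 0 < cre (creal t' * l) by rewrite cre_crealM mulr_gt0.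
    have Uc := U_curve (ltW w1) (scaled_lam_le (ltW t0) t1 (ltW w1)).
    have := @cder_curve R n m Omega alpha f zeta r hf id (fun=> w) _ _ _ (cder_id (creal t' * l)) (cder_cst w _) lt0 Uc.
    by move=> hh; apply: (cder_eq hh); rewrite /slope; ring.
  rewrite !cabsM cabs_creal gtr0_norm ?invr_gt0// ler_pM2l ?invr_gt0//.
  apply: ler_pM; rewrite ?cabs_ge0 ?mulr_ge0 ?cabs_ge0//; first exact: hM (ltW w1).
  rewrite cabsV ler_pdivrMl ?cabs_gt0//; apply: le_trans mv _.
  rewrite (_ : creal s * l - l = creal (s - 1) * l); last by rewrite crealB creal1; ring.
  rewrite cabsM cabs_creal ltr0_norm; last by lra.
  by rewrite opprB; move: (cabs l) => L; rewrite le_eqVlt; apply/orP; left; apply/eqP; ring.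
apply: le_trans (dint_le1 cD B) _.
rewrite le_eqVlt; apply/orP; left; apply/eqP; rewrite /e'; move: (pi : R) pi0 => P P0; field.
by rewrite !gt_eqF.
Qed.

(** The complex derivative exists by assumption, so its value may be read off along real [s]
    increasing to 1, where [slice_value] and [radial_diff] are available. *)
Lemma slice_derivative d :
  cder (fun s => cpow s (1 + A) * (slice_coef (wof p) *
    Keta eta (scl (cn (fun i => cpow (s * mobius (wof p)) (alpha i))) (lsubmx p)) zeta)) 1 d ->
  d = cconj (F q).
Proof.
move=> [phi [cphi phi1 hphi]].
pose k := cconj (F q).
suff H e : 0 < e -> cabs (d - k) <= e + e.
  apply/eqP; rewrite -subr_eq0 -cabs_eq0 eq_le cabs_ge0 andbT; apply/ler_addgt0Pl => e e0.
  have e20 : 0 < e / 2 by rewrite divr_gt0.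
  have := H _ e20; rewrite -splitr addr0; exact: id.
move=> e0.
have [d1 d10 hd1] := radial_diff e0.
have /ccont_epsP/(_ e e0)[d2 d20 hd2] := cphi.
(* Halving makes [s = 1 - h] positive and strictly within both [d1] and [d2] of 1. *)
pose h := Num.min (Num.min d1 d2) 1 / 2.
have h0 : 0 < h by rewrite divr_gt0// !lt_min d10 d20 ltr01.
have hle : 2 * h <= Num.min (Num.min d1 d2) 1 by rewrite /h mulrC divfK.
have [hd1' hd2' h1'] : [/\ 2 * h <= d1, 2 * h <= d2 & 2 * h <= 1].
  by move: hle; rewrite !le_min => /andP[/andP[-> ->] ->].
clearbody h; pose s := 1 - h; have s0 : 0 < s by rewrite /s; lra.
have s1 : s < 1 by rewrite /s; lra.
have sd : 1 - d1 < s by rewrite /s; lra.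
have D := hd1 s s0 sd s1.
have cps : cpow (creal s) (1 + A) = creal (s `^ (1 + A)).
  by rewrite -[creal s]mulr1 cpowZ// cpow1 mulr1.
have := hphi (creal s); rewrite cps (slice_value s0 (ltW s1)).
have := slice_value ltr01 (lexx 1); rewrite creal1 => ->.
rewrite cpow1 mul1r => E.
have phis : cabs (phi (creal s) - d) < e.
  rewrite -phi1; apply: hd2; rewrite -creal1 -crealB cabs_creal /s.
  by rewrite (_ : 1 - h - 1 = - h); [rewrite normrN gtr0_norm//; lra|ring].
clearbody s.
have E2 : cconj (creal (s `^ (1 + A)) * dint (radial_density s) - dint (radial_density 1) - creal (s - 1) * F q) =
   creal (s - 1) * (phi (creal s) - k).
  rewrite !cconjB !cconjM !cconj_creal E /k crealB creal1; by ring.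
have B : cabs (phi (creal s) - k) <= e.
  move: D; rewrite -cabs_conj E2 cabsM cabs_creal ltr0_norm; last by lra.
  by rewrite opprB mulrC ler_pM2r//; lra.
have -> : d - k = (phi (creal s) - k) - (phi (creal s) - d) by ring.
by apply: le_trans (cabsB _ _) _; apply: lerD; [exact: B|exact: ltW].
Qed.

End Slices.

End Integral.
End KernelIntegral.

(** Since [h] is linear in [z], differentiating the composite by [z_j] and multiplying by [z_j]
    gives the Euler field of [G] at the image point, which is also what scaling [mobius] by [s]
    produces. The factor [s^(1 + A)] accounts for the multiples of the identity. *)
Lemma Dop_slice (R : realType) (n m : nat) (Omega : set 'rV[Cx R]_(n + m)) (alpha : 'I_n -> R)
    (G : 'rV[Cx R]_(n + m) -> Cx R) (p q : 'rV[Cx R]_(n + m + 1)) :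
  let z := scl (cn (cpa alpha (mobius q (wof p)))) (lsubmx p) in
  holomorphic_on (U_alpha_eta alpha Omega (wof q)) G -> U_alpha_eta alpha Omega (wof q) z ->
  0 < cre (mobius q (wof p)) ->
  cder (fun s => cpow s (1 + alpha_sum alpha) * (slice_coef alpha q (wof p) *
    G (scl (cn (fun i => cpow (s * mobius q (wof p)) (alpha i))) (lsubmx p)))) 1
   (D_op alpha (wof q) (fun r => G (row_mx (h_map alpha (zof r) (wof r) (wof q)) (z'of r))) p).
Proof.
move=> z hG Uz m0; set mob := mobius q (wof p) in z Uz m0 *; set c := slice_coef alpha q (wof p).
pose dG i := 'D_(evec R (lshift m i)) G z.
have rowE (v : 'rV[Cx R]_(n + m + 1)) : row_mx (h_map alpha (zof v) (wof v) (wof q)) (z'of v) =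
    scl (cn (cpa alpha (mobius q (wof v)))) (lsubmx v).
  rewrite scl_cn_row; congr row_mx; apply/rowP => i; rewrite !mxE mulrC.
  by [].
have Fp : G (row_mx (h_map alpha (zof p) (wof p) (wof q)) (z'of p)) = G z by rewrite rowE.
have hDF j : 'D_(zdir R m j) (fun r => G (row_mx (h_map alpha (zof r) (wof r) (wof q)) (z'of r))) p =
   dG j * cpow mob (alpha j).
  apply: (proj2 (proj1 (derive_cder _ _ _ _) _)).
  pose v t := upd p (lshift 1 (lshift m j)) t.
  have wv t : wof (v t) = wof p.
    by rewrite /wof !mxE eq_rlshift.
  have vE t k : v t 0 (lshift 1 k) = if k == lshift m j then t else lsubmx p 0 k.
    by rewrite !mxE (inj_eq (@lshift_inj _ _)).
  pose P t := scl (cn (cpa alpha mob)) (lsubmx (v t)).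
  pose dP k : Cx R := if k == lshift m j then cpow mob (alpha j) else 0.
  have v0 : v (p 0 (lshift 1 (lshift m j))) = p by exact: upd_id.
  have UP : U_alpha_eta alpha Omega (wof q) (P (p 0 (lshift 1 (lshift m j)))) by rewrite /P v0.
  have hP k : cder (fun t => P t 0 k) (p 0 (lshift 1 (lshift m j))) (dP k).
    have -> : (fun t => P t 0 k) = (fun t => cn (cpa alpha mob) k * (if k == lshift m j then t else lsubmx p 0 k)).
      by apply/funext => t; rewrite sclE mxE vE.
    rewrite /dP; case: ifP => [/eqP ->|_]; last by apply: (cder_eq (cder_cst _ _)).
    by rewrite cnl; apply: (cder_eq (cderZ _ (cder_id _))); rewrite mulr1.
  have := @holo_chain R _ _ G P _ dP hG UP hP.
  have -> : (fun t => G (P t)) = (fun t => G (row_mx (h_map alpha (zof (v t)) (wof (v t)) (wof q)) (z'of (v t)))).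
    by apply/funext => t; rewrite rowE wv.
  move=> H; apply: (cder_eq H); rewrite (bigD1 (lshift m j))//= big1 ?addr0.
    by rewrite /dP eqxx /P v0.
  by move=> k /negPf kj; rewrite /dP kj mulr0.
pose P s := scl (cn (fun i => cpow (s * mob) (alpha i))) (lsubmx p).
have P1 : P 1 = z by rewrite /P mul1r.
pose dP k : Cx R := match fintype.split k with
  | inl i => creal (alpha i) * cpow mob (alpha i) * lsubmx p 0 k | inr _ => 0 end.
have hl : cder (fun s => s * mob) 1 mob.
  by apply: (cder_eq (cderM (cder_id 1) (cder_cst mob 1))); ring.
have l0 : 0 < cre (1 * mob) by rewrite mul1r.
have n0 := cre_gt0_neq0 m0.
have hP k : cder (fun s => P s 0 k) 1 (dP k).
  have -> : (fun s => P s 0 k) = (fun s => cn (fun i => cpow (s * mob) (alpha i)) k * lsubmx p 0 k).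
    by apply/funext => s; rewrite sclE.
  rewrite /dP /cn; case: (fintype.split k) => [i|_]; last first.
    by apply: (cder_eq (cder_cst _ _)).
  apply: (cder_eq (cderM (cder_cpow_log (alpha i) hl l0) (cder_cst _ _))).
  by rewrite mul1r; field.
have UP : U_alpha_eta alpha Omega (wof q) (P 1) by rewrite P1.
have h1 := @holo_chain R _ _ G P 1 dP hG UP hP.
have h2 := cder_cpow_log (1 + alpha_sum alpha) (cder_id 1) (ltac:(by rewrite cre1 ltr01) : 0 < cre (1 : Cx R)).
apply: (cder_eq (cderM h2 (cderZ c h1))).
rewrite cpow1 /D_op Fp -/(slice_coef alpha q (wof p)) -/c P1.
rewrite divr1 !mulr1 mul1r mulrCA -mulrDr; congr (_ * _).
rewrite big_split_ord /= [X in _ + (_ + X)]big1 ?addr0; last first.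
  by move=> k _; rewrite /dP (unsplitK (inr k : 'I_n + 'I_m)) mulr0.
rewrite crealD creal1 mulrDl mul1r -addrA; congr (_ + _).
have -> : creal (alpha_sum alpha) = \sum_(j < n) creal (alpha j) :> Cx R.
  by rewrite /alpha_sum; apply: (big_morph (@creal R)); [exact: crealD|exact: creal0].
rewrite mulr_suml -big_split /=; apply: eq_bigr => i _.
rewrite hDF mulrDr; congr (_ + _).
rewrite /dP (unsplitK (inl i : 'I_n + 'I_m)) /zof !mxE /dG; by ring.
Qed.

Theorem theorem1 (R : realType) (n m : nat)
  (Omega : set 'rV[Cx R]_(n + m)) (alpha : 'I_n -> R)
  (KU : 'rV[Cx R]_(n + m + 1) -> 'rV[Cx R]_(n + m + 1) -> Cx R)
  (Keta : Cx R -> 'rV[Cx R]_(n + m) -> 'rV[Cx R]_(n + m) -> Cx R) :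
  (1 <= n)%N ->
  is_domain Omega ->
  nstar_hartogs Omega ->
  (forall j, 0 < alpha j) ->
  is_bergman_kernel (U_alpha alpha Omega) KU ->
  (forall eta : Cx R, cabs eta < 1 ->
     is_bergman_kernel (U_alpha_eta alpha Omega eta) (Keta eta)) ->
  forall p q : 'rV[Cx R]_(n + m + 1),
    U_alpha alpha Omega p -> U_alpha alpha Omega q ->
    KU p q =
    D_op alpha (wof q)
      (fun r => Keta (wof q)
                  (row_mx (h_map alpha (zof r) (wof r) (wof q)) (z'of r))
                  (lsubmx q))
      p.
Proof.
move=> n1 dO starO alpha0 hKU hKeta p q Up Uq.
have [r [f [r0 r1 hf Ff]]] := kernel_extension starO alpha0 hKU Up.
have Uq' : U_alpha_eta alpha Omega (wof q) (lsubmx q) by rewrite UsE app_eta.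
have e1 := U_cabs Uq'.
have Up' : U_alpha alpha Omega (app_last (lsubmx p) (wof p)) by rewrite app_eta.
have w1 := U_cabs Up'.
have m0 : 0 < cre (mobius q (wof p)).
  by have := cre_mobius Uq ltr01 (ltW w1); rewrite creal1 mul1r.
have Uz : U_alpha_eta alpha Omega (wof q) (scl (cn (cpa alpha (mobius q (wof p)))) (lsubmx p)).
  apply: (U_scale starO Up' e1) => i; apply: (cpa_cr_le alpha0 i w1 e1).
  by have := mobius_le Uq ler01 (lexx 1) w1; rewrite creal1 mul1r.
have hG := kernel_holo (hKeta _ e1) Uq'.
(* [D] says that the right-hand side is the derivative at [s = 1]; [slice_derivative] evaluates that
   derivative to the conjugate of [KU q p], which is [KU p q] by hermitian symmetry. *)
have D := Dop_slice hG Uz m0.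
rewrite (kernel_herm hKU Up Uq); apply/esym.
exact: (slice_derivative n1 starO alpha0 r0 r1 hf (F := fun v => KU v p) Ff Uq hKU hKeta Up (fun=> erefl) D).
Qed.
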